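(* Let $X\ge 16$ be a sufficiently large positive number and put $N:=\lfloor\sqrt{2\pi X}\rfloor$. Let $$q:=e^{-\tau+\frac{2\pi i h}{k}},$$ where $h,k$ are integers with $1\le h\le k\le N$ and $(h,k)=1$, and $\tau:=X^{-1}+2\pi i Y$ with $Y$ real and $|Y|\le \frac{1}{kN}$. Let $M$ be a positive integer and let $a$ be any of $1,2,\ldots,M$. Denote by $b$ the unique integer between $1$ and $(k,M)$ such that $b\equiv -ha \pmod{(k,M)}$, and write $$b^*:=\begin{cases}(k,M)-b & \text{if } b\ne (k,M),\\ (k,M) & \text{if } b=(k,M).\end{cases}$$ Then $$\Phi_{a,M}(q)=\frac{1}{\tau}\frac{(k,M)^2}{k^2 M}\left[\pi^2\left(\frac{b^2}{(k,M)^2}-\frac{b}{(k,M)}+\frac16\right)+2\pi i\left(-\zeta'\!\left(-1,\frac{b}{(k,M)}\right)+\zeta'\!\left(-1,\frac{b^*}{(k,M)}\right)\right)\right]+E,$$ where $$|\Re(E)|\ll_{M} X^{\frac12}\log X.$$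
   Context: $(m,n)$ denotes the greatest common divisor of integers $m,n$. For $|q|<1$, $(A;q)_\infty:=\prod_{j\ge0}(1-Aq^j)$, so that $(q^a;q^M)_\infty=\prod_{j\ge 0}(1-q^{a+jM})$. The function $\Phi_{a,M}$ is $$\Phi_{a,M}(q):=\log\left(\frac{1}{(q^a;q^M)_\infty}\right)=\sum_{\substack{m\ge 1\\ m\equiv a \bmod M}}\ \sum_{\ell\ge 1}\frac{q^{\ell m}}{\ell}\qquad(|q|<1).$$ $\zeta(s,\alpha)$ is the Hurwitz zeta function and $\zeta'(s,\alpha):=\frac{\partial}{\partial s}\zeta(s,\alpha)$. The notation $f\ll_M g$ means $|f|\le C g$ with a constant $C$ depending only on $M$ (in particular not on $X,h,k,Y,a$). *)

(* Defs.v *)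
From Stdlib Require Import Reals ZArith.
From Coquelicot Require Import Coquelicot.

Open Scope R_scope.

Definition Cexp (z : C) : C :=
  (exp (Re z) * cos (Im z), exp (Re z) * sin (Im z)).

(** [x ^ s] for [x > 0], with the real logarithm of [x]. *)
Definition Rpow_C (x : R) (s : C) : C := Cexp (s * RtoC (ln x))%C.

(** Componentwise sum; it is the sum of the series as soon as the series
    converges in [C], and a default value otherwise. *)
Definition CSeries (u : nat -> C) : C :=
  (Series (fun n => Re (u n)), Series (fun n => Im (u n))).

(** The branch of [log (1 / (q^a; q^M)_oo)] given by the double series
    [sum_(m >= 1, m = a mod M) sum_(l >= 1) q^(l m) / l], for [|q| < 1];
    here [m = i + 1] and [l = j + 1]. *)
Definition Phi (a M : Z) (q : C) : C :=
  CSeries (fun i : nat =>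
    if Z.eqb ((Z.of_nat (S i)) mod M) (a mod M)
    then CSeries (fun j : nat => (Cpow q (S j * S i) / RtoC (INR (S j)))%C)
    else RtoC 0).

Definition analytic_at (f : C -> C) (z : C) : Prop :=
  exists (r : R) (c : nat -> C), 0 < r /\
    forall w : C, Cmod (w - z) < r ->
      is_pseries (K := C_AbsRing) (V := C_NormedModule) c (w - z)%C (f w).

(** [f] is the Hurwitz zeta function [s |-> zeta(s, alpha)]: the analytic
    continuation to [C \ {1}] of [sum_(n >= 0) (n + alpha)^(-s)], [Re s > 1].
    This determines [f] on [C \ {1}]; its value at the pole is irrelevant. *)
Definition is_hurwitz_zeta_at (alpha : R) (f : C -> C) : Prop :=
  (forall s : C, s <> RtoC 1 -> analytic_at f s) /\
  (forall s : C, 1 < Re s ->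
     is_series (K := C_AbsRing) (V := C_NormedModule)
       (fun n : nat => Rpow_C (INR n + alpha) (- s)%C) (f s)).

Definition is_hurwitz_zeta (zeta : C -> R -> C) : Prop :=
  forall alpha : R, 0 < alpha ->
    is_hurwitz_zeta_at alpha (fun s : C => zeta s alpha).

(** [zeta'(s, alpha)], the derivative being with respect to [s]. *)
Definition dzeta (zeta : C -> R -> C) (s : C) (alpha : R) : C :=
  C_derive (fun s' : C => zeta s' alpha) s.

(** [Int_part] is the floor function. *)
Definition Nof (X : R) : Z := Int_part (sqrt (2 * PI * X)).

Definition tau (X Y : R) : C := (/ X, 2 * PI * Y).

Definition qpt (X Y : R) (h k : Z) : C :=
  Cexp (- tau X Y + RtoC (2 * PI) * Ci * RtoC (IZR h) / RtoC (IZR k))%C.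

Definition bstar (K b : Z) : Z := if Z.eqb b K then K else (K - b)%Z.

Definition main_term (zeta : C -> R -> C) (M : Z) (X Y : R) (k b : Z) : C :=
  let K := Z.gcd k M in
  let x := IZR b / IZR K in
  let xs := IZR (bstar K b) / IZR K in
  (RtoC 1 / tau X Y * RtoC (IZR K ^ 2 / (IZR k ^ 2 * IZR M))
   * (RtoC (PI ^ 2 * (IZR b ^ 2 / IZR K ^ 2 - IZR b / IZR K + 1 / 6))
      + RtoC (2 * PI) * Ci
        * (- dzeta zeta (RtoC (-1)) x + dzeta zeta (RtoC (-1)) xs)))%C.

(* Main.v *)
Require Import Defs.
From Stdlib Require Import Reals ZArith Lra Lia Psatz Classical.
From Coquelicot Require Import Coquelicot.

(** The proof computes the double series exactly up to trivial error terms. Summing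
    over [m] first, [Phi a M q] is the sum over [l >= 1] of
    [(1/l) q^(l a) / (1 - q^(l M))] ([Phi_series]). Write [K = (k, M)], [k' = k/K].
    If [k'] divides [l], then [q^(l M) = e^(-l M tau)] is close to [1], and the term
    is [e^(-2 pi i b l / k) / (l^2 M tau)] up to [O(1/l)]; otherwise [q^(l M)] is
    close to a [k']-th root of unity [w] other than [1], and [|1 - w| >= 1/k'], so the
    term is [O(k'/l)]. This holds as long as [l <= N / (64 M)], since then
    [|l M tau| <= 1 / (4 k)]. Larger [l] contribute at most the sum of the
    [2 X / l^2], which is [O(M sqrt X)]. As [k' <= N = O(sqrt X)], the total error is
    [O(sqrt X log X)] ([Phi_polar_estimate]).

    The polar parts add up to [K^2 / (k^2 M tau)] times the dilogarithm of
    [e^(-2 pi i x)], [x = b/K]. Abel summation gives the derivatives of its real and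
    imaginary parts in closed form ([primitive_limit_clausen_cos],
    [primitive_limit_clausen_sin]); the real part is then the Bernoulli polynomial
    ([clausen_cos_bernoulli]).

    It remains to see that [zeta'(-1,x) - zeta'(-1,1-x)] is the Clausen series
    [sum sin(2 pi n x) / n^2] divided by [2 pi] ([hurwitz_clausen]). For [Re s > 1],
    [zeta(s,x) - zeta(s,1-x) - x^(-s) + 2 x s zeta(s+1,1)] is the sum of
    [(n+x)^(-s) - (n-x)^(-s) + 2 x s n^(-s-1) = O(n^(-s-3))], a series that
    represents an analytic function for [Re s > -2]; the identity theorem along a
    segment from [2 + 3 i] to [-1] carries the relation to a neighbourhood of [-1].
    Differentiating there, [zeta'(-1,x) - zeta'(-1,1-x)] becomes an explicit series in
    [x], up to a multiple of [x]. Its derivative in [x] is [- ln (sin (PI x))] up to a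
    constant, by Euler's product ([ln_sine_product]), and so is that of the Clausen
    series. The two sides thus differ by an affine function, which vanishes at [0] by
    continuity and at [1/2] because both sides change sign under [x -> 1 - x]. *)

Open Scope R_scope.

(** * Complex series and interchange of summations *)

Ltac Rring := match goal with |- @eq _ ?x ?y => change (@eq R x y) end; ring.

Definition Cseries (u : nat -> C) (l : C) : Prop :=
  is_series (K := C_AbsRing) (V := C_NormedModule) u l.

Definition Csum (u : nat -> C) (n : nat) : C := sum_n (G := C_AbelianMonoid) u n.

Lemma INR_S_ge_1 (i : nat) : 1 <= INR (S i).
Proof. apply (le_INR 1). lia. Qed.

Lemma INR_S_pos (i : nat) : 0 < INR (S i).
Proof. apply lt_0_INR. lia. Qed.

Lemma inverse_square_pos (i : nat) : 0 < / INR (S i) ^ 2.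
Proof. apply Rinv_0_lt_compat, pow_lt, INR_S_pos. Qed.

Lemma continuous_of_ex_derive (f : R -> R) (x : R) : ex_derive f x -> continuous f x.
Proof. apply (ex_derive_continuous (K := R_AbsRing) (V := R_NormedModule)). Qed.

Lemma Cmod_le_components (z : C) : Cmod z <= Rabs (Re z) + Rabs (Im z).
Proof.
  unfold Cmod, Re, Im.
  rewrite <- (sqrt_pow2 (Rabs (fst z) + Rabs (snd z))).
  2: pose proof (Rabs_pos (fst z)); pose proof (Rabs_pos (snd z)); lra.
  apply sqrt_le_1_alt.
  rewrite <- (pow2_abs (fst z)), <- (pow2_abs (snd z)).
  pose proof (Rabs_pos (fst z)); pose proof (Rabs_pos (snd z)); nra.
Qed.

Lemma im_le_Cmod (z : C) : Rabs (Im z) <= Cmod z.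
Proof.
  eapply Rle_trans; [ | apply Rmax_Cmod ]. apply Rmax_r.
Qed.

Lemma Csum_0 (u : nat -> C) : Csum u 0 = u 0%nat.
Proof. exact (sum_O (G := C_AbelianMonoid) u). Qed.

Lemma Csum_S (u : nat -> C) n : Csum u (S n) = (Csum u n + u (S n))%C.
Proof. exact (@sum_Sn C_AbelianMonoid u n). Qed.

Lemma Csum_components (u : nat -> C) (n : nat) :
  Csum u n = (sum_n (fun k => Re (u k)) n, sum_n (fun k => Im (u k)) n).
Proof.
  induction n as [|n IH].
  - rewrite Csum_0, !sum_O. now destruct (u O).
  - rewrite Csum_S, IH, !sum_Sn. reflexivity.
Qed.

Lemma Rseries_eps (u : nat -> R) (l : R) :
  is_series u l <->
  (forall eps, 0 < eps -> exists N, forall n, (N <= n)%nat ->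
     Rabs (sum_n u n - l) < eps).
Proof.
  unfold is_series.
  rewrite (filterlim_locally (U := R_UniformSpace)). split.
  - intros H eps Heps. destruct (H (mkposreal eps Heps)) as [N HN].
    exists N. exact HN.
  - intros H [eps Heps]. destruct (H eps Heps) as [N HN]. now exists N.
Qed.

Lemma is_series_0 : is_series (fun _ : nat => 0) 0.
Proof.
  apply Rseries_eps. intros eps Heps. exists 0%nat. intros n _.
  rewrite sum_n_const, Rmult_0_r, Rminus_0_r, Rabs_R0. exact Heps.
Qed.

Lemma Series_0 : Series (fun _ => 0) = 0.
Proof. apply is_series_unique, is_series_0. Qed.

Lemma Cseries_components (u : nat -> C) (l : C) :
  Cseries u l <->
  is_series (fun n => Re (u n)) (Re l) /\ is_series (fun n => Im (u n)) (Im l).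
Proof.
  unfold Cseries, is_series.
  rewrite (filterlim_locally (U := C_UniformSpace)).
  rewrite !(filterlim_locally (U := R_UniformSpace)). split.
  - intros H. split; intros eps; destruct (H eps) as [N HN]; exists N;
      intros n Hn; destruct (HN n Hn) as [H1 H2].
    + pose proof (Csum_components u n) as E. unfold Csum, sum_n in *.
      change (@sum_n_m (NormedModule.AbelianMonoid C_AbsRing C_NormedModule))
        with (@sum_n_m C_AbelianMonoid) in H1.
      rewrite E in H1. exact H1.
    + pose proof (Csum_components u n) as E. unfold Csum, sum_n in *.
      change (@sum_n_m (NormedModule.AbelianMonoid C_AbsRing C_NormedModule))
        with (@sum_n_m C_AbelianMonoid) in H2.
      rewrite E in H2. exact H2.
  - intros [H1 H2] eps. destruct (H1 eps) as [N1 HN1], (H2 eps) as [N2 HN2].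
    exists (N1 + N2)%nat. intros n Hn.
    pose proof (Csum_components u n) as E. unfold Csum, sum_n in *.
    change (@sum_n_m (NormedModule.AbelianMonoid C_AbsRing C_NormedModule))
      with (@sum_n_m C_AbelianMonoid).
    rewrite E. split; [apply HN1 | apply HN2]; lia.
Qed.

Lemma Cseries_eps (u : nat -> C) (l : C) :
  Cseries u l <->
  (forall eps, 0 < eps -> exists N, forall n, (N <= n)%nat ->
     Cmod (Csum u n - l)%C < eps).
Proof.
  rewrite Cseries_components, !Rseries_eps. split.
  - intros [H1 H2] eps Heps.
    destruct (H1 (eps / 2)) as [N1 HN1]; [lra|].
    destruct (H2 (eps / 2)) as [N2 HN2]; [lra|].
    exists (N1 + N2)%nat. intros n Hn.
    rewrite Csum_components.
    eapply Rle_lt_trans; [apply Cmod_le_components|]. simpl.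
    specialize (HN1 n ltac:(lia)). specialize (HN2 n ltac:(lia)).
    unfold Re, Im, Rminus in *. lra.
  - intros H. split; intros eps Heps; destruct (H eps Heps) as [N HN];
      exists N; intros n Hn; specialize (HN n Hn);
      rewrite Csum_components in HN; eapply Rle_lt_trans; try exact HN.
    + eapply Rle_trans; [|apply re_le_Cmod]. apply Req_le. reflexivity.
    + eapply Rle_trans; [|apply im_le_Cmod]. apply Req_le. reflexivity.
Qed.

Lemma Cseries_unique (u : nat -> C) (l l' : C) :
  Cseries u l -> Cseries u l' -> l = l'.
Proof.
  rewrite !Cseries_components. intros [H1 H2] [H1' H2'].
  apply is_series_unique in H1, H2, H1', H2'.
  destruct l, l'. simpl in *. congruence.
Qed.

Lemma Cseries_CSeries (u : nat -> C) (l : C) : Cseries u l -> CSeries u = l.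
Proof.
  rewrite Cseries_components. intros [H1 H2]. unfold CSeries.
  rewrite (is_series_unique _ _ H1), (is_series_unique _ _ H2). now destruct l.
Qed.

Lemma CSeries_ext (u v : nat -> C) : (forall n, u n = v n) -> CSeries u = CSeries v.
Proof.
  intros H. unfold CSeries.
  rewrite (Series_ext (fun n => Re (u n)) (fun n => Re (v n))) by (intros; now rewrite H).
  rewrite (Series_ext (fun n => Im (u n)) (fun n => Im (v n))) by (intros; now rewrite H).
  reflexivity.
Qed.

Lemma Cseries_ext (u v : nat -> C) (l : C) :
  (forall n, u n = v n) -> Cseries u l -> Cseries v l.
Proof. apply is_series_ext. Qed.

Lemma Cseries_plus (u v : nat -> C) (a b : C) :
  Cseries u a -> Cseries v b -> Cseries (fun n => (u n + v n)%C) (a + b)%C.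
Proof. apply (is_series_plus u v a b). Qed.

Lemma Cseries_minus (u v : nat -> C) (a b : C) :
  Cseries u a -> Cseries v b -> Cseries (fun n => (u n - v n)%C) (a - b)%C.
Proof. apply (is_series_minus u v a b). Qed.

Lemma Cseries_scal (c : C) (u : nat -> C) (a : C) :
  Cseries u a -> Cseries (fun n => (c * u n)%C) (c * a)%C.
Proof. apply (is_series_scal c u a). Qed.

Lemma Rsum_S (u : nat -> R) n : sum_n u (S n) = sum_n u n + u (S n).
Proof. exact (@sum_Sn R_AbelianMonoid u n). Qed.

Lemma Rsum_scal (c : R) (u : nat -> R) n : sum_n (fun k => c * u k) n = c * sum_n u n.
Proof. exact (sum_n_mult_l (K := R_Ring) c u n). Qed.

Lemma Rsum_linear (c d : R) (u v : nat -> R) n :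
  sum_n (fun k => c * u k + d * v k) n = c * sum_n u n + d * sum_n v n.
Proof.
  rewrite <- !Rsum_scal. exact (sum_n_plus (G := R_AbelianMonoid) _ _ n).
Qed.

Lemma Rsum_nonneg_incr (u : nat -> R) :
  (forall n, 0 <= u n) -> forall n m, (n <= m)%nat -> sum_n u n <= sum_n u m.
Proof.
  intros H n m Hnm. induction Hnm as [|m Hnm IH]; [lra|].
  rewrite Rsum_S. specialize (H (S m)). lra.
Qed.

Lemma Rsum_le (u v : nat -> R) n :
  (forall k, u k <= v k) -> sum_n u n <= sum_n v n.
Proof.
  intros H. induction n as [|n IH]; [rewrite !sum_O; apply H|].
  rewrite !Rsum_S. specialize (H (S n)). lra.
Qed.

Lemma Rsum_nonneg (u : nat -> R) n : (forall k, 0 <= u k) -> 0 <= sum_n u n.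
Proof.
  intros H. induction n as [|n IH]; [rewrite sum_O; apply H|].
  rewrite Rsum_S. specialize (H (S n)). lra.
Qed.

Lemma Cmod_Csum (u : nat -> C) n :
  Cmod (Csum u n) <= sum_n (fun k => Cmod (u k)) n.
Proof.
  induction n as [|n IH]; [rewrite Csum_0, sum_O; lra|].
  rewrite Csum_S, Rsum_S. eapply Rle_trans; [apply Cmod_triangle|]. lra.
Qed.

Lemma Rabs_sum (u : nat -> R) n :
  Rabs (sum_n u n) <= sum_n (fun k => Rabs (u k)) n.
Proof.
  induction n as [|n IH]; [rewrite !sum_O; lra|].
  rewrite !Rsum_S. eapply Rle_trans; [apply Rabs_triang|]. lra.
Qed.

Lemma ex_series_bounded (u : nat -> R) (B : R) :
  (forall n, 0 <= u n) -> (forall n, sum_n u n <= B) -> ex_series u.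
Proof.
  intros H0 HB.
  assert (E : ex_finite_lim_seq (sum_n u)).
  { apply ex_finite_lim_seq_incr with B; [|exact HB].
    intros n. rewrite Rsum_S. specialize (H0 (S n)). lra. }
  destruct E as [l Hl]. exists l. exact Hl.
Qed.

Lemma series_le_bound (u : nat -> R) (l B : R) :
  is_series u l -> (forall n, sum_n u n <= B) -> l <= B.
Proof.
  intros Hl HB. rewrite Rseries_eps in Hl. apply Rnot_lt_le. intros Hlt.
  destruct (Hl (l - B)) as [N HN]; [lra|].
  specialize (HN N (Nat.le_refl N)). specialize (HB N).
  apply Rabs_lt_between in HN. lra.
Qed.

Lemma sum_le_series (u : nat -> R) (l : R) :
  (forall n, 0 <= u n) -> is_series u l -> forall n, sum_n u n <= l.
Proof.
  intros H0 Hl n. rewrite Rseries_eps in Hl. apply Rnot_lt_le. intros Hlt.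
  destruct (Hl (sum_n u n - l)) as [N HN]; [lra|].
  specialize (HN (n + N)%nat ltac:(lia)).
  pose proof (Rsum_nonneg_incr u H0 n (n + N) ltac:(lia)).
  apply Rabs_lt_between in HN. lra.
Qed.

Lemma Cseries_le_bound (u : nat -> C) (l : C) (B : R) :
  Cseries u l -> (forall n, sum_n (fun k => Cmod (u k)) n <= B) -> Cmod l <= B.
Proof.
  intros Hl HB. rewrite Cseries_eps in Hl. apply Rnot_lt_le. intros Hlt.
  destruct (Hl (Cmod l - B)) as [N HN]; [lra|].
  specialize (HN N (Nat.le_refl N)).
  pose proof (Rle_trans _ _ _ (Cmod_Csum u N) (HB N)).
  assert (Cmod l <= Cmod (Csum u N) + Cmod (Csum u N - l)%C).
  { rewrite <- (Cmod_opp (Csum u N - l)%C).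
    eapply Rle_trans; [|apply Cmod_triangle]. apply Req_le. f_equal. ring. }
  lra.
Qed.

Lemma Cseries_abs (u : nat -> C) :
  ex_series (fun n => Cmod (u n)) -> Cseries u (CSeries u).
Proof.
  intros H. rewrite Cseries_components. split; apply Series_correct;
    apply ex_series_Rabs.
  - apply (@ex_series_le R_AbsRing R_CompleteNormedModule) with (2 := H).
    intros n. change (Rabs (Rabs (Re (u n))) <= Cmod (u n)).
    rewrite Rabs_Rabsolu. apply re_le_Cmod.
  - apply (@ex_series_le R_AbsRing R_CompleteNormedModule) with (2 := H).
    intros n. change (Rabs (Rabs (Im (u n))) <= Cmod (u n)).
    rewrite Rabs_Rabsolu. apply im_le_Cmod.
Qed.

Lemma ex_series_le_nonneg (u v : nat -> R) :
  (forall n, 0 <= u n <= v n) -> ex_series v -> ex_series u.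
Proof.
  intros H. apply (@ex_series_le R_AbsRing R_CompleteNormedModule).
  intros n. change (Rabs (u n) <= v n). rewrite Rabs_pos_eq; apply H.
Qed.

(** Fubini for real double series: the rectangles [i <= I, j <= J] are off by
    at most the tail of [V] beyond [I], uniformly in [J]. *)
Lemma fubini_real (u : nat -> nat -> R) (V : nat -> R) :
  (forall i J, sum_n (fun j => Rabs (u i j)) J <= V i) -> ex_series V ->
  is_series (fun j => Series (fun i => u i j)) (Series (fun i => Series (u i))).
Proof.
  intros HV [v Hv].
  assert (HV0 : forall i, 0 <= V i).
  { intros i. eapply Rle_trans; [|apply (HV i 0%nat)]. rewrite sum_O.
    apply Rabs_pos. }
  assert (Hij : forall i j, Rabs (u i j) <= V i).
  { intros i j. eapply Rle_trans; [|apply (HV i j)]. destruct j.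
    - rewrite sum_O. lra.
    - rewrite Rsum_S. pose proof (Rsum_nonneg (fun j => Rabs (u i j)) j
        (fun k => Rabs_pos _)). lra. }
  assert (Hrow : forall i, is_series (u i) (Series (u i))).
  { intros i. apply Series_correct, ex_series_Rabs.
    apply ex_series_bounded with (V i); [intros; apply Rabs_pos|apply HV]. }
  assert (Hrow' : forall i, Rabs (Series (u i)) <= V i).
  { intros i. assert (E : ex_series (fun j => Rabs (u i j))).
    { apply ex_series_bounded with (V i); [intros; apply Rabs_pos|apply HV]. }
    eapply Rle_trans; [apply Series_Rabs, E|].
    apply series_le_bound with (1 := Series_correct _ E). apply HV. }
  assert (Hcol : forall j, is_series (fun i => u i j) (Series (fun i => u i j))).
  { intros j. apply Series_correct, ex_series_Rabs.
    apply ex_series_le_nonneg with V; [|now exists v].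
    intros i. split; [apply Rabs_pos|apply Hij]. }
  assert (Htot : is_series (fun i => Series (u i)) (Series (fun i => Series (u i)))).
  { apply Series_correct, ex_series_Rabs.
    apply ex_series_le_nonneg with V; [|now exists v].
    intros i. split; [apply Rabs_pos|apply Hrow']. }
  set (T := Series (fun i => Series (u i))) in *.
  assert (Hswap : forall J, is_series (fun i => sum_n (u i) J)
            (sum_n (fun j => Series (fun i => u i j)) J)).
  { induction J as [|J IH].
    - apply is_series_ext with (fun i => u i 0%nat).
      + intros i. now rewrite sum_O.
      + rewrite sum_O. apply Hcol.
    - apply is_series_ext with (fun i => sum_n (u i) J + u i (S J)).
      + intros i. now rewrite Rsum_S.
      + rewrite Rsum_S. apply (is_series_plus _ _ _ _ IH (Hcol (S J))). }
  rewrite Rseries_eps. intros eps Heps.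
  rewrite Rseries_eps in Hv. destruct (Hv (eps / 16)) as [I HI]; [lra|].
  assert (HI0 := HI I (Nat.le_refl I)). apply Rabs_lt_between in HI0.
  assert (Hfin : forall e, 0 < e -> exists J0, forall J, (J0 <= J)%nat ->
            Rabs (sum_n (fun i => sum_n (u i) J - Series (u i)) I) < e).
  { clear -Hrow. induction I as [|I IH]; intros e He.
    - specialize (Hrow 0%nat). rewrite Rseries_eps in Hrow.
      destruct (Hrow e) as [J0 H]; [lra|]. exists J0. intros J HJ.
      rewrite sum_O. now apply H.
    - destruct (IH (e / 2)) as [J2 HJ2]; [lra|].
      specialize (Hrow (S I)). rewrite Rseries_eps in Hrow.
      destruct (Hrow (e / 2)) as [J3 HJ3]; [lra|].
      exists (J2 + J3)%nat. intros J HJ. rewrite Rsum_S.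
      specialize (HJ2 J ltac:(lia)). specialize (HJ3 J ltac:(lia)).
      eapply Rle_lt_trans; [apply Rabs_triang|]. lra. }
  destruct (Hfin (eps / 4)) as [J0 HJ0]; [lra|]. exists J0. intros J HJ. specialize (HJ0 J HJ).
  pose proof (is_series_minus _ _ _ _ (Hswap J) Htot) as D.
  change (is_series (fun i => sum_n (u i) J - Series (u i))
            (sum_n (fun j => Series (fun i => u i j)) J - T)) in D.
  set (d := fun i => sum_n (u i) J - Series (u i)) in *.
  assert (Hd : forall i, Rabs (d i) <= 2 * V i).
  { intros i. unfold d. eapply Rle_trans; [apply Rabs_triang|].
    rewrite Rabs_Ropp. pose proof (Hrow' i).
    pose proof (Rle_trans _ _ _ (Rabs_sum (u i) J) (HV i J)). lra. }
  assert (Htail : forall n, (I <= n)%nat ->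
            Rabs (sum_n d n - sum_n d I) <= 2 * (sum_n V n - sum_n V I)).
  { intros n Hn. induction Hn as [|n Hn IH].
    - rewrite !Rminus_diag, Rabs_R0. lra.
    - rewrite !Rsum_S. specialize (Hd (S n)).
      replace (sum_n d n + d (S n) - sum_n d I)
        with ((sum_n d n - sum_n d I) + d (S n)) by ring.
      eapply Rle_trans; [apply Rabs_triang|]. lra. }
  rewrite Rseries_eps in D. destruct (D (eps / 8)) as [N HN]; [lra|].
  specialize (HN (N + I)%nat ltac:(lia)). specialize (Htail (N + I)%nat ltac:(lia)).
  specialize (HI (N + I)%nat ltac:(lia)). apply Rabs_lt_between in HI.
  apply Rabs_lt_between in HN, HJ0. apply Rabs_le_between in Htail.
  apply Rabs_lt_between.
  lra.
Qed.

Lemma fubini_complex (u : nat -> nat -> C) (V : nat -> R) :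
  (forall i J, sum_n (fun j => Cmod (u i j)) J <= V i) -> ex_series V ->
  Cseries (fun j => CSeries (fun i => u i j)) (CSeries (fun i => CSeries (u i))).
Proof.
  intros HV HexV. apply Cseries_components. split.
  - apply (fubini_real (fun i j => Re (u i j)) V); [|exact HexV].
    intros i J. eapply Rle_trans; [|apply (HV i J)].
    apply Rsum_le. intros; apply re_le_Cmod.
  - apply (fubini_real (fun i j => Im (u i j)) V); [|exact HexV].
    intros i J. eapply Rle_trans; [|apply (HV i J)].
    apply Rsum_le. intros; apply im_le_Cmod.
Qed.

(** * The complex exponential *)

Lemma Cexp_plus (z w : C) : Cexp (z + w)%C = (Cexp z * Cexp w)%C.
Proof.
  destruct z as [a b], w as [c d]. unfold Cexp, Cplus, Cmult, Re, Im. simpl.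
  rewrite exp_plus, cos_plus, sin_plus. f_equal; ring.
Qed.

Lemma Cexp_0 : Cexp 0 = 1.
Proof. unfold Cexp. simpl. rewrite exp_0, cos_0, sin_0. unfold RtoC. f_equal; ring. Qed.

Lemma Cmod_Cexp (z : C) : Cmod (Cexp z) = exp (Re z).
Proof.
  unfold Cexp, Cmod. simpl.
  replace (_ + _) with (exp (Re z) ^ 2).
  - apply sqrt_pow2. left. apply exp_pos.
  - pose proof (sin2_cos2 (Im z)) as H. unfold Rsqr in H. 
    transitivity (exp (Re z) ^ 2 * (sin (Im z) * sin (Im z) + cos (Im z) * cos (Im z))).
    + rewrite H. ring.
    + ring.
Qed.

Lemma Cexp_neq_0 (z : C) : Cexp z <> 0.
Proof. apply Cmod_gt_0. rewrite Cmod_Cexp. apply exp_pos. Qed.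

Lemma Cexp_opp (z : C) : Cexp (- z)%C = (/ Cexp z)%C.
Proof.
  assert (H : (Cexp z * Cexp (- z) = 1)%C).
  { rewrite <- Cexp_plus, <- Cexp_0. f_equal. ring. }
  rewrite <- (Cmult_1_l (/ Cexp z)%C), <- H. field. apply Cexp_neq_0.
Qed.

Lemma Cexp_pow (z : C) (n : nat) : (Cexp z ^ n)%C = Cexp (RtoC (INR n) * z)%C.
Proof.
  induction n as [|n IH].
  - simpl. rewrite <- Cexp_0. f_equal. ring.
  - rewrite Cpow_S, IH, <- Cexp_plus, S_INR, RtoC_plus. f_equal. ring.
Qed.

Lemma Cexp_2PI_nat (n : nat) : Cexp (RtoC (2 * PI) * Ci * RtoC (INR n))%C = 1.
Proof.
  replace (RtoC (2 * PI) * Ci * RtoC (INR n))%C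
    with (RtoC (INR n) * ((0, 2 * PI)%R : C))%C.
  - rewrite <- Cexp_pow. unfold Cexp at 1. simpl.
    rewrite exp_0, cos_2PI, sin_2PI, !Rmult_1_l. apply Cpow_1_l.
  - unfold Ci, RtoC, Cmult. simpl. f_equal; ring.
Qed.

Lemma Cexp_2PI_Z (n : Z) : Cexp (RtoC (2 * PI) * Ci * RtoC (IZR n))%C = 1.
Proof.
  destruct (Z_le_gt_dec 0 n) as [H|H].
  - rewrite <- (Z2Nat.id n H), <- INR_IZR_INZ. apply Cexp_2PI_nat.
  - replace (RtoC (2 * PI) * Ci * RtoC (IZR n))%C
      with (- (RtoC (2 * PI) * Ci * RtoC (INR (Z.to_nat (- n)))))%C.
    + rewrite Cexp_opp, Cexp_2PI_nat. field.
    + rewrite INR_IZR_INZ, Z2Nat.id, opp_IZR, RtoC_opp by lia. ring.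
Qed.

Lemma exp_series_bound (r : R) n : 0 <= r ->
  sum_n (fun k => r ^ k / INR (fact k)) n <= exp r.
Proof.
  intros Hr. apply sum_le_series.
  - intros k. apply Rmult_le_pos; [now apply pow_le|].
    left. apply Rinv_0_lt_compat, INR_fact_lt_0.
  - pose proof (is_exp_Reals r) as H. rewrite is_pseries_R in H.
    eapply is_series_ext; [|exact H]. intros k. simpl. unfold Rdiv. apply Rmult_comm.
Qed.

Lemma Cmod_exp_term (z : C) k :
  Cmod (z ^ k / RtoC (INR (fact k)))%C = Cmod z ^ k / INR (fact k).
Proof.
  rewrite Cmod_div, Cmod_pow, Cmod_R, Rabs_pos_eq; [easy|apply pos_INR|].
  intros H. apply RtoC_inj in H. now apply (INR_fact_neq_0 k).
Qed.

Lemma CV_radius_ge_abs (a : nat -> R) (r : R) :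
  ex_series (fun k => Rabs (a k * r ^ k)) -> Rbar_le r (CV_radius a).
Proof.
  intros H. unfold CV_radius.
  destruct (Lub_Rbar_correct (CV_disk a)) as [Hub _]. now apply Hub.
Qed.

Lemma CV_radius_infinite (a : nat -> R) :
  (forall r, 0 <= r -> ex_series (fun k => Rabs (a k * r ^ k))) ->
  CV_radius a = p_infty.
Proof.
  intros H. pose proof (CV_radius_ge_0 a) as H0.
  destruct (CV_radius a) as [r| |] eqn:E; [|reflexivity|easy].
  exfalso. simpl in H0.
  pose proof (CV_radius_ge_abs a (r + 1) (H (r + 1) ltac:(lra))) as H1.
  rewrite E in H1. simpl in H1. lra.
Qed.

(** Along the ray [t |-> t z] the exponential series and [Cexp] solve the same
    linear differential equation, so their quotient is constant. *)
Lemma Cexp_series (z : C) :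
  Cseries (fun k => (z ^ k / RtoC (INR (fact k)))%C) (Cexp z).
Proof.
  set (a := fun k => Re (z ^ k / RtoC (INR (fact k)))%C).
  set (b := fun k => Im (z ^ k / RtoC (INR (fact k)))%C).
  assert (Ha : forall k, Rabs (a k) <= Cmod z ^ k / INR (fact k)).
  { intros k. rewrite <- Cmod_exp_term. apply re_le_Cmod. }
  assert (Hb : forall k, Rabs (b k) <= Cmod z ^ k / INR (fact k)).
  { intros k. rewrite <- Cmod_exp_term. apply im_le_Cmod. }
  assert (Hcv : forall c, (forall k, Rabs (c k) <= Cmod z ^ k / INR (fact k)) ->
            CV_radius c = p_infty).
  { intros c Hc. apply CV_radius_infinite. intros r Hr.
    apply ex_series_le_nonneg with (fun k => (Cmod z * r) ^ k / INR (fact k)).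
    - intros k. split; [apply Rabs_pos|].
      rewrite Rabs_mult, Rpow_mult_distr, (Rabs_pos_eq (r ^ k)) by now apply pow_le.
      specialize (Hc k). unfold Rdiv in *.
      replace (Cmod z ^ k * r ^ k * / INR (fact k))
        with (Cmod z ^ k * / INR (fact k) * r ^ k) by ring.
      apply Rmult_le_compat_r; [now apply pow_le|exact Hc].
    - apply ex_series_bounded with (exp (Cmod z * r)).
      + intros k. apply Rmult_le_pos.
        * apply pow_le, Rmult_le_pos; [apply Cmod_ge_0|exact Hr].
        * left. apply Rinv_0_lt_compat, INR_fact_lt_0.
      + intros n. apply exp_series_bound.
        apply Rmult_le_pos; [apply Cmod_ge_0|exact Hr]. }
  pose proof (Hcv a Ha) as Ra. pose proof (Hcv b Hb) as Rb.
  assert (Sk : forall k, (INR (S k) * (z ^ S k / INR (fact (S k))))%C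
             = (z * (z ^ k / INR (fact k)))%C).
  { intros k. rewrite fact_simpl, mult_INR, RtoC_mult, Cpow_S. field.
    split; intros H; apply RtoC_inj in H.
    - now apply (INR_fact_neq_0 k).
    - now apply (not_0_INR (S k)). }
  assert (D : forall c u v, CV_radius c = p_infty ->
            (forall k, INR (S k) * c (S k) = u * a k + v * b k) ->
            forall t, is_derive (PSeries c) t (u * PSeries a t + v * PSeries b t)).
  { intros c u v Rc Hc t. replace (u * PSeries a t + v * PSeries b t)
      with (PSeries (PS_derive c) t); [apply is_derive_PSeries; now rewrite Rc|].
    rewrite <- !PSeries_scal, <- PSeries_plus.
    - apply PSeries_ext, Hc.
    - apply ex_pseries_scal; [apply Rmult_comm|apply CV_radius_inside; now rewrite Ra].
    - apply ex_pseries_scal; [apply Rmult_comm|apply CV_radius_inside; now rewrite Rb]. }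
  assert (Da := D a (Re z) (- Im z) Ra). assert (Db := D b (Im z) (Re z) Rb).
  lapply Da; [clear Da; intros Da|]; [lapply Db; [clear Db; intros Db|]|].
  2, 3: intros k; specialize (Sk k); pose proof (f_equal Re Sk) as S1;
    pose proof (f_equal Im Sk) as S2; unfold a, b; unfold Re, Im in *; simpl in *; lra.
  set (x := Re z) in *. set (y := Im z) in *.
  set (p := fun t => exp (- (x * t)) * (cos (y * t) * PSeries a t + sin (y * t) * PSeries b t)).
  set (q := fun t => exp (- (x * t)) * (cos (y * t) * PSeries b t - sin (y * t) * PSeries a t)).
  assert (p01 : p 0 = p 1).
  { apply (eq_is_derive p 0 1); [|lra]. intros t _. unfold p.
    auto_derive.
    - repeat split; eexists; [apply Da|apply Db].
    - rewrite (is_derive_unique (fun u : R => PSeries a u) _ _ (Da t)), (is_derive_unique (fun u : R => PSeries b u) _ _ (Db t)).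
      unfold zero; simpl. ring. }
  assert (q01 : q 0 = q 1).
  { apply (eq_is_derive q 0 1); [|lra]. intros t _. unfold q.
    auto_derive.
    - repeat split; eexists; [apply Db|apply Da].
    - rewrite (is_derive_unique (fun u : R => PSeries a u) _ _ (Da t)), (is_derive_unique (fun u : R => PSeries b u) _ _ (Db t)).
      unfold zero; simpl. ring. }
  unfold p in p01. unfold q in q01.
  rewrite !PSeries_0, !Rmult_0_r, Ropp_0, exp_0, cos_0, sin_0 in p01, q01.
  rewrite !Rmult_1_r in p01, q01.
  assert (a0 : a 0%nat = 1). { unfold a. simpl. field. }
  assert (b0 : b 0%nat = 0). { unfold b. simpl. field. }
  rewrite a0, b0 in p01, q01.
  rewrite exp_Ropp in p01, q01. pose proof (exp_pos x) as Hx.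
  apply (f_equal (Rmult (exp x))) in p01, q01.
  rewrite <- (Rmult_assoc (exp x) (/ exp x)), Rinv_r in p01, q01 by lra.
  pose proof (sin2_cos2 y) as sc. unfold Rsqr in sc.
  assert (A1 : PSeries a 1 = exp x * cos y).
  { pose proof (f_equal (Rmult (cos y)) p01). pose proof (f_equal (Rmult (sin y)) q01).
    pose proof (f_equal (Rmult (PSeries a 1)) sc). lra. }
  assert (B1 : PSeries b 1 = exp x * sin y).
  { pose proof (f_equal (Rmult (sin y)) p01). pose proof (f_equal (Rmult (cos y)) q01).
    pose proof (f_equal (Rmult (PSeries b 1)) sc). lra. }
  apply Cseries_components. unfold Cexp. cbn [Re Im fst snd]. fold x y a b.
  split.
  - rewrite <- A1. apply is_series_ext with (fun k => a k * 1 ^ k).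
    + intros k. rewrite pow1. apply Rmult_1_r.
    + apply (is_pseries_R a 1 (PSeries a 1)), PSeries_correct, CV_radius_inside. now rewrite Ra.
  - rewrite <- B1. apply is_series_ext with (fun k => b k * 1 ^ k).
    + intros k. rewrite pow1. apply Rmult_1_r.
    + apply (is_pseries_R b 1 (PSeries b 1)), PSeries_correct, CV_radius_inside. now rewrite Rb.
Qed.

Lemma geometric_sum_le (r : R) n : 0 <= r < 1 -> sum_n (fun k => r ^ k) n <= / (1 - r).
Proof.
  intros Hr. apply sum_le_series.
  - intros k. apply pow_le, Hr.
  - apply is_series_geom. rewrite Rabs_pos_eq; apply Hr.
Qed.

Lemma exp_term_le (r : R) k : 0 <= r -> r ^ k / INR (fact k) <= r ^ k.
Proof.
  intros Hr. assert (1 <= INR (fact k)).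
  { apply (le_INR 1). apply lt_O_fact. }
  apply Rle_div_l; [lra|]. pose proof (pow_le r k Hr). nra.
Qed.

Lemma Cmod_Cexp_sub_1 (z : C) : Cmod z <= 1 / 2 -> Cmod (Cexp z - 1)%C <= 2 * Cmod z.
Proof.
  intros Hz. pose proof (Cmod_ge_0 z) as H0.
  apply Cseries_le_bound with
    (fun k => (z ^ S k / RtoC (INR (fact (S k))))%C).
  - refine (is_series_incr_1 (fun k => (z ^ k / RtoC (INR (fact k)))%C) _ _).
    simpl Cpow. simpl fact.
    replace (plus _ _) with (Cexp z); [apply Cexp_series|].
    change (Cexp z = (Cexp z - 1) + 1 / 1)%C. field.
  - intros n. apply Rle_trans with (sum_n (fun k => Cmod z * Cmod z ^ k) n).
    + apply Rsum_le. intros k. rewrite Cmod_exp_term.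
      apply (exp_term_le (Cmod z) (S k)), H0.
    + rewrite Rsum_scal.
      rewrite (Rmult_comm 2). apply Rmult_le_compat_l; [exact H0|].
      eapply Rle_trans; [apply geometric_sum_le; lra|].
      rewrite <- (Rinv_inv 2). apply Rinv_le_contravar; lra.
Qed.

Lemma Cmod_Cexp_sub_1_sub (z : C) :
  Cmod z <= 1 / 2 -> Cmod (Cexp z - 1 - z)%C <= 2 * Cmod z ^ 2.
Proof.
  intros Hz. pose proof (Cmod_ge_0 z) as H0.
  apply Cseries_le_bound with
    (fun k => (z ^ S (S k) / RtoC (INR (fact (S (S k)))))%C).
  - refine (is_series_incr_1 (fun k => (z ^ (S k) / RtoC (INR (fact (S k))))%C) _ _).
    refine (is_series_incr_1 (fun k => (z ^ k / RtoC (INR (fact k)))%C) _ _).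
    simpl Cpow. simpl fact.
    replace (plus _ _) with (Cexp z); [apply Cexp_series|].
    change (Cexp z = (Cexp z - 1 - z) + (z * 1) / 1 + 1 / 1)%C. field.
  - intros n. apply Rle_trans with (sum_n (fun k => Cmod z ^ 2 * Cmod z ^ k) n).
    + apply Rsum_le. intros k. rewrite Cmod_exp_term, <- pow_add.
      apply (exp_term_le (Cmod z) (S (S k))), H0.
    + rewrite Rsum_scal.
      rewrite (Rmult_comm 2). apply Rmult_le_compat_l; [now apply pow_le|].
      eapply Rle_trans; [apply geometric_sum_le; lra|].
      rewrite <- (Rinv_inv 2). apply Rinv_le_contravar; lra.
Qed.

(** * The double series as a sum of geometric series *)

Lemma Cmod_one_minus_ge (Q : C) : 1 - Cmod Q <= Cmod (1 - Q)%C.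
Proof.
  assert (Cmod 1 <= Cmod (1 - Q)%C + Cmod Q).
  { eapply Rle_trans; [|apply Cmod_triangle]. apply Req_le. f_equal. ring. }
  rewrite Cmod_1 in H. lra.
Qed.

Lemma one_minus_neq_0 (Q : C) : Cmod Q < 1 -> (1 - Q)%C <> 0.
Proof.
  intros H. apply Cmod_gt_0. pose proof (Cmod_one_minus_ge Q). lra.
Qed.

Lemma pow_le_self (r : R) n : 0 <= r < 1 -> (1 <= n)%nat -> r ^ n <= r.
Proof.
  intros Hr Hn. destruct n as [|n]; [lia|]. simpl.
  assert (r ^ n <= 1 ^ n) by (apply pow_incr; lra). rewrite pow1 in *. nra.
Qed.

Lemma Csum_single (u : nat -> C) (p n : nat) :
  (p <= n)%nat -> (forall i, (i <= n)%nat -> i <> p -> u i = 0) -> Csum u n = u p.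
Proof.
  intros Hp H. 
  assert (Z0 : forall m, (m < p)%nat -> Csum u m = RtoC 0).
  { intros m Hm. induction m as [|m IH].
    - rewrite Csum_0. apply H; lia.
    - rewrite Csum_S, IH, (H (S m)) by lia. ring. }
  induction Hp as [|n Hp IH].
  - destruct p as [|p]; [apply Csum_0|]. rewrite Csum_S, Z0 by lia. ring.
  - rewrite Csum_S, IH, (H (S n)) by (intros; try apply H; lia). ring.
Qed.

(** Multiplication by [Q^M] shifts the series by [M] places, and only one of its
    first [M] terms is non-zero; so its sum [T] satisfies [T = Q^a + Q^M T]. *)
Lemma residue_class_series (Q : C) (a M : Z) :
  (1 <= a <= M)%Z -> Cmod Q < 1 ->
  Cseries (fun i => if Z.eqb (Z.of_nat (S i) mod M) (a mod M) then (Q ^ S i)%C else 0)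
    (Q ^ Z.to_nat a / (1 - Q ^ Z.to_nat M))%C.
Proof.
  intros Ha HQ.
  set (u := fun i => if Z.eqb (Z.of_nat (S i) mod M) (a mod M) then (Q ^ S i)%C else 0).
  pose proof (Cmod_ge_0 Q) as HQ0.
  assert (Hu : Cseries u (CSeries u)).
  { apply Cseries_abs, ex_series_le_nonneg with (fun i => Cmod Q ^ i).
    - intros i. split; [apply Cmod_ge_0|]. unfold u.
      destruct (Z.eqb _ _).
      + rewrite Cmod_pow. simpl. pose proof (pow_le (Cmod Q) i HQ0). nra.
      + rewrite Cmod_0. now apply pow_le.
    - eexists. apply is_series_geom. now rewrite Rabs_pos_eq. }
  set (m := Z.to_nat M).
  assert (HM : (Cmod (Q ^ m)%C < 1)).
  { rewrite Cmod_pow. eapply Rle_lt_trans; [apply pow_le_self|exact HQ]; [lra|].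
    unfold m. lia. }
  assert (Hshift : Cseries (fun i => u (m + i)%nat) (CSeries u - Q ^ Z.to_nat a)%C).
  { apply (is_series_incr_n u); [unfold m; lia|].
    replace (plus _ _) with (CSeries u); [exact Hu|].
    change (sum_n u (Init.Nat.pred m)) with (Csum u (Init.Nat.pred m)).
    replace (Csum u (Init.Nat.pred m)) with (Q ^ Z.to_nat a)%C.
    - change (CSeries u = CSeries u - Q ^ Z.to_nat a + Q ^ Z.to_nat a)%C. ring.
    - symmetry. etransitivity.
      + apply (Csum_single u (Z.to_nat a - 1)%nat (Init.Nat.pred m)).
        * unfold m. lia.
        * intros i Hi Hne. unfold u. destruct (Z.eqb_spec (Z.of_nat (S i) mod M) (a mod M)) as [E|]; [|reflexivity].
          exfalso. apply Hne.
          destruct (Z.eq_dec a M) as [->|Hn].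
          -- rewrite Z_mod_same_full in E.
             destruct (Z.eq_dec (Z.of_nat (S i)) M); [lia|].
             rewrite Z.mod_small in E by (unfold m in Hi; lia). lia.
          -- rewrite (Z.mod_small a) in E by lia.
             destruct (Z.eq_dec (Z.of_nat (S i)) M) as [Ei|].
             ++ rewrite Ei, Z_mod_same_full in E. lia.
             ++ rewrite Z.mod_small in E by (unfold m in Hi; lia). lia.
      + unfold u. replace (S (Z.to_nat a - 1)) with (Z.to_nat a) by lia.
        rewrite Z2Nat.id by lia. now rewrite Z.eqb_refl. }
  assert (Hmul : Cseries (fun i => u (m + i)%nat) (Q ^ m * CSeries u)%C).
  { apply Cseries_ext with (fun i => (Q ^ m * u i)%C); [|now apply Cseries_scal].
    intros i. unfold u.
    replace (Z.of_nat (S (m + i)) mod M)%Z with (Z.of_nat (S i) mod M)%Z.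
    - destruct (Z.eqb _ _); [|ring].
      rewrite <- Cpow_add_r. f_equal. lia.
    - replace (Z.of_nat (S (m + i))) with (Z.of_nat (S i) + 1 * M)%Z by (unfold m; lia).
      now rewrite Z_mod_plus_full. }
  replace (Q ^ Z.to_nat a / (1 - Q ^ m))%C with (CSeries u); [exact Hu|].
  pose proof (Cseries_unique _ _ _ Hshift Hmul) as E.
  replace (Q ^ Z.to_nat a)%C with (CSeries u * (1 - Q ^ m))%C.
  - field. now apply one_minus_neq_0.
  - transitivity (CSeries u - Q ^ m * CSeries u)%C; [ring|]. rewrite <- E. ring.
Qed.

Lemma CSeries_0 : CSeries (fun _ => RtoC 0) = 0.
Proof. apply Cseries_CSeries, Cseries_components. split; apply is_series_0. Qed.

(** Summing over the residue class first: [|q ^ ((i+1)(j+1))| <= |q|^(i+1) |q|^j]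
    makes the double series absolutely convergent. *)
Lemma Phi_series (q : C) (a M : Z) :
  (1 <= a <= M)%Z -> Cmod q < 1 ->
  Cseries (fun j => (/ RtoC (INR (S j)) *
      ((q ^ S j) ^ Z.to_nat a / (1 - (q ^ S j) ^ Z.to_nat M)))%C) (Phi a M q).
Proof.
  intros Ha Hq. pose proof (Cmod_ge_0 q) as Hq0.
  set (c := fun i => Z.eqb (Z.of_nat (S i) mod M) (a mod M)).
  set (u := fun i j => if c i then (q ^ (S j * S i) / RtoC (INR (S j)))%C else 0).
  assert (E1 : Phi a M q = CSeries (fun i => CSeries (u i))).
  { unfold Phi. apply CSeries_ext. intros i. fold (c i). unfold u.
    destruct (c i); [reflexivity|]. now rewrite CSeries_0. }
  rewrite E1.
  assert (Hnz : forall j, RtoC (INR (S j)) <> 0).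
  { intros j H. apply RtoC_inj in H. now apply (not_0_INR (S j)). }
  apply Cseries_ext with (fun j => CSeries (fun i => u i j)).
  - intros j. apply Cseries_CSeries.
    apply Cseries_ext with (fun i => (/ RtoC (INR (S j)) *
      (if c i then ((q ^ S j) ^ S i)%C else 0))%C).
    + intros i. unfold u. destruct (c i); [|ring].
      rewrite <- Cpow_mult_r. unfold Cdiv. ring.
    + apply Cseries_scal, residue_class_series; [exact Ha|].
      rewrite Cmod_pow. eapply Rle_lt_trans; [apply pow_le_self|exact Hq]; [lra|lia].
  - apply fubini_complex with (fun i => Cmod q ^ i * / (1 - Cmod q)).
    + intros i J. apply Rle_trans with (sum_n (fun j => Cmod q ^ i * Cmod q ^ j) J).
      * apply Rsum_le. intros j. unfold u. destruct (c i).
        -- rewrite Cmod_div, Cmod_R, Rabs_pos_eq, Cmod_pow by (try apply pos_INR; apply Hnz).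
           apply Rle_div_l; [apply lt_0_INR; lia|].
           rewrite <- pow_add.
           apply Rle_trans with (Cmod q ^ (i + j) * 1).
           ++ rewrite Rmult_1_r. replace (S j * S i)%nat with ((i + j) + S (i * j))%nat by lia.
              rewrite pow_add, <- (Rmult_1_r (Cmod q ^ (i + j))), Rmult_assoc, Rmult_1_l.
              apply Rmult_le_compat_l; [now apply pow_le|].
              rewrite <- (pow1 (S (i * j))). apply pow_incr. lra.
           ++ apply Rmult_le_compat_l; [now apply pow_le|]. apply (le_INR 1). lia.
        -- rewrite Cmod_0. apply Rmult_le_pos; now apply pow_le.
      * rewrite Rsum_scal.
        apply Rmult_le_compat_l; [now apply pow_le|]. apply geometric_sum_le. lra.
    + exists (/ (1 - Cmod q) * / (1 - Cmod q)). apply is_series_scal_r.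
      apply is_series_geom. now rewrite Rabs_pos_eq.
Qed.

(** * The terms of the series near and away from the cusp *)

(** The powers [w^j], [j < n], sum to [0], so the numbers [1 - w^j] sum to [n];
    each of them is at most [n |1 - w|]. *)
Lemma root_of_unity_gap (w : C) (n : nat) :
  (w ^ n)%C = 1 -> w <> 1 -> Cmod w = 1 -> (1 <= n)%nat ->
  / INR n <= Cmod (1 - w)%C.
Proof.
  intros Hwn Hw1 Hmod Hn. destruct n as [|m]; [lia|].
  assert (Hgeo : forall p, ((1 - w) * Csum (fun j => w ^ j) p = 1 - w ^ S p)%C).
  { induction p as [|p IH].
    - rewrite Csum_0. simpl. ring.
    - rewrite Csum_S, Cmult_plus_distr_l, IH. simpl. ring. }
  assert (Hw : (1 - w)%C <> 0).
  { intros H. apply Hw1. replace w with (1 - (1 - w))%C by ring. rewrite H. ring. }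
  assert (Hsum0 : Csum (fun j => w ^ j)%C m = 0).
  { replace (Csum (fun j => w ^ j)%C m)
      with ((1 - w) * Csum (fun j => w ^ j) m / (1 - w))%C by (field; exact Hw).
    rewrite Hgeo, Hwn. field. exact Hw. }
  assert (Hcount : forall p, Csum (fun j => 1 - w ^ j)%C p
                   = (INR (S p) - Csum (fun j => w ^ j) p)%C).
  { induction p as [|p IH].
    - rewrite !Csum_0. simpl. ring.
    - rewrite !Csum_S, IH, (S_INR (S p)), RtoC_plus. ring. }
  assert (Hone : forall j, Cmod (1 - w ^ j)%C <= INR j * Cmod (1 - w)%C).
  { induction j as [|j IH].
    - simpl. replace (1 - 1)%C with (RtoC 0) by ring. rewrite Cmod_0. lra.
    - replace (1 - w ^ S j)%C with ((1 - w ^ j) + w ^ j * (1 - w))%C by (simpl; ring).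
      eapply Rle_trans; [apply Cmod_triangle|].
      rewrite Cmod_mult, Cmod_pow, Hmod, pow1, S_INR. lra. }
  pose proof (Cmod_Csum (fun j => 1 - w ^ j)%C m) as H.
  rewrite Hcount, Hsum0 in H.
  replace (INR (S m) - 0)%C with (RtoC (INR (S m))) in H by ring.
  rewrite Cmod_R, Rabs_pos_eq in H by apply pos_INR.
  assert (Hle : forall p, (p <= m)%nat ->
    sum_n (fun j => Cmod (1 - w ^ j)%C) p <= INR (S p) * (INR (S m) * Cmod (1 - w)%C)).
  { pose proof (Cmod_ge_0 (1 - w)%C) as H0.
    assert (Hj : forall j, (j <= m)%nat ->
              Cmod (1 - w ^ j)%C <= INR (S m) * Cmod (1 - w)%C).
    { intros j Hj. eapply Rle_trans; [apply Hone|].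
      apply Rmult_le_compat_r; [exact H0|]. apply le_INR. lia. }
    induction p as [|p IH]; intros Hp.
    - rewrite sum_O. specialize (Hj 0%nat Hp). simpl (INR 1). lra.
    - rewrite Rsum_S, (S_INR (S p)). specialize (IH ltac:(lia)).
      specialize (Hj (S p) Hp). lra. }
  specialize (Hle m (Nat.le_refl m)).
  pose proof (INR_S_pos m) as Hpos.
  apply Rmult_le_reg_l with (INR (S m)); [exact Hpos|].
  rewrite Rinv_r by lra.
  apply Rmult_le_reg_l with (INR (S m)); [exact Hpos|]. lra.
Qed.

(** [1 / (1 - e^(-z))] has a simple pole with residue [1] at [0]; the bound is
    uniform because both [z (e^(-theta z) - 1)] and [e^(-z) - 1 + z] are [O(z^2)]. *)
Lemma exp_over_one_minus_exp (z : C) (theta : R) :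
  z <> 0 -> Cmod z <= 1 / 4 -> 0 <= theta <= 1 ->
  Cmod (Cexp (- (theta * z)) / (1 - Cexp (- z)) - 1 / z)%C <= 8.
Proof.
  intros Hz Hsmall Ht.
  assert (Hpos : 0 < Cmod z) by now apply Cmod_gt_0.
  assert (Hden : Cmod z / 2 <= Cmod (1 - Cexp (- z))%C).
  { pose proof (Cmod_Cexp_sub_1_sub (- z)%C) as H. rewrite Cmod_opp in H.
    specialize (H ltac:(lra)).
    assert (Cmod z <= Cmod (1 - Cexp (- z))%C + Cmod (Cexp (- z) - 1 - - z)%C).
    { eapply Rle_trans; [|apply Cmod_triangle]. apply Req_le. f_equal. ring. }
    nra. }
  assert (Hden0 : (1 - Cexp (- z))%C <> 0) by (apply Cmod_gt_0; lra).
  replace (Cexp (- (theta * z)) / (1 - Cexp (- z)) - 1 / z)%C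
    with ((z * (Cexp (- (theta * z)) - 1) + (Cexp (- z) - 1 - - z))
          / (z * (1 - Cexp (- z))))%C by (field; now split).
  rewrite Cmod_div by now apply Cmult_neq_0.
  rewrite Cmod_mult. apply Rle_div_l; [nra|].
  eapply Rle_trans; [apply Cmod_triangle|]. rewrite Cmod_mult.
  pose proof (Cmod_Cexp_sub_1_sub (- z)%C) as H1. rewrite Cmod_opp in H1.
  specialize (H1 ltac:(lra)).
  pose proof (Cmod_Cexp_sub_1 (- (theta * z))%C) as H2.
  rewrite Cmod_opp, Cmod_mult, Cmod_R, Rabs_pos_eq in H2 by lra.
  assert (Hth : theta * Cmod z <= Cmod z) by nra.
  specialize (H2 ltac:(lra)).
  assert (Cmod z * Cmod (Cexp (- (theta * z)) - 1)%C <= Cmod z * (2 * Cmod z))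
    by (apply Rmult_le_compat_l; lra).
  nra.
Qed.

(** With [r = |Q|] the quotient is at most [r / (1 - r) = 1 / (e^y - 1)]. *)
Lemma geometric_quotient_le (Q : C) (y : R) (a M : nat) :
  Cmod Q = exp (- y) -> 0 < y -> (1 <= a)%nat -> (1 <= M)%nat ->
  Cmod (Q ^ a / (1 - Q ^ M))%C <= / y.
Proof.
  intros HQ Hy Ha HM. set (r := exp (- y)) in *.
  assert (Hr : 0 < r < 1).
  { split; [apply exp_pos|]. unfold r. rewrite <- exp_0. apply exp_increasing. lra. }
  pose proof (pow_le_self r a ltac:(lra) Ha). pose proof (pow_le_self r M ltac:(lra) HM).
  pose proof (Cmod_one_minus_ge (Q ^ M)%C) as H1.
  rewrite Cmod_pow, HQ in H1.
  rewrite Cmod_div by (apply Cmod_gt_0; lra). rewrite Cmod_pow, HQ.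
  apply Rle_div_l; [lra|].
  assert (r * (1 + y) <= 1).
  { pose proof (exp_ineq1_le y). unfold r. rewrite exp_Ropp.
    apply Rmult_le_reg_l with (exp y); [apply exp_pos|].
    rewrite <- Rmult_assoc, Rinv_r, Rmult_1_l, Rmult_1_r; [lra|].
    pose proof (exp_pos y). lra. }
  apply Rmult_le_reg_l with y; [exact Hy|]. rewrite <- Rmult_assoc, Rinv_r by lra.
  assert (y * r ^ a <= y * r) by (apply Rmult_le_compat_l; lra). lra.
Qed.

Lemma Cexp_2PI_eq_1 (x : R) :
  Cexp (RtoC (2 * PI) * Ci * RtoC x)%C = 1 -> exists n : Z, x = IZR n.
Proof.
  intros H. replace (RtoC (2 * PI) * Ci * RtoC x)%C with ((0, 2 * (PI * x))%R : C) in H.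
  2: { unfold Ci, RtoC, Cmult. simpl. f_equal; ring. }
  unfold Cexp in H. simpl in H. rewrite exp_0 in H. injection H as H1 _.
  rewrite cos_2a_sin in H1.
  assert (Hs : sin (PI * x) = 0) by nra.
  destruct (sin_eq_0_0 _ Hs) as [n Hn]. exists n.
  apply Rmult_eq_reg_l with PI; [lra|apply PI_neq0].
Qed.

(** The polar part lives on the multiples of a denominator; spreading it over all
    indices allows it to be subtracted term by term. *)
Lemma series_on_multiples (f : nat -> C) (k : nat) (l : C) :
  (1 <= k)%nat -> Cseries f l ->
  Cseries (fun i => if Nat.eqb (S i mod k) 0 then f (S i / k - 1)%nat else 0) l.
Proof.
  intros Hk Hf.
  set (g := fun i => if Nat.eqb (S i mod k) 0 then f (S i / k - 1)%nat else 0).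
  assert (Hsum : forall n, Csum g n
            = match (S n / k)%nat with O => 0 | S p => Csum f p end).
  { assert (Hstep : forall n, (if Nat.eqb (S n mod k) 0 then S n / k = S (n / k) else S n / k = n / k)%nat).
    { intros n. pose proof (Nat.div_mod_eq (S n) k) as E1. pose proof (Nat.div_mod_eq n k) as E2.
      pose proof (Nat.mod_upper_bound (S n) k ltac:(lia)).
      pose proof (Nat.mod_upper_bound n k ltac:(lia)).
      set (x := (S n / k)%nat) in *. set (y := (n / k)%nat) in *.
      set (r := (S n mod k)%nat) in *. set (r' := (n mod k)%nat) in *.
      clearbody x y r r'. destruct (Nat.eqb_spec r 0).
      - destruct (Nat.lt_trichotomy x (S y)) as [L|[L|L]]; [|exact L|].
        + assert (k * x <= k * y)%nat by (apply Nat.mul_le_mono_l; lia). lia.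
        + assert (k * (y + 2) <= k * x)%nat by (apply Nat.mul_le_mono_l; lia). lia.
      - destruct (Nat.lt_trichotomy x y) as [L|[L|L]]; [|exact L|].
        + assert (k * (x + 1) <= k * y)%nat by (apply Nat.mul_le_mono_l; lia). lia.
        + assert (k * (y + 1) <= k * x)%nat by (apply Nat.mul_le_mono_l; lia). lia. }
    induction n as [|n IH].
    - rewrite Csum_0. unfold g. pose proof (Hstep 0%nat) as H.
      rewrite Nat.Div0.div_0_l in H.
      destruct (Nat.eqb_spec (1 mod k) 0); rewrite H; [|reflexivity].
      now rewrite Csum_0.
    - rewrite Csum_S, IH. unfold g. pose proof (Hstep (S n)) as H.
      destruct (Nat.eqb (S (S n) mod k) 0); rewrite H.
      + destruct (S n / k)%nat as [|p].
        * rewrite Csum_0. simpl. ring.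
        * rewrite Csum_S. now replace (S (S p) - 1)%nat with (S p) by lia.
      + destruct (S n / k)%nat; ring. }
  rewrite Cseries_eps in *. intros eps Heps. destruct (Hf eps Heps) as [N HN].
  exists (k * (N + 1))%nat. intros n Hn. rewrite Hsum.
  assert (Hq : (N + 1 <= S n / k)%nat).
  { apply Nat.div_le_lower_bound; lia. }
  destruct (S n / k)%nat as [|p]; [lia|]. apply HN. lia.
Qed.

Lemma Cmod_unit_phase (x : R) : Cmod (Cexp (RtoC (2 * PI) * Ci * RtoC x)%C) = 1.
Proof.
  rewrite Cmod_Cexp, <- exp_0. f_equal. unfold Ci, RtoC, Cmult, Re. simpl. ring.
Qed.

Lemma Cmod_unit_phase_opp (x : R) :
  Cmod (Cexp (- (RtoC (2 * PI) * Ci * RtoC x))%C) = 1.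
Proof.
  rewrite Cexp_opp, Cmod_inv, Cmod_unit_phase by apply Cexp_neq_0. apply Rinv_1.
Qed.

Lemma qpt_pow (X Y : R) (h k : Z) (l n : nat) :
  k <> 0%Z ->
  ((qpt X Y h k ^ l) ^ n)%C
  = (Cexp (- (RtoC (INR l * INR n) * tau X Y))
     * Cexp (RtoC (2 * PI) * Ci * RtoC (INR l * INR n * IZR h / IZR k)))%C.
Proof.
  intros Hk. unfold qpt. rewrite !Cexp_pow, <- Cexp_plus. f_equal.
  unfold Rdiv. rewrite !RtoC_mult, RtoC_inv by now apply not_0_IZR.
  unfold Cdiv. ring.
Qed.

Lemma Cmod_qpt_pow (X Y : R) (h k : Z) (l : nat) :
  k <> 0%Z -> Cmod (qpt X Y h k ^ l)%C = exp (- (INR l / X)).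
Proof.
  intros Hk. replace (qpt X Y h k ^ l)%C with ((qpt X Y h k ^ l) ^ 1)%C by apply Cpow_1_r.
  rewrite qpt_pow, Cmod_mult, Cmod_unit_phase, Cmod_Cexp, Rmult_1_r by exact Hk.
  f_equal. unfold tau, RtoC, Cmult, Copp, Re. simpl. unfold Rdiv. ring.
Qed.

Lemma Cmod_tau_le (X Y : R) : 0 < X -> Cmod (tau X Y) <= / X + 8 * Rabs Y.
Proof.
  intros HX. eapply Rle_trans; [apply Cmod_le_components|]. unfold tau. simpl.
  rewrite (Rabs_pos_eq (/ X)) by (left; now apply Rinv_0_lt_compat).
  rewrite Rabs_mult, (Rabs_pos_eq (2 * PI)) by (pose proof PI_RGT_0; lra).
  pose proof PI_4. pose proof (Rabs_pos Y). nra.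
Qed.

Lemma Cmod_tau_ge (X Y : R) : 0 < X -> / X <= Cmod (tau X Y).
Proof.
  intros HX. eapply Rle_trans; [|apply re_le_Cmod]. unfold tau. simpl. apply Rle_abs.
Qed.

Lemma Zgcd_pos_l (k M : Z) : (1 <= k)%Z -> (1 <= Z.gcd k M)%Z.
Proof.
  intros Hk. pose proof (Z.gcd_nonneg k M). assert (Z.gcd k M <> 0)%Z; [|lia].
  intros E. apply Z.gcd_eq_0_l in E. lia.
Qed.

Section Cusp.

Variables (X Y : R) (h k M : Z).
Hypothesis (HX : 0 < X) (Hk : (1 <= k)%Z) (HM : (1 <= M)%Z).
Hypothesis Hhk : Z.gcd h k = 1%Z.

Let K := Z.gcd k M.
Let kp := (k / K)%Z.
Let q := qpt X Y h k.

Lemma cusp_K_pos : (1 <= K)%Z.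
Proof. now apply Zgcd_pos_l. Qed.

Lemma cusp_k_split : k = (kp * K)%Z.
Proof.
  unfold kp. pose proof cusp_K_pos.
  pose proof (Z.gcd_divide_l k M) as [c Hc]. fold K in Hc.
  rewrite Hc at 2. rewrite Z.div_mul by lia. exact Hc.
Qed.

Lemma cusp_kp_pos : (1 <= kp)%Z.
Proof. pose proof cusp_K_pos. pose proof cusp_k_split. nia. Qed.

Lemma cusp_reals : 1 <= IZR kp /\ 1 <= IZR K /\ IZR k = IZR kp * IZR K.
Proof.
  split; [apply (IZR_le 1), cusp_kp_pos|]. split; [apply (IZR_le 1), cusp_K_pos|].
  rewrite cusp_k_split at 1. apply mult_IZR.
Qed.

(** [q^(l M)] is within [2 |l M tau|] of [e^(2 pi i l M h / k)], a [kp]-th root of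
    unity; it is not [1] because [M h / K] is prime to [kp]. *)
Lemma away_from_cusp (l : nat) :
  (Z.of_nat l mod kp <> 0)%Z ->
  Cmod (RtoC (INR l * IZR M) * tau X Y)%C <= / (4 * IZR k) ->
  / (2 * IZR kp) <= Cmod (1 - (q ^ l) ^ Z.to_nat M)%C.
Proof.
  intros Hl Hz. pose proof cusp_K_pos as HK. pose proof cusp_kp_pos as Hkp.
  pose proof cusp_k_split as Ek.
  pose proof (Z.gcd_divide_r k M) as [M' HM']. fold K in HM'.
  destruct cusp_reals as [Rkp [RK Rk]].
  unfold q. rewrite qpt_pow by lia.
  rewrite (INR_IZR_INZ (Z.to_nat M)), Z2Nat.id by lia.
  set (zeta := (RtoC (INR l * IZR M) * tau X Y)%C) in *.
  replace (INR l * IZR M * IZR h / IZR k)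
    with (IZR (Z.of_nat l * (M' * h)) / IZR kp).
  2: { rewrite !mult_IZR, <- INR_IZR_INZ, Rk, HM', mult_IZR. field. lra. }
  set (p := (Z.of_nat l * (M' * h))%Z).
  set (w := Cexp (RtoC (2 * PI) * Ci * RtoC (IZR p / IZR kp))%C).
  assert (Hw1 : w <> 1).
  { intros E. apply Cexp_2PI_eq_1 in E. destruct E as [n Hn].
    assert (Ep : p = (n * kp)%Z).
    { apply eq_IZR. rewrite mult_IZR, <- Hn. field. lra. }
    assert (G1 : Z.gcd kp M' = 1%Z).
    { pose proof (Z.gcd_div_gcd k M K ltac:(lia) eq_refl) as G.
      replace (M / K)%Z with M' in G by (rewrite HM'; symmetry; apply Z.div_mul; lia).
      exact G. }
    assert (G2 : Z.gcd kp h = 1%Z).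
    { apply Z.bezout_1_gcd. destruct (Z.gcd_bezout h k 1 Hhk) as [u [v Huv]].
      exists (v * K)%Z, u. rewrite Ek in Huv. lia. }
    assert (D : (kp | M' * h * Z.of_nat l)%Z) by (exists n; unfold p in Ep; lia).
    assert (G : Z.gcd kp (M' * h) = 1%Z).
    { apply Z.bezout_1_gcd.
      destruct (Z.gcd_bezout _ _ 1 G1) as [u [v Huv]].
      destruct (Z.gcd_bezout _ _ 1 G2) as [u' [v' Huv']].
      exists (u * u' * kp + u * v' * h + v * M' * u')%Z, (v * v')%Z. nia. }
    apply Z.gauss in D; [|exact G].
    apply Hl. now apply Z.mod_divide; [lia|]. }
  assert (Hwk : (w ^ Z.to_nat kp)%C = 1).
  { unfold w. rewrite Cexp_pow, <- (Cexp_2PI_Z p). f_equal.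
    rewrite INR_IZR_INZ, Z2Nat.id by lia.
    rewrite RtoC_div by lra. field.
    intros H. apply RtoC_inj in H. lra. }
  assert (Hwm : Cmod w = 1) by apply Cmod_unit_phase.
  pose proof (root_of_unity_gap w (Z.to_nat kp) Hwk Hw1 Hwm ltac:(lia)) as Hgap.
  rewrite INR_IZR_INZ, Z2Nat.id in Hgap by lia.
  assert (Hle : / (4 * IZR k) <= / (4 * IZR kp)).
  { apply Rinv_le_contravar; [lra|]. rewrite Rk. nra. }
  assert (Hlt : / (4 * IZR kp) <= 1 / 4).
  { apply Rle_trans with (/ 4); [|lra]. apply Rinv_le_contravar; lra. }
  pose proof (Cmod_Cexp_sub_1 (- zeta)%C) as Hs. rewrite Cmod_opp in Hs.
  specialize (Hs ltac:(lra)).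
  assert (Htri : Cmod (1 - w)%C <= Cmod (1 - Cexp (- zeta) * w)%C + Cmod (Cexp (- zeta) - 1)%C).
  { replace (Cmod (Cexp (- zeta) - 1)%C) with (Cmod ((Cexp (- zeta) - 1) * w)%C)
      by (rewrite Cmod_mult, Hwm; ring).
    eapply Rle_trans; [|apply Cmod_triangle]. apply Req_le. f_equal. ring. }
  replace (/ (2 * IZR kp)) with (/ IZR kp - 2 * / (4 * IZR kp)) by (field; lra).
  lra.
Qed.

(** Here [l M h / k] is an integer, and [l a h / k] differs from [- b j / K] by one. *)
Lemma at_cusp (l j : nat) (a b : Z) :
  (1 <= a)%Z -> (b mod K = (- (h * a)) mod K)%Z -> Z.of_nat l = (kp * Z.of_nat j)%Z ->
  ((q ^ l) ^ Z.to_nat M = Cexp (- (RtoC (INR l * IZR M) * tau X Y)))%C /\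
  ((q ^ l) ^ Z.to_nat a
   = Cexp (- (RtoC (IZR a / IZR M) * (RtoC (INR l * IZR M) * tau X Y)))
     * Cexp (- (RtoC (2 * PI) * Ci * RtoC (IZR b / IZR K * INR j))))%C.
Proof.
  intros Ha Hb Hl. pose proof cusp_K_pos as HK. pose proof cusp_kp_pos as Hkp.
  pose proof cusp_k_split as Ek.
  pose proof (Z.gcd_divide_r k M) as [M' HM']. fold K in HM'.
  assert (RM : 1 <= IZR M) by now apply (IZR_le 1).
  destruct cusp_reals as [Rkp [RK Rk]].
  assert (Rl : INR l = IZR kp * INR j) by (rewrite !INR_IZR_INZ, Hl; apply mult_IZR).
  unfold q. rewrite !qpt_pow by lia.
  rewrite !(INR_IZR_INZ (Z.to_nat _)), !Z2Nat.id by lia. split.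
  - replace (INR l * IZR M * IZR h / IZR k) with (IZR (Z.of_nat j * M' * h)).
    + rewrite Cexp_2PI_Z. ring.
    + rewrite !mult_IZR, <- INR_IZR_INZ, Rk, Rl, HM', mult_IZR. field. lra.
  - assert (Hm : exists c : Z, (h * a = c * K - b)%Z).
    { exists ((h * a + b) / K)%Z.
      assert ((h * a + b) mod K = 0)%Z.
      { rewrite Z.add_mod, Hb, <- Z.add_mod by lia.
        replace (h * a + - (h * a))%Z with 0%Z by ring. apply Z.mod_0_l. lia. }
      pose proof (Z_div_mod_eq_full (h * a + b) K). lia. }
    destruct Hm as [c Hc].
    replace (INR l * IZR a * IZR h / IZR k)
      with (IZR (Z.of_nat j * c) + - (IZR b / IZR K * INR j)).
    + rewrite RtoC_plus, Cmult_plus_distr_l, Cexp_plus, Cexp_2PI_Z.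
      f_equal.
      * f_equal. rewrite RtoC_div, !RtoC_mult by lra. field.
        intros H. apply RtoC_inj in H. lra.
      * rewrite RtoC_opp, Cmult_1_l. f_equal. ring.
    + apply (f_equal IZR) in Hc. rewrite minus_IZR, !mult_IZR in Hc.
      rewrite mult_IZR, <- INR_IZR_INZ, Rk, Rl.
      replace (IZR kp * INR j * IZR a * IZR h / (IZR kp * IZR K))
        with (INR j * (IZR h * IZR a) / IZR K) by (field; lra).
      rewrite Hc. field. lra.
Qed.

End Cusp.

(** The terms of the dilogarithm of [e^(-2 pi i x)]. *)
Definition phase_term (x : R) (j : nat) : C :=
  (Cexp (- (RtoC (2 * PI) * Ci * RtoC (x * INR (S j)))) / RtoC (INR (S j) ^ 2))%C.

Section Terms.

Variables (X Y : R) (h k M a b : Z).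
Hypothesis (HX : 0 < X) (Hk : (1 <= k)%Z) (Ha : (1 <= a <= M)%Z).
Hypothesis Hhk : Z.gcd h k = 1%Z.
Hypothesis Hb : (b mod Z.gcd k M = (- (h * a)) mod Z.gcd k M)%Z.

Let K := Z.gcd k M.
Let kp := (k / K)%Z.
Let q := qpt X Y h k.

Definition geometric_term (i : nat) : C :=
  (/ RtoC (INR (S i)) * ((q ^ S i) ^ Z.to_nat a / (1 - (q ^ S i) ^ Z.to_nat M)))%C.

(** The principal part in [tau] of [geometric_term] at the indices for which
    [q^(l M)] tends to [1] with [tau]. *)
Definition polar_term (i : nat) : C :=
  if Nat.eqb (S i mod Z.to_nat kp) 0
  then (RtoC 1 / tau X Y * RtoC (IZR K ^ 2 / (IZR k ^ 2 * IZR M))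
        * phase_term (IZR b / IZR K) (S i / Z.to_nat kp - 1))%C
  else 0.

Lemma tau_neq_0 : tau X Y <> 0.
Proof.
  apply Cmod_gt_0. eapply Rlt_le_trans; [|now apply Cmod_tau_ge].
  now apply Rinv_0_lt_compat.
Qed.

(** At an index divisible by [k/K] the geometric term is [1/l] times a unit
    times [e^(-theta z) / (1 - e^(-z))], [z = l M tau]; the polar term replaces
    this quotient by [1/z]. *)
Lemma polar_term_at_multiple (i j : nat) :
  (S i = Z.to_nat kp * S j)%nat ->
  polar_term i
  = (/ RtoC (INR (S i)) * (Cexp (- (RtoC (2 * PI) * Ci * RtoC (IZR b / IZR K * INR (S j))))
      * (1 / (RtoC (INR (S i) * IZR M) * tau X Y))))%C.
Proof.
  intros Hij.
  pose proof (cusp_kp_pos k M Hk) as Hkp. fold K kp in Hkp.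
  destruct (cusp_reals k M Hk) as [Rkp [RK Rk]]. fold K kp in Rkp, RK, Rk.
  assert (RM : 1 <= IZR M) by (apply (IZR_le 1); lia).
  assert (Rl : INR (S i) = IZR kp * INR (S j)).
  { rewrite Hij, mult_INR. f_equal. rewrite INR_IZR_INZ, Z2Nat.id; [reflexivity|lia]. }
  pose proof (INR_S_pos j) as Rj.
  unfold polar_term.
  replace (Nat.eqb (S i mod Z.to_nat kp) 0) with true.
  2: { symmetry. apply Nat.eqb_eq. rewrite Hij, Nat.mul_comm. apply Nat.Div0.mod_mul. }
  replace (S i / Z.to_nat kp - 1)%nat with j.
  2: { rewrite Hij, Nat.mul_comm, Nat.div_mul by lia. lia. }
  unfold phase_term. rewrite Rl, Rk. pose proof tau_neq_0 as Ht.
  set (e := Cexp _).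
  rewrite RtoC_div by (apply Rgt_not_eq; apply Rmult_lt_0_compat; [apply pow_lt|]; nra).
  rewrite !RtoC_mult, !RtoC_pow, !RtoC_mult.
  assert (RtoC (IZR kp) <> 0) by (intros E; apply RtoC_inj in E; lra).
  assert (RtoC (IZR K) <> 0) by (intros E; apply RtoC_inj in E; lra).
  assert (RtoC (IZR M) <> 0) by (intros E; apply RtoC_inj in E; lra).
  assert (RtoC (INR (S j)) <> 0) by (intros E; apply RtoC_inj in E; lra).
  field. repeat split; assumption.
Qed.

Lemma multiple_index (i : nat) : (S i mod Z.to_nat kp)%nat = 0%nat ->
  exists j, (S i = Z.to_nat kp * S j)%nat.
Proof.
  intros E. pose proof (Nat.div_mod_eq (S i) (Z.to_nat kp)) as D. rewrite E in D.
  destruct (S i / Z.to_nat kp)%nat as [|j]; [lia|]. exists j. lia.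
Qed.

Lemma geometric_term_tail (i : nat) :
  Cmod (geometric_term i) <= X / INR (S i) ^ 2.
Proof.
  pose proof (INR_S_pos i) as Rl.
  unfold geometric_term. rewrite Cmod_mult, Cmod_inv, Cmod_R, Rabs_pos_eq by
    (try lra; intros E; apply RtoC_inj in E; lra).
  pose proof (geometric_quotient_le (q ^ S i)%C (INR (S i) / X) (Z.to_nat a) (Z.to_nat M)) as G.
  specialize (G ltac:(unfold q; apply Cmod_qpt_pow; lia)
    ltac:(apply Rdiv_lt_0_compat; lra) ltac:(lia) ltac:(lia)).
  apply Rle_trans with (/ INR (S i) * / (INR (S i) / X)).
  - apply Rmult_le_compat_l; [|exact G]. left. now apply Rinv_0_lt_compat.
  - apply Req_le. field. lra.
Qed.

Lemma polar_term_tail (i : nat) : Cmod (polar_term i) <= X / INR (S i) ^ 2.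
Proof.
  pose proof (INR_S_pos i) as Rl.
  assert (Hp : 0 < X / INR (S i) ^ 2) by (apply Rdiv_lt_0_compat; [lra|now apply pow_lt]).
  destruct (Nat.eq_dec (S i mod Z.to_nat kp) 0) as [E|E].
  2: { unfold polar_term. rewrite (proj2 (Nat.eqb_neq _ _) E), Cmod_0. lra. }
  pose proof (cusp_kp_pos k M Hk) as Hkp. fold K kp in Hkp.
  assert (RM : 1 <= IZR M) by (apply (IZR_le 1); lia).
  destruct (multiple_index i E) as [j Hj]. rewrite (polar_term_at_multiple i j Hj).
  pose proof tau_neq_0 as Ht. pose proof (Cmod_tau_ge X Y HX) as Hge.
  assert (0 < / X) by now apply Rinv_0_lt_compat.
  rewrite !Cmod_mult, Cmod_inv, Cmod_R, Rabs_pos_eq by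
    (try lra; intros E0; apply RtoC_inj in E0; lra).
  rewrite Cmod_unit_phase_opp, Rmult_1_l, Cmod_div, Cmod_1, Cmod_mult, Cmod_R, Rabs_pos_eq.
  - apply Rle_trans with (/ INR (S i) * (1 / (INR (S i) * / X))).
    + apply Rmult_le_compat_l; [left; now apply Rinv_0_lt_compat|].
      unfold Rdiv. rewrite !Rmult_1_l. apply Rinv_le_contravar; [nra|].
      apply Rmult_le_compat; [nra|lra|nra|exact Hge].
    + apply Req_le. field. lra.
  - nra.
  - apply Cmult_neq_0; [|exact Ht]. intros E0; apply RtoC_inj in E0. nra.
Qed.

Lemma term_difference_tail (i : nat) :
  Cmod (geometric_term i - polar_term i)%C <= 2 * X / INR (S i) ^ 2.
Proof.
  eapply Rle_trans; [apply Cmod_triangle|]. rewrite Cmod_opp.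
  pose proof (geometric_term_tail i). pose proof (polar_term_tail i).
  replace (2 * X / INR (S i) ^ 2) with (X / INR (S i) ^ 2 + X / INR (S i) ^ 2); [lra|].
  unfold Rdiv. ring.
Qed.

Lemma term_difference_small (i : nat) :
  Cmod (RtoC (INR (S i) * IZR M) * tau X Y)%C <= / (4 * IZR k) ->
  Cmod (geometric_term i - polar_term i)%C <= (2 * IZR k + 8) / INR (S i).
Proof.
  intros Hz.
  pose proof (INR_S_pos i) as Rl.
  assert (HM : (1 <= M)%Z) by lia.
  pose proof (cusp_kp_pos k M Hk) as Hkp. fold K kp in Hkp.
  destruct (cusp_reals k M Hk) as [Rkp [RK Ek]]. fold K kp in Rkp, RK, Ek.
  assert (RM : 1 <= IZR M) by now apply (IZR_le 1).
  assert (Rk : IZR kp <= IZR k) by (rewrite Ek; nra). assert (Rk1 : 1 <= IZR k) by lra.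
  assert (Hl0 : RtoC (INR (S i)) <> 0) by (intros E; apply RtoC_inj in E; lra).
  assert (Hil : 0 < / INR (S i)) by now apply Rinv_0_lt_compat.
  destruct (Nat.eq_dec (S i mod Z.to_nat kp) 0) as [E|E].
  - destruct (multiple_index i E) as [j Hj]. rewrite (polar_term_at_multiple i j Hj).
    unfold geometric_term.
    destruct (at_cusp X Y h k M Hk HM (S i) (S j) a b ltac:(lia) Hb) as [E1 E2].
    { fold K kp. rewrite Hj, Nat2Z.inj_mul, Z2Nat.id; lia. }
    fold q in E1, E2. rewrite E1, E2. fold K.
    set (zeta := (RtoC (INR (S i) * IZR M) * tau X Y)%C) in *.
    set (e := Cexp (- (RtoC (2 * PI) * Ci * RtoC (IZR b / IZR K * INR (S j))))%C).
    assert (He : Cmod e = 1).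
    { apply Cmod_unit_phase_opp. }
    assert (Hz0 : zeta <> 0).
    { apply Cmult_neq_0; [|apply tau_neq_0]. intros E0; apply RtoC_inj in E0. nra. }
    pose proof (exp_over_one_minus_exp zeta (IZR a / IZR M) Hz0) as B.
    assert (H4 : / (4 * IZR k) <= 1 / 4).
    { apply Rle_trans with (/ 4); [|lra]. apply Rinv_le_contravar; lra. }
    specialize (B ltac:(lra)).
    assert (Hth : 0 <= IZR a / IZR M <= 1).
    { assert (1 <= IZR a <= IZR M) by (split; [apply (IZR_le 1)|apply IZR_le]; lia).
      split; [apply Rdiv_le_0_compat; lra|]. apply Rle_div_l; lra. }
    specialize (B Hth).
    replace (_ - _)%C with (/ RtoC (INR (S i)) * e
      * (Cexp (- (RtoC (IZR a / IZR M) * zeta)) / (1 - Cexp (- zeta)) - 1 / zeta))%C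
      by (unfold Cdiv; ring).
    rewrite !Cmod_mult, He, Cmod_inv, Cmod_R, Rabs_pos_eq by (assumption || lra).
    rewrite Rmult_1_r, Rmult_comm. unfold Rdiv.
    apply Rmult_le_compat_r; lra.
  - unfold polar_term. rewrite (proj2 (Nat.eqb_neq _ _) E).
    replace (geometric_term i - 0)%C with (geometric_term i) by ring.
    unfold geometric_term.
    assert (Hmod : (Z.of_nat (S i) mod kp <> 0)%Z).
    { intros H0. apply E. apply Nat2Z.inj. rewrite Nat2Z.inj_mod, Z2Nat.id; [|lia]. exact H0. }
    pose proof (away_from_cusp X Y h k M Hk HM Hhk (S i) Hmod Hz) as G. fold q K kp in G.
    assert (G0 : 0 < / (2 * IZR kp)) by (apply Rinv_0_lt_compat; lra).
    rewrite Cmod_mult, Cmod_inv, Cmod_R, Rabs_pos_eq by (assumption || lra).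
    rewrite Cmod_div by (apply Cmod_gt_0; lra).
    rewrite Cmod_pow. unfold Rdiv at 2. rewrite (Rmult_comm (2 * IZR k + 8)).
    apply Rmult_le_compat_l; [lra|].
    assert (Hq1 : Cmod (q ^ S i)%C <= 1).
    { unfold q. rewrite Cmod_qpt_pow by lia. rewrite <- exp_0. left. apply exp_increasing.
      assert (0 < INR (S i) / X) by (apply Rdiv_lt_0_compat; lra). lra. }
    apply Rle_div_l; [lra|].
    apply Rle_trans with 1.
    + rewrite <- (pow1 (Z.to_nat a)). apply pow_incr. split; [apply Cmod_ge_0|exact Hq1].
    + apply Rle_trans with ((2 * IZR kp) * / (2 * IZR kp)).
      * rewrite Rinv_r; lra.
      * apply Rmult_le_compat; lra.
Qed.

End Terms.

(** * Comparison of the series with its polar part *)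

Lemma ln_le_sub_1 (x : R) : 0 < x -> ln x <= x - 1.
Proof.
  intros Hx. pose proof (exp_ineq1_le (ln x)) as H. rewrite exp_ln in H by exact Hx. lra.
Qed.

(** Carried through the induction with [min (n, N)] in place of [N]; each step is
    [1/(n+1) <= ln ((n+1)/n)]. *)
Lemma harmonic_sum_le (N : R) (n : nat) : 1 <= N ->
  sum_n (fun i => if Rle_dec (INR (S i)) N then / INR (S i) else 0) n <= 1 + ln N.
Proof.
  intros HN.
  assert (H : sum_n (fun i => if Rle_dec (INR (S i)) N then / INR (S i) else 0) n
              <= 1 + ln (Rmin (INR (S n)) N)).
  { induction n as [|n IH].
    - rewrite sum_O. simpl (INR 1). rewrite Rmin_left, ln_1 by exact HN.
      destruct (Rle_dec 1 N); lra.
    - rewrite Rsum_S. pose proof (INR_S_pos n) as H1.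
      rewrite (S_INR (S n)) in *. set (x := INR (S n)) in *.
      destruct (Rle_dec (x + 1) N) as [L|L].
      + rewrite Rmin_left in IH |- * by lra.
        pose proof (ln_le_sub_1 (x / (x + 1)) ltac:(apply Rdiv_lt_0_compat; lra)) as G.
        rewrite ln_div in G by lra.
        replace (x / (x + 1) - 1) with (- / (x + 1)) in G by (field; lra). lra.
      + rewrite (Rmin_right (x + 1)) by lra.
        assert (ln (Rmin x N) <= ln N).
        { apply ln_le; [apply Rmin_glb_lt; lra|apply Rmin_r]. } lra. }
  eapply Rle_trans; [exact H|]. apply Rplus_le_compat_l, ln_le; [|apply Rmin_r].
  apply Rmin_glb_lt; [apply lt_0_INR; lia|lra].
Qed.

(** [1/l^2 <= 2/l - 2/(l+1)] telescopes from the first index beyond [L]. *)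
Lemma inverse_square_tail_le (L : R) (n : nat) : 0 < L ->
  sum_n (fun i => if Rle_dec (INR (S i)) L then 0 else / INR (S i) ^ 2) n <= 2 / L.
Proof.
  intros HL.
  assert (H : sum_n (fun i => if Rle_dec (INR (S i)) L then 0 else / INR (S i) ^ 2) n
              <= 2 / L - 2 / Rmax L (INR (S (S n)))).
  { assert (Hmon : forall u v, 0 < u -> u <= v -> 2 / v <= 2 / u).
    { intros u v Hu Huv. apply Rmult_le_compat_l; [lra|]. now apply Rinv_le_contravar. }
    assert (Hstep : forall x, 1 <= x -> / x ^ 2 <= 2 / x - 2 / (x + 1)).
    { intros x Hx. replace (2 / x - 2 / (x + 1)) with (2 / (x * (x + 1))) by (field; lra).
      replace (/ x ^ 2) with (2 / (2 * x ^ 2)) by (field; lra).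
      apply Hmon; nra. }
    induction n as [|n IH].
    - rewrite sum_O. simpl (INR 1). replace (INR 2) with 2 by (simpl; lra).
      destruct (Rle_dec 1 L) as [H1|H1].
      + pose proof (Hmon L (Rmax L 2) HL (Rmax_l L 2)). lra.
      + rewrite Rmax_right by lra. pose proof (Hmon L 1 HL ltac:(lra)).
        rewrite pow1, Rinv_1. lra.
    - rewrite Rsum_S. assert (H1 : 1 <= INR (S (S n))) by (apply (le_INR 1); lia).
      rewrite (S_INR (S (S n))). set (x := INR (S (S n))) in *.
      destruct (Rle_dec x L) as [Hx|Hx].
      + pose proof (Hmon (Rmax L x) (Rmax L (x + 1))
          ltac:(eapply Rlt_le_trans; [exact HL|apply Rmax_l])
          ltac:(apply Rle_max_compat_l; lra)). lra.
      + rewrite Rmax_right in IH |- * by lra. specialize (Hstep x H1). lra. }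
  assert (0 < 2 / Rmax L (INR (S (S n)))); [|lra].
  apply Rdiv_lt_0_compat; [lra|]. eapply Rlt_le_trans; [exact HL|apply Rmax_l].
Qed.

Lemma Nof_bounds (X : R) : 16 <= X ->
  sqrt X <= IZR (Nof X) <= 3 * sqrt X /\ IZR (Nof X) ^ 2 <= 8 * X /\ 4 <= sqrt X.
Proof.
  intros HX. pose proof PI_4 as P4. pose proof PI2_3_2 as P3.
  assert (S4 : 4 <= sqrt X).
  { rewrite <- (sqrt_pow2 4) by lra. apply sqrt_le_1_alt. lra. }
  assert (SX : sqrt X * sqrt X = X) by (apply sqrt_sqrt; lra).
  unfold Nof. set (s := sqrt (2 * PI * X)).
  assert (Ss : s * s = 2 * PI * X) by (apply sqrt_sqrt; nra).
  assert (s0 : 0 <= s) by apply sqrt_pos.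
  destruct (base_Int_part s) as [B1 B2]. set (N := IZR (Int_part s)) in *.
  assert (Hs2 : 2 * sqrt X <= s) by (apply Rnot_lt_le; intros L; nra).
  assert (Hs3 : s <= 3 * sqrt X) by (apply Rnot_lt_le; intros L; nra).
  repeat split; try lra. nra.
Qed.

(** The threshold [N / (64 M)] keeps [l M tau] below [1 / (4 k)] for all smaller
    [l]; beyond it both series are trivially [O(X / l^2)]. *)
Lemma Phi_polar_estimate (M : Z) : (1 <= M)%Z ->
  exists B : R, forall X : R, 16 <= X ->
  forall h k : Z, (1 <= k)%Z -> (k <= Nof X)%Z -> Z.gcd h k = 1%Z ->
  forall Y : R, Rabs Y <= 1 / (IZR k * IZR (Nof X)) ->
  forall a : Z, (1 <= a <= M)%Z ->
  forall b : Z, (b mod Z.gcd k M = (- (h * a)) mod Z.gcd k M)%Z ->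
  forall L : C, Cseries (phase_term (IZR b / IZR (Z.gcd k M))) L ->
  Cmod (Phi a M (qpt X Y h k)
        - RtoC 1 / tau X Y * RtoC (IZR (Z.gcd k M) ^ 2 / (IZR k ^ 2 * IZR M)) * L)%C
  <= B * (sqrt X * ln X).
Proof.
  intros HM.
  (* [(2 N + 8) (1 + ln N) <= 8 sqrt X * 2 ln X], and [2 X * 2 / L0 <= 256 M sqrt X] *)
  exists (16 + 256 * IZR M).
  intros X HX h k Hk HkN Hhk Y HY a Ha b Hb L HL.
  destruct (Nof_bounds X HX) as [[N1 N2] [N3 S4]].
  set (N := IZR (Nof X)) in *.
  assert (RM : 1 <= IZR M) by now apply (IZR_le 1).
  assert (Rk : 1 <= IZR k <= N) by (split; [now apply (IZR_le 1)|now apply IZR_le]).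
  assert (X0 : 0 < X) by lra.
  set (L0 := N / (64 * IZR M)).
  assert (HL0 : 0 < L0) by (apply Rdiv_lt_0_compat; lra).
  assert (HL0N : L0 <= N) by (apply Rle_div_l; nra).
  set (d := fun i => (geometric_term X Y h k M a i - polar_term X Y k M b i)%C).
  assert (Hd : Cseries d (Phi a M (qpt X Y h k)
        - RtoC 1 / tau X Y * RtoC (IZR (Z.gcd k M) ^ 2 / (IZR k ^ 2 * IZR M)) * L)%C).
  { apply Cseries_minus.
    - apply Phi_series; [exact Ha|].
      replace (qpt X Y h k) with (qpt X Y h k ^ 1)%C by apply Cpow_1_r.
      rewrite Cmod_qpt_pow, <- exp_0 by lia. apply exp_increasing.
      assert (0 < INR 1 / X) by (apply Rdiv_lt_0_compat; simpl; lra). lra.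
    - pose proof (cusp_kp_pos k M Hk) as Hkp.
      apply (series_on_multiples (fun j => RtoC 1 / tau X Y
         * RtoC (IZR (Z.gcd k M) ^ 2 / (IZR k ^ 2 * IZR M))
         * phase_term (IZR b / IZR (Z.gcd k M)) j)%C); [lia|].
      now apply Cseries_scal. }
  assert (Hterm : forall i, Cmod (d i)
     <= (2 * N + 8) * (if Rle_dec (INR (S i)) N then / INR (S i) else 0)
        + 2 * X * (if Rle_dec (INR (S i)) L0 then 0 else / INR (S i) ^ 2)).
  { intros i. pose proof (INR_S_pos i) as Rl.
    assert (Hil : 0 < / INR (S i)) by now apply Rinv_0_lt_compat.
    destruct (Rle_dec (INR (S i)) L0) as [Hi|Hi].
    - destruct (Rle_dec (INR (S i)) N) as [_|]; [|lra].
      eapply Rle_trans.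
      + apply (term_difference_small X Y h k M a b X0 Hk Ha Hhk Hb i).
        rewrite Cmod_mult, Cmod_R, Rabs_pos_eq by nra.
        assert (Hlm : INR (S i) * IZR M <= N / 64).
        { apply Rle_trans with (L0 * IZR M); [apply Rmult_le_compat_r; lra|].
          unfold L0. apply Req_le. field. lra. }
        pose proof (Cmod_tau_le X Y X0) as Ht.
        assert (Hik : 0 < / IZR k) by (apply Rinv_0_lt_compat; lra).
        assert (HiN : 0 < / N) by (apply Rinv_0_lt_compat; lra).
        (* [N^2 <= 8 X] gives [N / X <= 8 / N <= 8 / k] *)
        assert (HNX : N * / X <= 8 * / IZR k).
        { apply Rle_trans with (8 * / N).
          - apply Rmult_le_reg_l with (X * N); [nra|].
            replace (X * N * (N * / X)) with (N ^ 2) by (field; lra).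
            replace (X * N * (8 * / N)) with (8 * X) by (field; lra). exact N3.
          - apply Rmult_le_compat_l; [lra|]. apply Rinv_le_contravar; lra. }
        assert (HNY : N * Rabs Y <= / IZR k).
        { apply Rle_trans with (N * (1 / (IZR k * N))).
          - apply Rmult_le_compat_l; lra.
          - apply Req_le. field. lra. }
        apply Rle_trans with (N / 64 * (/ X + 8 * Rabs Y)).
        * apply Rmult_le_compat; try lra; [nra|apply Cmod_ge_0].
        * rewrite Rinv_mult. lra.
      + unfold Rdiv. assert ((2 * IZR k + 8) * / INR (S i) <= (2 * N + 8) * / INR (S i)).
        { apply Rmult_le_compat_r; lra. } lra.
    - pose proof (term_difference_tail X Y h k M a b X0 Hk Ha i) as T. fold (d i) in T.
      unfold Rdiv in T.
      assert (0 <= (2 * N + 8) * (if Rle_dec (INR (S i)) N then / INR (S i) else 0)).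
      { apply Rmult_le_pos; [lra|]. destruct (Rle_dec (INR (S i)) N); lra. }
      lra. }
  apply Cseries_le_bound with (1 := Hd). intros n.
  eapply Rle_trans; [apply Rsum_le, Hterm|].
  rewrite Rsum_linear.
  pose proof (harmonic_sum_le N n ltac:(lra)) as H1.
  pose proof (inverse_square_tail_le L0 n HL0) as H2.
  assert (SX : sqrt X * sqrt X = X) by (apply sqrt_sqrt; lra).
  assert (lnX1 : 1 <= ln X).
  { rewrite <- (ln_exp 1). apply ln_le; [apply exp_pos|]. pose proof exp_le_3. lra. }
  assert (HsX : 4 * sqrt X <= X).
  { rewrite <- SX at 2. apply Rmult_le_compat_r; lra. }
  assert (lnN : ln N <= ln X) by (apply ln_le; lra).
  assert (Hbig : 2 / L0 = 128 * IZR M / N) by (unfold L0; field; lra).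
  assert (HXN : X / N <= sqrt X).
  { apply Rle_div_l; [lra|]. rewrite <- SX at 1. apply Rmult_le_compat_l; lra. }
  apply Rle_trans with ((2 * N + 8) * (1 + ln N) + 2 * X * (2 / L0)).
  - apply Rplus_le_compat; apply Rmult_le_compat_l; (exact H1 || exact H2 || lra).
  - rewrite Hbig.
    assert (E1 : 2 * X * (128 * IZR M / N) <= 256 * IZR M * (sqrt X * ln X)).
    { replace (2 * X * (128 * IZR M / N)) with (256 * IZR M * (X / N)) by (field; lra).
      apply Rmult_le_compat_l; [lra|]. nra. }
    assert (E2 : (2 * N + 8) * (1 + ln N) <= (8 * sqrt X) * (2 * ln X)).
    { apply Rmult_le_compat; try lra.
      assert (0 <= ln N) by (rewrite <- ln_1; apply ln_le; lra). lra. }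
    lra.
Qed.

(** * Uniform limits of primitives *)

(** [U] is a uniform limit of functions whose derivatives tend uniformly to [g].
    This is closed under uniform limits and still gives the mean value inequality. *)
Definition primitive_limit (U g : R -> R) (a b : R) : Prop :=
  forall eps, 0 < eps -> exists u u' : R -> R,
    (forall t, a <= t <= b -> is_derive u t (u' t)) /\
    (forall t, a <= t <= b -> Rabs (u t - U t) <= eps /\ Rabs (u' t - g t) <= eps).

Lemma primitive_limit_derive (U g : R -> R) (a b : R) :
  (forall t, a <= t <= b -> is_derive U t (g t)) -> primitive_limit U g a b.
Proof.
  intros H eps Heps. exists U, g. split; [exact H|].
  intros t Ht. rewrite !Rminus_diag, Rabs_R0. lra.
Qed.

Lemma primitive_limit_minus (U V g h : R -> R) (a b : R) :
  primitive_limit U g a b -> primitive_limit V h a b ->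
  primitive_limit (fun t => U t - V t) (fun t => g t - h t) a b.
Proof.
  intros HU HV eps Heps.
  destruct (HU (eps / 2)) as [u [u' [Du Eu]]]; [lra|].
  destruct (HV (eps / 2)) as [v [v' [Dv Ev]]]; [lra|].
  exists (fun t => u t - v t), (fun t => u' t - v' t). split.
  - intros t Ht. apply (is_derive_minus u v); auto.
  - intros t Ht. destruct (Eu t Ht) as [E1 E2], (Ev t Ht) as [E3 E4].
    apply Rabs_le_between in E1, E2, E3, E4.
    split; apply Rabs_le_between; lra.
Qed.

Lemma primitive_limit_closed (U g : R -> R) (a b : R) :
  (forall eps, 0 < eps -> exists V h, primitive_limit V h a b /\
     (forall t, a <= t <= b -> Rabs (V t - U t) <= eps /\ Rabs (h t - g t) <= eps)) ->
  primitive_limit U g a b.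
Proof.
  intros H eps Heps.
  destruct (H (eps / 2)) as [V [h [HV E]]]; [lra|].
  destruct (HV (eps / 2)) as [v [v' [Dv Ev]]]; [lra|].
  exists v, v'. split; [exact Dv|]. intros t Ht.
  destruct (E t Ht) as [E1 E2], (Ev t Ht) as [E3 E4].
  apply Rabs_le_between in E1, E2, E3, E4.
  split; apply Rabs_le_between; lra.
Qed.

Lemma primitive_limit_ext (U V g h : R -> R) (a b : R) :
  (forall t, a <= t <= b -> U t = V t) -> (forall t, a <= t <= b -> g t = h t) ->
  primitive_limit U g a b -> primitive_limit V h a b.
Proof.
  intros E1 E2 H eps Heps. destruct (H eps Heps) as [u [u' [Du Eu]]].
  exists u, u'. split; [exact Du|]. intros t Ht. rewrite <- E1, <- E2 by exact Ht. auto.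
Qed.

Lemma primitive_limit_lipschitz (U g : R -> R) (a b B x y : R) :
  primitive_limit U g a b -> (forall t, a <= t <= b -> Rabs (g t) <= B) ->
  a <= x -> x <= y -> y <= b -> Rabs (U y - U x) <= B * (y - x).
Proof.
  intros HU HB Hx Hxy Hy.
  apply Rle_plus_epsilon. intros eps Heps.
  destruct (HU (eps / (3 + (y - x)))) as [u [u' [Du Eu]]].
  { apply Rdiv_lt_0_compat; [exact Heps|lra]. }
  set (e := eps / (3 + (y - x))) in *.
  assert (He : e * (3 + (y - x)) = eps) by (unfold e; field; lra).
  assert (He0 : 0 < e) by (apply Rdiv_lt_0_compat; [exact Heps|lra]).
  destruct (MVT_gen u x y u') as [c [Hc E]].
  - rewrite Rmin_left, Rmax_right by exact Hxy. intros t Ht. apply Du. lra.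
  - rewrite Rmin_left, Rmax_right by exact Hxy. intros t Ht.
    apply continuity_pt_filterlim. apply (continuous_of_ex_derive u).
    exists (u' t). apply Du. lra.
  - rewrite Rmin_left, Rmax_right in Hc by exact Hxy.
    destruct (Eu x ltac:(lra)) as [E1 _], (Eu y ltac:(lra)) as [E2 _].
    destruct (Eu c ltac:(lra)) as [_ E3]. specialize (HB c ltac:(lra)).
    apply Rabs_le_between in E1, E2, E3, HB.
    assert (Hd : - ((B + e) * (y - x)) <= u y - u x <= (B + e) * (y - x)).
    { rewrite E. split; nra. }
    apply Rabs_le_between. nra.
Qed.

Lemma primitive_limit_zero (U : R -> R) (a b x y : R) :
  primitive_limit U (fun _ => 0) a b -> a <= x <= b -> a <= y <= b -> U x = U y.
Proof.
  intros HU.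
  assert (G : forall x y, a <= x -> x <= y -> y <= b -> U x = U y).
  { intros s t Hs Hst Ht.
    pose proof (primitive_limit_lipschitz U _ a b 0 s t HU) as H.
    specialize (H ltac:(intros; cbv beta; rewrite Rabs_R0; lra) Hs Hst Ht).
    apply Rabs_le_between in H. lra. }
  intros Hx Hy. destruct (Rle_lt_dec x y); [apply G; lra|symmetry; apply G; lra].
Qed.

Lemma Rseries_tail_le (u A : nat -> R) (n : nat) (l : R) :
  (forall k, Rabs (u k) <= A k) -> is_series A l ->
  Rabs (sum_n u n - Series u) <= l - sum_n A n.
Proof.
  intros H HA.
  assert (Hu : is_series u (Series u)).
  { apply Series_correct, ex_series_Rabs, ex_series_le_nonneg with A; [|now exists l].
    intros k. split; [apply Rabs_pos|apply H]. }
  assert (A0 : forall k, 0 <= A k).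
  { intros k. eapply Rle_trans; [apply Rabs_pos|apply H]. }
  assert (Hd : forall m, (n <= m)%nat -> Rabs (sum_n u m - sum_n u n) <= sum_n A m - sum_n A n).
  { intros m Hm. induction Hm as [|m Hm IH].
    - rewrite !Rminus_diag, Rabs_R0. lra.
    - rewrite !Rsum_S. specialize (H (S m)).
      replace (sum_n u m + u (S m) - sum_n u n) with ((sum_n u m - sum_n u n) + u (S m)) by ring.
      eapply Rle_trans; [apply Rabs_triang|]. lra. }
  apply Rle_plus_epsilon. intros eps Heps. rewrite Rseries_eps in Hu.
  destruct (Hu eps Heps) as [N HN].
  specialize (HN (n + N)%nat ltac:(lia)). specialize (Hd (n + N)%nat ltac:(lia)).
  pose proof (sum_le_series A l A0 HA (n + N)%nat).
  apply Rabs_lt_between in HN. apply Rabs_le_between in Hd. apply Rabs_le_between. lra.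
Qed.

(** The tails of the majorants bound the errors of the partial sums. *)
Lemma primitive_limit_series (u u' : nat -> R -> R) (A A' : nat -> R) (a b : R) :
  (forall n t, a <= t <= b -> is_derive (u n) t (u' n t)) ->
  (forall n t, a <= t <= b -> Rabs (u n t) <= A n /\ Rabs (u' n t) <= A' n) ->
  ex_series A -> ex_series A' ->
  primitive_limit (fun t => Series (fun n => u n t)) (fun t => Series (fun n => u' n t)) a b.
Proof.
  intros Hd HA [l Hl] [l' Hl'] eps Heps.
  pose proof Hl as Hl1. pose proof Hl' as Hl1'. rewrite Rseries_eps in Hl1, Hl1'.
  destruct (Hl1 eps Heps) as [N HN]. destruct (Hl1' eps Heps) as [N' HN'].
  set (m := (N + N')%nat).
  specialize (HN m ltac:(unfold m; lia)). specialize (HN' m ltac:(unfold m; lia)).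
  exists (fun t => sum_n (fun n => u n t) m), (fun t => sum_n (fun n => u' n t) m).
  split.
  - intros t Ht. apply (is_derive_sum_n (K := R_AbsRing) (V := R_NormedModule)).
    intros k _. now apply Hd.
  - intros t Ht. apply Rabs_lt_between in HN, HN'. split.
    + eapply Rle_trans; [apply (Rseries_tail_le (fun n => u n t) A m l)|]; [|exact Hl|lra].
      intros k. now apply HA.
    + eapply Rle_trans; [apply (Rseries_tail_le (fun n => u' n t) A' m l')|]; [|exact Hl'|lra].
      intros k. now apply HA.
Qed.

(** * The dilogarithm on the unit circle *)

Lemma Cseries_geometric (Q : C) : Cmod Q < 1 -> Cseries (fun i => (Q ^ i)%C) (/ (1 - Q))%C.
Proof.
  intros HQ. apply (is_series_decr_1 (fun i => (Q ^ i)%C)).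
  pose proof (residue_class_series Q 1 1 ltac:(lia) HQ) as H.
  replace (plus _ _) with (Q ^ Z.to_nat 1 / (1 - Q ^ Z.to_nat 1))%C.
  - eapply Cseries_ext; [|exact H]. intros i. cbv beta.
    now rewrite !Z.mod_1_r.
  - change (Q ^ Z.to_nat 1 / (1 - Q ^ Z.to_nat 1) = / (1 - Q) - 1)%C.
    change (Z.to_nat 1) with 1%nat. rewrite Cpow_1_r. field. now apply one_minus_neq_0.
Qed.

(** [|1 - r e^(i theta)|^2]. *)
Definition poisson_den (r theta : R) : R := 1 - 2 * r * cos theta + r ^ 2.

Lemma poisson_den_pos (r theta : R) : 0 <= r < 1 -> 0 < poisson_den r theta.
Proof.
  intros Hr. unfold poisson_den. pose proof (COS_bound theta). nra.
Qed.

Lemma poisson_series (r theta : R) : 0 <= r < 1 ->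
  is_series (fun i => r ^ i * cos (INR (S i) * theta)) ((cos theta - r) / poisson_den r theta) /\
  is_series (fun i => r ^ i * sin (INR (S i) * theta)) (sin theta / poisson_den r theta).
Proof.
  intros Hr. pose proof (poisson_den_pos r theta Hr) as HD.
  set (e := Cexp ((0, theta) : C)).
  assert (He : e = (cos theta, sin theta)).
  { unfold e, Cexp. simpl. rewrite exp_0. f_equal; ring. }
  assert (He1 : Cmod e = 1).
  { unfold e. rewrite Cmod_Cexp. apply exp_0. }
  assert (Hpow : forall i, (e * (RtoC r * e) ^ i)%C
            = (r ^ i * cos (INR (S i) * theta), r ^ i * sin (INR (S i) * theta))).
  { intros i. rewrite Cpow_mult_l, <- RtoC_pow.
    replace (e * (RtoC (r ^ i) * e ^ i))%C with (RtoC (r ^ i) * e ^ S i)%C by (simpl; ring).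
    unfold e. rewrite Cexp_pow. unfold Cexp, RtoC, Cmult, Re, Im. cbn [fst snd].
    replace (INR (S i) * 0 - 0 * theta) with 0 by ring.
    replace (INR (S i) * theta + 0 * 0) with (INR (S i) * theta) by ring.
    rewrite exp_0. f_equal; ring. }
  assert (HQ : Cmod (RtoC r * e)%C < 1).
  { rewrite Cmod_mult, He1, Cmod_R, Rabs_pos_eq; lra. }
  pose proof (Cseries_scal e _ _ (Cseries_geometric _ HQ)) as H.
  replace (e * / (1 - RtoC r * e))%C
    with ((cos theta - r) / poisson_den r theta, sin theta / poisson_den r theta) in H.
  - rewrite Cseries_components in H. destruct H as [H1 H2]. split.
    + eapply is_series_ext; [|exact H1]. intros i. cbv beta. now rewrite Hpow.
    + eapply is_series_ext; [|exact H2]. intros i. cbv beta. now rewrite Hpow.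
  - assert (Hne : (1 - RtoC r * e)%C <> 0) by now apply one_minus_neq_0.
    set (W := ((cos theta - r) / poisson_den r theta, sin theta / poisson_den r theta) : C).
    assert (HW : (W * (1 - RtoC r * e))%C = e).
    { rewrite He. unfold W, Cminus, Cplus, Cmult, Copp, RtoC. cbn [fst snd].
      pose proof (sin2_cos2 theta) as sc. unfold Rsqr in sc.
      f_equal.
      - transitivity (((cos theta - r) * (1 - r * cos theta) + r * (sin theta * sin theta))
                      / poisson_den r theta); [field; lra|].
        replace (sin theta * sin theta) with (1 - cos theta * cos theta) by lra.
        unfold poisson_den in *. field. lra.
      - unfold poisson_den in *. field. lra. }
    change (W = e * / (1 - RtoC r * e))%C.
    transitivity (W * (1 - RtoC r * e) * / (1 - RtoC r * e))%C; [field; exact Hne|].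
    now rewrite HW.
Qed.

Lemma ex_series_pow (r : R) : 0 <= r < 1 -> ex_series (fun i => r ^ i).
Proof. intros Hr. eexists. apply is_series_geom. rewrite Rabs_pos_eq; lra. Qed.

(** The series and its closed form [V] have the same derivative in the radius,
    a geometric series, and both vanish at the centre. *)
Lemma abel_series_real (f : R -> R) (V : R -> R) (dV : R -> R) (theta r : R) :
  0 <= r < 1 -> (forall x, Rabs (f x) <= 1) ->
  (forall t, 0 <= t < 1 ->
     is_series (fun i => t ^ i * f (INR (S i) * theta)) (dV t) /\ is_derive V t (dV t)) ->
  V 0 = 0 ->
  Series (fun i => r ^ S i * f (INR (S i) * theta) / INR (S i)) = V r.
Proof.
  intros Hr Hf HV V0.
  pose proof INR_S_pos as HS.
  assert (HU : primitive_limit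
    (fun t => Series (fun i => t ^ S i * f (INR (S i) * theta) / INR (S i)))
    (fun t => Series (fun i => t ^ i * f (INR (S i) * theta))) 0 r).
  { apply (primitive_limit_series
      (fun i t => t ^ S i * f (INR (S i) * theta) / INR (S i))
      (fun i t => t ^ i * f (INR (S i) * theta)) (fun i => r ^ i) (fun i => r ^ i)).
    - intros i t Ht. specialize (HS i). auto_derive; [exact I|].
      change (pred (S i)) with i. change (match i with | O => 1 | S _ => INR i + 1 end) with (INR (S i)).
      field. lra.
    - intros i t Ht. specialize (HS i). specialize (Hf (INR (S i) * theta)).
      assert (Hti : 0 <= t ^ i <= r ^ i) by (split; [apply pow_le|apply pow_incr]; lra).
      pose proof (INR_S_ge_1 i) as H1.
      unfold Rdiv. rewrite !Rabs_mult, (Rabs_pos_eq (t ^ i)), (Rabs_pos_eq (t ^ S i)),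
        (Rabs_pos_eq (/ INR (S i)))
        by (try (left; now apply Rinv_0_lt_compat); try apply pow_le; lra).
      assert (Hfi := Rabs_pos (f (INR (S i) * theta))).
      assert (Hi1 : / INR (S i) <= 1) by (rewrite <- Rinv_1; apply Rinv_le_contravar; lra).
      assert (Hi0 : 0 < / INR (S i)) by now apply Rinv_0_lt_compat.
      assert (Hts : 0 <= t ^ S i <= t ^ i) by (simpl; nra).
      split.
      + apply Rle_trans with (r ^ i * 1 * 1); [|lra].
        apply Rmult_le_compat; [nra|lra| |lra].
        apply Rmult_le_compat; lra.
      + apply Rle_trans with (r ^ i * 1); [|lra]. apply Rmult_le_compat; lra.
    - now apply ex_series_pow.
    - now apply ex_series_pow. }
  assert (HV' : primitive_limit V (fun t => Series (fun i => t ^ i * f (INR (S i) * theta))) 0 r).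
  { apply primitive_limit_derive. intros t Ht. destruct (HV t ltac:(lra)) as [H1 H2].
    rewrite (is_series_unique _ _ H1). exact H2. }
  pose proof (primitive_limit_minus _ _ _ _ _ _ HU HV') as H.
  assert (H' : primitive_limit
    (fun t => Series (fun i => t ^ S i * f (INR (S i) * theta) / INR (S i)) - V t)
    (fun _ => 0) 0 r).
  { eapply primitive_limit_ext; [| |exact H]; intros t Ht; cbv beta; ring. }
  pose proof (primitive_limit_zero _ _ _ 0 r H' ltac:(lra) ltac:(lra)) as E. cbv beta in E.
  rewrite V0 in E.
  rewrite (Series_ext (fun i => 0 ^ S i * f (INR (S i) * theta) / INR (S i)) (fun _ => 0)) in E.
  - rewrite Series_0 in E. lra.
  - intros i. simpl pow. unfold Rdiv. ring.
Qed.

Lemma abel_log_series (theta r : R) : 0 <= r < 1 ->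
  Series (fun i => r ^ S i * cos (INR (S i) * theta) / INR (S i))
  = - (ln (poisson_den r theta) / 2).
Proof.
  intros Hr. apply (abel_series_real cos (fun t => - (ln (poisson_den t theta) / 2))
    (fun t => (cos theta - t) / poisson_den t theta)); [exact Hr| | |].
  - intros x. apply Rabs_le_between, COS_bound.
  - intros t Ht. split; [now apply poisson_series|].
    pose proof (poisson_den_pos t theta Ht) as HD. unfold poisson_den in *.
    auto_derive; [exact HD|]. field. lra.
  - replace (poisson_den 0 theta) with 1 by (unfold poisson_den; ring).
    rewrite ln_1. field.
Qed.

Lemma abel_atan_series (theta r : R) : 0 <= r < 1 ->
  Series (fun i => r ^ S i * sin (INR (S i) * theta) / INR (S i))
  = atan (r * sin theta / (1 - r * cos theta)).
Proof.
  intros Hr. apply (abel_series_real sin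
    (fun t => atan (t * sin theta / (1 - t * cos theta)))
    (fun t => sin theta / poisson_den t theta)); [exact Hr| | |].
  - intros x. apply Rabs_le_between, SIN_bound.
  - intros t Ht. split; [now apply poisson_series|].
    pose proof (poisson_den_pos t theta Ht) as HD.
    assert (HC : 0 < 1 - t * cos theta) by (pose proof (COS_bound theta); nra).
    pose proof (sin2_cos2 theta) as sc. unfold Rsqr in sc.
    assert (E : poisson_den t theta = (1 - t * cos theta) ^ 2 + (t * sin theta) ^ 2).
    { unfold poisson_den. replace ((t * sin theta) ^ 2) with (t ^ 2 * (sin theta * sin theta)) by ring.
      replace (sin theta * sin theta) with (1 - cos theta * cos theta) by lra. ring. }
    auto_derive; [lra|]. rewrite E in HD |- *. field. simpl in HD. lra.
  - replace (0 * sin theta / (1 - 0 * cos theta)) with 0 by field. apply atan_0.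
Qed.

(** [clausen_cos theta + i clausen_sin theta] is the dilogarithm of [e^(i theta)]. *)
Definition clausen_cos (theta : R) : R :=
  Series (fun i => cos (INR (S i) * theta) / INR (S i) ^ 2).

Definition clausen_sin (theta : R) : R :=
  Series (fun i => sin (INR (S i) * theta) / INR (S i) ^ 2).

Lemma ex_series_inverse_squares : ex_series (fun i => / INR (S i) ^ 2).
Proof.
  pose proof INR_S_ge_1 as HS.
  apply ex_series_bounded with (2 / (1 / 2)).
  - intros i. left. apply Rinv_0_lt_compat, pow_lt. specialize (HS i). lra.
  - intros n. eapply Rle_trans; [|apply (inverse_square_tail_le (1 / 2) n); lra].
    apply Rsum_le. intros i. destruct (Rle_dec (INR (S i)) (1 / 2)); [|lra].
    specialize (HS i). lra.
Qed.

Lemma Rabs_Series_le (u : nat -> R) (B : R) :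
  (forall n, sum_n (fun k => Rabs (u k)) n <= B) -> Rabs (Series u) <= B.
Proof.
  intros H. assert (E : ex_series (fun k => Rabs (u k))).
  { apply ex_series_bounded with B; [intros; apply Rabs_pos|exact H]. }
  eapply Rle_trans; [apply Series_Rabs, E|].
  apply series_le_bound with (1 := Series_correct _ E). exact H.
Qed.

Lemma ex_series_over_squares (f : nat -> R) :
  (forall i, Rabs (f i) <= 1) -> ex_series (fun i => f i / INR (S i) ^ 2).
Proof.
  intros H. apply ex_series_Rabs.
  apply ex_series_le_nonneg with (2 := ex_series_inverse_squares).
  intros i. split; [apply Rabs_pos|].
  assert (0 < / INR (S i) ^ 2) by (apply inverse_square_pos).
  unfold Rdiv. rewrite Rabs_mult, (Rabs_pos_eq (/ _)) by lra.
  specialize (H i). nra.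
Qed.

(** The linear bound is used for [i + 1 <= N], the bound by [1] beyond. *)
Lemma small_over_squares (f : nat -> R) (eta N : R) :
  1 <= N -> 0 <= eta -> (forall i, Rabs (f i) <= Rmin 1 (INR (S i) * eta)) ->
  forall n, sum_n (fun i => Rabs (f i / INR (S i) ^ 2)) n <= eta * (1 + ln N) + 2 / N.
Proof.
  intros HN Heta Hf n.
  eapply Rle_trans; [apply (Rsum_le _ (fun i =>
     eta * (if Rle_dec (INR (S i)) N then / INR (S i) else 0)
     + 1 * (if Rle_dec (INR (S i)) N then 0 else / INR (S i) ^ 2)))|].
  - intros i. specialize (Hf i).
    pose proof (INR_S_pos i) as Rl.
    assert (Hq : 0 < / INR (S i) ^ 2) by (apply Rinv_0_lt_compat, pow_lt, Rl).
    unfold Rdiv. rewrite Rabs_mult, (Rabs_pos_eq (/ _)) by lra.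
    destruct (Rle_dec (INR (S i)) N).
    + apply Rle_trans with (INR (S i) * eta * / INR (S i) ^ 2).
      * apply Rmult_le_compat_r; [lra|].
        eapply Rle_trans; [exact Hf|apply Rmin_r].
      * apply Req_le. field. lra.
    + pose proof (Rle_trans _ _ _ Hf (Rmin_l _ _)). nra.
  - rewrite Rsum_linear, Rmult_1_l. apply Rplus_le_compat.
    + apply Rmult_le_compat_l; [exact Heta|]. now apply harmonic_sum_le.
    + apply inverse_square_tail_le. lra.
Qed.

Lemma small_threshold (eps : R) : 0 < eps ->
  exists N eta, 1 <= N /\ 0 < eta <= 1 / 2 /\ eta * (1 + ln N) + 2 / N <= eps.
Proof.
  intros Heps. set (N := 1 + 4 / eps).
  assert (H4 : 0 < 4 / eps) by (apply Rdiv_lt_0_compat; lra).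
  assert (HN : 1 <= N) by (unfold N; lra).
  assert (Hln : 0 <= ln N) by (rewrite <- ln_1; apply ln_le; lra).
  exists N, (Rmin (1 / 2) (eps / 2 / (1 + ln N))).
  assert (He : 0 < eps / 2 / (1 + ln N)) by (apply Rdiv_lt_0_compat; lra).
  repeat split; [exact HN|apply Rmin_glb_lt; lra|apply Rmin_l|].
  assert (H1 : Rmin (1 / 2) (eps / 2 / (1 + ln N)) * (1 + ln N) <= eps / 2).
  { apply Rle_trans with (eps / 2 / (1 + ln N) * (1 + ln N)).
    - apply Rmult_le_compat_r; [lra|apply Rmin_r].
    - apply Req_le. field. lra. }
  assert (H2 : 2 / N <= eps / 2).
  { apply Rle_div_l; [lra|]. unfold N. 
    replace (eps / 2 * (1 + 4 / eps)) with (eps / 2 + 2) by (field; lra). lra. }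
  lra.
Qed.

Lemma one_minus_pow_le (r : R) (n : nat) : 0 <= r <= 1 -> 0 <= 1 - r ^ n <= Rmin 1 (INR n * (1 - r)).
Proof.
  intros Hr. assert (H0 : 0 <= r ^ n) by (apply pow_le; lra).
  assert (H1 : r ^ n <= 1) by (rewrite <- (pow1 n); apply pow_incr; lra).
  split; [lra|]. apply Rmin_glb; [lra|]. clear H0 H1.
  induction n as [|n IH]; [simpl; lra|].
  assert (H0 : 0 <= r ^ n) by (apply pow_le; lra).
  assert (H1 : r ^ n <= 1) by (rewrite <- (pow1 n); apply pow_incr; lra).
  rewrite S_INR. simpl pow. nra.
Qed.

(** Uniformity in [f] comes from [1 - r^n <= min (1, n (1 - r))]. *)
Lemma abel_mean_close (eps : R) : 0 < eps ->
  exists eta, 0 < eta <= 1 / 2 /\ forall r, 1 - eta <= r < 1 ->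
  forall f : nat -> R, (forall i, Rabs (f i) <= 1) ->
  Rabs (Series (fun i => r ^ S i * f i / INR (S i) ^ 2) - Series (fun i => f i / INR (S i) ^ 2))
  <= eps.
Proof.
  intros Heps. destruct (small_threshold eps Heps) as [N [eta [HN [Heta H]]]].
  exists eta. split; [exact Heta|]. intros r Hr f Hf.
  rewrite <- Series_minus.
  - apply Rabs_Series_le. intros n.
    apply Rle_trans with (eta * (1 + ln N) + 2 / N); [|exact H].
    eapply Rle_trans; [|apply (small_over_squares (fun i => (r ^ S i - 1) * f i) eta N HN ltac:(lra))].
    + apply Req_le, sum_n_ext. intros i. f_equal. unfold Rdiv. ring.
    + intros i. specialize (Hf i). rewrite Rabs_mult.
      pose proof (one_minus_pow_le r (S i) ltac:(lra)) as [P0 P1].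
      rewrite Rabs_minus_sym, (Rabs_pos_eq (1 - r ^ S i)) by exact P0.
      apply Rle_trans with (1 - r ^ S i).
      * pose proof (Rabs_pos (f i)). nra.
      * eapply Rle_trans; [exact P1|]. apply Rle_min_compat_l.
        apply Rmult_le_compat_l; [apply pos_INR|lra].
  - apply ex_series_over_squares. intros i. specialize (Hf i).
    assert (0 <= r ^ S i <= 1).
    { split; [apply pow_le; lra|rewrite <- (pow1 (S i)); apply pow_incr; lra]. }
    rewrite Rabs_mult, (Rabs_pos_eq (r ^ S i)) by lra.
    pose proof (Rabs_pos (f i)). nra.
  - now apply ex_series_over_squares.
Qed.

Lemma abel_primitive (g g' : R -> R) (r a b : R) :
  0 <= r < 1 -> (forall x, is_derive g x (g' x)) ->
  (forall x, Rabs (g x) <= 1) -> (forall x, Rabs (g' x) <= 1) ->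
  primitive_limit (fun t => Series (fun i => r ^ S i * g (INR (S i) * t) / INR (S i) ^ 2))
    (fun t => Series (fun i => r ^ S i * g' (INR (S i) * t) / INR (S i))) a b.
Proof.
  intros Hr Hd Hg Hg'.
  apply (primitive_limit_series (fun i t => r ^ S i * g (INR (S i) * t) / INR (S i) ^ 2)
    (fun i t => r ^ S i * g' (INR (S i) * t) / INR (S i)) (fun i => r ^ i) (fun i => r ^ i)).
  - intros i t _. pose proof (INR_S_pos i) as Rl.
    set (x := INR (S i)) in *.
    apply is_derive_ext with (fun t => (r ^ S i / x ^ 2) * g (x * t)).
    { intros s. unfold Rdiv. Rring. }
    replace (r ^ S i * g' (x * t) / x) with ((r ^ S i / x ^ 2) * (x * g' (x * t))) by (field; lra).
    apply (is_derive_scal (fun t => g (x * t))).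
    apply (is_derive_comp g (fun t => x * t)); [apply Hd|].
    auto_derive; [exact I|ring].
  - intros i t _. pose proof (INR_S_ge_1 i) as H1.
    set (x := INR (S i)) in *.
    assert (Hri : 0 <= r ^ S i <= r ^ i).
    { assert (0 <= r ^ i) by (apply pow_le; lra). simpl. nra. }
    assert (Hx1 : 0 < / x <= 1).
    { split; [apply Rinv_0_lt_compat; lra|rewrite <- Rinv_1; apply Rinv_le_contravar; lra]. }
    assert (Hx2 : 0 < / x ^ 2 <= 1).
    { split; [apply Rinv_0_lt_compat; nra|rewrite <- Rinv_1; apply Rinv_le_contravar; nra]. }
    unfold Rdiv. rewrite !Rabs_mult, (Rabs_pos_eq (r ^ S i)), (Rabs_pos_eq (/ x ^ 2)),
      (Rabs_pos_eq (/ x)) by lra.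
    specialize (Hg (x * t)). specialize (Hg' (x * t)).
    pose proof (Rabs_pos (g (x * t))). pose proof (Rabs_pos (g' (x * t))).
    split; (apply Rle_trans with (r ^ i * 1 * 1); [|lra]);
      (apply Rmult_le_compat; [nra|lra|apply Rmult_le_compat; lra|lra]).
  - now apply ex_series_pow.
  - now apply ex_series_pow.
Qed.

Lemma sin_half_lower (a b : R) : 0 < a -> a <= b -> b < 2 * PI ->
  exists m, 0 < m /\ forall t, a <= t <= b -> m <= sin (t / 2).
Proof.
  intros Ha Hab Hb. pose proof PI_RGT_0 as HPI.
  exists (Rmin (sin (a / 2)) (sin (b / 2))). split.
  - apply Rmin_glb_lt; apply sin_gt_0; lra.
  - intros t Ht. destruct (Rle_lt_dec (t / 2) (PI / 2)).
    + eapply Rle_trans; [apply Rmin_l|]. apply sin_incr_1; lra.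
    + eapply Rle_trans; [apply Rmin_r|]. apply sin_decr_1; lra.
Qed.

Lemma one_minus_cos_half (t : R) : 1 - cos t = 2 * sin (t / 2) ^ 2.
Proof.
  pose proof (cos_2a_sin (t / 2)) as H. replace (2 * (t / 2)) with t in H by field.
  rewrite H. ring.
Qed.

(** As [r] tends to [1], [|1 - r e^(i t)|] tends to [2 sin (t/2)], uniformly away
    from the ends of the period; so do the logarithms. *)
Lemma primitive_limit_clausen_sin (a b : R) : 0 < a -> a <= b -> b < 2 * PI ->
  primitive_limit clausen_sin (fun t => - ln (2 * sin (t / 2))) a b.
Proof.
  intros Ha Hab Hb. destruct (sin_half_lower a b Ha Hab Hb) as [m [Hm Hsin]].
  apply primitive_limit_closed. intros eps Heps.
  destruct (abel_mean_close eps Heps) as [eta [Heta Hmean]].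
  set (r := 1 - Rmin eta (eps * m ^ 2 / 5)).
  assert (Hmin : 0 < Rmin eta (eps * m ^ 2 / 5)).
  { apply Rmin_glb_lt; [lra|]. apply Rdiv_lt_0_compat; [|lra].
    apply Rmult_lt_0_compat; [exact Heps|now apply pow_lt]. }
  pose proof (Rmin_l eta (eps * m ^ 2 / 5)) as Hl.
  pose proof (Rmin_r eta (eps * m ^ 2 / 5)) as Hr.
  assert (Hr1 : 1 / 2 <= r < 1) by (unfold r; lra).
  exists (fun t => Series (fun i => r ^ S i * sin (INR (S i) * t) / INR (S i) ^ 2)),
    (fun t => Series (fun i => r ^ S i * cos (INR (S i) * t) / INR (S i))).
  split.
  - apply abel_primitive; [lra| | |].
    + intros x. auto_derive; [exact I|ring].
    + intros x. apply Rabs_le_between, SIN_bound.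
    + intros x. apply Rabs_le_between, COS_bound.
  - intros t Ht. split.
    + apply (Hmean r ltac:(unfold r in *; lra) (fun i => sin (INR (S i) * t))).
      intros i. apply Rabs_le_between, SIN_bound.
    + rewrite abel_log_series by lra. specialize (Hsin t Ht).
      set (D := 2 * (1 - cos t)).
      assert (HD : 2 * ln (2 * sin (t / 2)) = ln D).
      { unfold D. rewrite one_minus_cos_half.
        replace (2 * (2 * sin (t / 2) ^ 2)) with (2 * sin (t / 2) * (2 * sin (t / 2))) by ring.
        rewrite (ln_mult (2 * sin (t / 2)) (2 * sin (t / 2))) by lra. ring. }
      assert (HDm : 4 * m ^ 2 <= D <= 4).
      { unfold D. rewrite one_minus_cos_half. pose proof (SIN_bound (t / 2)). nra. }
      pose proof (poisson_den_pos r t ltac:(lra)) as HA. set (A := poisson_den r t) in *.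
      assert (EA : A = (1 - r) ^ 2 + r * D) by (unfold A, poisson_den, D; ring).
      assert (HAD : Rabs (A - D) <= 5 * (1 - r)).
      { rewrite EA. apply Rabs_le_between. split; nra. }
      assert (Hm2 : 0 < m ^ 2) by now apply pow_lt.
      assert (HAm : 2 * m ^ 2 <= A) by (rewrite EA; nra).
      (* [|ln A - ln D| <= |A - D| / min(A, D)] *)
      assert (Hlip : forall x y, 2 * m ^ 2 <= x -> 2 * m ^ 2 <= y ->
                ln x - ln y <= Rabs (x - y) / (2 * m ^ 2)).
      { intros x y Hx Hy. rewrite <- ln_div by lra.
        eapply Rle_trans; [apply ln_le_sub_1, Rdiv_lt_0_compat; lra|].
        replace (x / y - 1) with ((x - y) / y) by (field; lra).
        apply Rle_trans with (Rabs (x - y) / y).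
        - apply Rmult_le_compat_r; [left; apply Rinv_0_lt_compat; lra|apply Rle_abs].
        - apply Rmult_le_compat_l; [apply Rabs_pos|]. apply Rinv_le_contravar; lra. }
      pose proof (Hlip A D HAm ltac:(lra)) as L1.
      pose proof (Hlip D A ltac:(lra) HAm) as L2. rewrite Rabs_minus_sym in L2.
      assert (Hfin : Rabs (A - D) / (2 * m ^ 2) <= eps).
      { apply Rle_div_l; [lra|]. eapply Rle_trans; [exact HAD|]. unfold r. lra. }
      apply Rabs_le_between. lra.
Qed.

Lemma atan_lipschitz (x y : R) : Rabs (atan x - atan y) <= Rabs (x - y).
Proof.
  destruct (MVT_gen atan y x (fun t => / (1 + t ^ 2))) as [c [_ E]].
  - intros t _. auto_derive; [exact I|field]. nra.
  - intros t _. apply continuity_pt_filterlim.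
    apply (continuous_of_ex_derive atan).
    auto_derive. exact I.
  - rewrite E, Rabs_mult. rewrite <- (Rmult_1_l (Rabs (x - y))) at 2.
    apply Rmult_le_compat_r; [apply Rabs_pos|].
    assert (0 <= c ^ 2) by nra.
    rewrite Rabs_pos_eq by (left; apply Rinv_0_lt_compat; lra).
    rewrite <- Rinv_1. apply Rinv_le_contravar; lra.
Qed.

Lemma atan_cot_half (t : R) : 0 < t < 2 * PI ->
  atan (sin t / (1 - cos t)) = (PI - t) / 2.
Proof.
  intros Ht. rewrite <- (atan_tan ((PI - t) / 2)) by lra. f_equal.
  assert (Hs : 0 < sin (t / 2)) by (apply sin_gt_0; lra).
  unfold tan. replace ((PI - t) / 2) with (PI / 2 - t / 2) by field.
  rewrite cos_shift, sin_shift.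
  rewrite one_minus_cos_half. pose proof (sin_2a (t / 2)) as H2.
  replace (2 * (t / 2)) with t in H2 by field. rewrite H2.
  field. lra.
Qed.

(** The argument of [1 / (1 - r e^(i t))] tends to [(PI - t) / 2], uniformly away
    from the ends of the period. *)
Lemma primitive_limit_clausen_cos (a b : R) : 0 < a -> a <= b -> b < 2 * PI ->
  primitive_limit clausen_cos (fun t => - ((PI - t) / 2)) a b.
Proof.
  intros Ha Hab Hb. destruct (sin_half_lower a b Ha Hab Hb) as [m [Hm Hsin]].
  apply primitive_limit_closed. intros eps Heps.
  destruct (abel_mean_close eps Heps) as [eta [Heta Hmean]].
  assert (Hm4 : 0 < m ^ 4) by now apply pow_lt.
  set (r := 1 - Rmin eta (eps * m ^ 4)).
  assert (Hmin : 0 < Rmin eta (eps * m ^ 4)).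
  { apply Rmin_glb_lt; [lra|]. now apply Rmult_lt_0_compat. }
  pose proof (Rmin_l eta (eps * m ^ 4)) as Hl.
  pose proof (Rmin_r eta (eps * m ^ 4)) as Hr.
  assert (Hr1 : 1 / 2 <= r < 1) by (unfold r; lra).
  exists (fun t => Series (fun i => r ^ S i * cos (INR (S i) * t) / INR (S i) ^ 2)),
    (fun t => Series (fun i => r ^ S i * (- sin (INR (S i) * t)) / INR (S i))).
  split.
  - apply (abel_primitive cos (fun x => - sin x)); [lra| | |].
    + intros x. auto_derive; [exact I|ring].
    + intros x. apply Rabs_le_between, COS_bound.
    + intros x. rewrite Rabs_Ropp. apply Rabs_le_between, SIN_bound.
  - intros t Ht. split.
    + apply (Hmean r ltac:(unfold r in *; lra) (fun i => cos (INR (S i) * t))).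
      intros i. apply Rabs_le_between, COS_bound.
    + rewrite (Series_ext _ (fun i => - (r ^ S i * sin (INR (S i) * t) / INR (S i))))
        by (intros; unfold Rdiv; ring).
      rewrite Series_opp, abel_atan_series by lra.
      rewrite <- atan_cot_half by lra. specialize (Hsin t Ht).
      replace (- atan (r * sin t / (1 - r * cos t)) - - atan (sin t / (1 - cos t)))
        with (atan (sin t / (1 - cos t)) - atan (r * sin t / (1 - r * cos t))) by ring.
      eapply Rle_trans; [apply atan_lipschitz|].
      assert (HC : 2 * m ^ 2 <= 1 - cos t).
      { rewrite one_minus_cos_half. nra. }
      assert (Hm2 : 0 < m ^ 2) by now apply pow_lt.
      assert (HR : m ^ 2 <= 1 - r * cos t).
      { pose proof (COS_bound t). nra. }
      replace (sin t / (1 - cos t) - r * sin t / (1 - r * cos t))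
        with (sin t * (1 - r) / ((1 - cos t) * (1 - r * cos t))) by (field; lra).
      assert (HP : 2 * m ^ 4 <= (1 - cos t) * (1 - r * cos t)).
      { replace (2 * m ^ 4) with (2 * m ^ 2 * m ^ 2) by ring. apply Rmult_le_compat; lra. }
      rewrite Rabs_div by lra. rewrite (Rabs_pos_eq (_ * (1 - r * cos t))) by lra.
      apply Rle_div_l; [lra|].
      rewrite Rabs_mult, (Rabs_pos_eq (1 - r)) by lra.
      assert (Hs1 : Rabs (sin t) <= 1) by (apply Rabs_le_between, SIN_bound).
      apply Rle_trans with (1 * (1 - r)); [apply Rmult_le_compat_r; lra|].
      apply Rle_trans with (eps * m ^ 4); [unfold r; lra|]. nra.
Qed.

Lemma clausen_cos_series (t : R) :
  is_series (fun i => cos (INR (S i) * t) / INR (S i) ^ 2) (clausen_cos t).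
Proof.
  apply Series_correct, (ex_series_over_squares (fun i => cos (INR (S i) * t))).
  intros i. apply Rabs_le_between, COS_bound.
Qed.

Lemma clausen_sin_series (t : R) :
  is_series (fun i => sin (INR (S i) * t) / INR (S i) ^ 2) (clausen_sin t).
Proof.
  apply Series_correct, (ex_series_over_squares (fun i => sin (INR (S i) * t))).
  intros i. apply Rabs_le_between, SIN_bound.
Qed.

Lemma cos_add_nat_PI (x : R) (n : nat) : cos (x + INR n * PI) = (-1) ^ n * cos x.
Proof.
  induction n as [|n IH].
  - simpl. rewrite Rmult_1_l. f_equal. ring.
  - rewrite S_INR. replace (x + (INR n + 1) * PI) with (x + INR n * PI + PI) by ring.
    rewrite neg_cos, IH. simpl. ring.
Qed.

(** In the sum of the two values the odd terms cancel and the even ones double. *)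
Lemma clausen_cos_duplication (t : R) :
  clausen_cos (t / 2) + clausen_cos (t / 2 + PI) = clausen_cos t / 2.
Proof.
  pose proof (is_series_plus _ _ _ _ (clausen_cos_series (t / 2)) (clausen_cos_series (t / 2 + PI))) as H.
  assert (G : Cseries (fun i => RtoC (cos (INR (S i) * t) / INR (S i) ^ 2 * / 2))
                (RtoC (clausen_cos t * / 2))).
  { apply Cseries_components. split.
    - apply (is_series_scal_r (/ 2) _ _ (clausen_cos_series t)).
    - apply is_series_0. }
  apply (series_on_multiples _ 2) in G; [|lia].
  rewrite Cseries_components in G. destruct G as [G _].
  apply is_series_unique in H. apply is_series_unique in G.
  change (clausen_cos (t / 2) + clausen_cos (t / 2 + PI) = clausen_cos t * / 2).
  change (plus (clausen_cos (t / 2)) (clausen_cos (t / 2 + PI)))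
    with (clausen_cos (t / 2) + clausen_cos (t / 2 + PI)) in H.
  rewrite <- H. change (Re (RtoC (clausen_cos t * / 2))) with (clausen_cos t * / 2) in G. rewrite <- G. apply Series_ext. intros i.
  change plus with Rplus. set (l := S i).
  replace (INR l * (t / 2 + PI)) with (INR l * (t / 2) + INR l * PI) by ring.
  rewrite cos_add_nat_PI.
  assert (Rl : 0 < INR l) by (apply lt_0_INR; unfold l; lia).
  pose proof (Nat.div_mod_eq l 2) as E.
  pose proof (Nat.mod_upper_bound l 2 ltac:(lia)) as B.
  destruct (Nat.eqb_spec (l mod 2) 0) as [Ev|Od].
  - rewrite Ev in E. set (m := (l / 2)%nat) in *.
    assert (Hm : (1 <= m)%nat) by (unfold l in E; lia).
    cbv beta. replace (S (m - 1)) with m by lia.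
    assert (Rm : INR l = 2 * INR m) by (rewrite E, Nat.add_0_r, mult_INR; reflexivity).
    assert (0 < INR m) by (apply lt_0_INR; lia).
    replace ((-1) ^ l) with 1.
    + unfold RtoC. cbn [Re fst]. rewrite Rm.
      replace (2 * INR m * (t / 2)) with (INR m * t) by field. field. lra.
    + rewrite E, Nat.add_0_r. symmetry. apply pow_1_even.
  - replace ((-1) ^ l) with (-1).
    + unfold RtoC. cbn [Re fst]. field. lra.
    + rewrite E. replace (l mod 2)%nat with 1%nat by lia. rewrite Nat.add_1_r.
      symmetry. apply pow_1_odd.
Qed.

(** The derivative [(t - PI) / 2] leaves one constant undetermined; the
    duplication formula at [PI] fixes it. *)
Lemma clausen_cos_quadratic (t : R) : 0 < t < 2 * PI ->
  clausen_cos t = t ^ 2 / 4 - PI * t / 2 + PI ^ 2 / 6.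
Proof.
  pose proof PI_RGT_0 as HPI.
  set (Q := fun t => clausen_cos t - (t ^ 2 / 4 - PI * t / 2)).
  assert (Hc : forall x y, 0 < x < 2 * PI -> 0 < y < 2 * PI -> Q x = Q y).
  { intros x y Hx Hy.
    set (a := Rmin x y). set (b := Rmax x y).
    assert (Hab : 0 < a /\ a <= x <= b /\ a <= y <= b /\ b < 2 * PI).
    { unfold a, b. repeat split; try apply Rmin_l; try apply Rmin_r; try apply Rmax_l; try apply Rmax_r.
      - now apply Rmin_glb_lt.
      - now apply Rmax_lub_lt. }
    destruct Hab as [H1 [H2 [H3 H4]]].
    apply (primitive_limit_zero Q a b); [|exact H2|exact H3].
    assert (Hq : primitive_limit (fun t => t ^ 2 / 4 - PI * t / 2)
                   (fun t => - ((PI - t) / 2)) a b).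
    { apply primitive_limit_derive. intros s _. auto_derive; [exact I|field]. }
    eapply primitive_limit_ext; [| |apply (primitive_limit_minus _ _ _ _ _ _
      (primitive_limit_clausen_cos a b H1 ltac:(lra) H4) Hq)].
    - reflexivity.
    - intros; cbv beta; ring. }
  intros Ht.
  pose proof (clausen_cos_duplication PI) as D.
  pose proof (Hc (PI / 2) t ltac:(lra) Ht) as E1.
  pose proof (Hc (PI / 2 + PI) t ltac:(lra) Ht) as E2.
  pose proof (Hc PI t ltac:(lra) Ht) as E3. unfold Q in *.
  set (c := clausen_cos t - (t ^ 2 / 4 - PI * t / 2)) in *. fold c in E1, E2, E3.
  assert (clausen_cos t = (t ^ 2 / 4 - PI * t / 2) + c) by (unfold c; ring).
  nra.
Qed.

(** At the end [x = 1] of the period the value is [zeta(2)], again by duplication. *)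
Lemma clausen_cos_bernoulli (x : R) : 0 < x <= 1 ->
  clausen_cos (2 * PI * x) = PI ^ 2 * (x ^ 2 - x + 1 / 6).
Proof.
  intros Hx. pose proof PI_RGT_0 as HPI.
  destruct (Req_dec x 1) as [->|Hne].
  - assert (E0 : clausen_cos (2 * PI * 1) = clausen_cos 0).
    { unfold clausen_cos. apply Series_ext. intros i. f_equal.
      replace (INR (S i) * (2 * PI * 1)) with (0 + 2 * INR (S i) * PI) by ring.
      rewrite cos_period. f_equal. ring. }
    rewrite E0. pose proof (clausen_cos_duplication 0) as D.
    replace (0 / 2) with 0 in D by field. rewrite Rplus_0_l in D.
    rewrite (clausen_cos_quadratic PI) in D by lra. nra.
  - rewrite clausen_cos_quadratic by (split; nra). field.
Qed.

Lemma phase_series (x : R) :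
  Cseries (phase_term x) (clausen_cos (2 * PI * x), - clausen_sin (2 * PI * x)).
Proof.
  assert (E : forall i, phase_term x i
     = (cos (INR (S i) * (2 * PI * x)) / INR (S i) ^ 2,
        - (sin (INR (S i) * (2 * PI * x)) / INR (S i) ^ 2))).
  { intros i. assert (Rl : INR (S i) ^ 2 <> 0) by (apply pow_nonzero, not_0_INR; lia).
    unfold phase_term.
    replace (- (RtoC (2 * PI) * Ci * RtoC (x * INR (S i))))%C
      with ((0, - (INR (S i) * (2 * PI * x)))%R : C).
    - unfold Cdiv. rewrite <- RtoC_inv by exact Rl.
      unfold Cexp, RtoC, Cmult, Re, Im. cbn [fst snd].
      rewrite exp_0, cos_neg, sin_neg. unfold Rdiv. f_equal; ring.
    - unfold Ci, RtoC, Cmult, Copp. cbn [fst snd]. f_equal; ring. }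
  apply Cseries_components. split.
  - eapply is_series_ext; [|apply clausen_cos_series]. intros i. now rewrite E.
  - eapply is_series_ext; [|apply (is_series_opp _ _ (clausen_sin_series (2 * PI * x)))].
    intros i. now rewrite E.
Qed.

(** * Euler's product for the sine *)

(** The quotient of this integral by its value at [x = 0] is, for even [n], the
    tail of the product for [sin (PI x) / (PI x)]. *)
Definition wallis (n : nat) (x : R) : R :=
  RInt (fun t => cos (2 * x * t) * cos t ^ n) 0 (PI / 2).

Lemma wallis_is_RInt (n : nat) (x : R) :
  is_RInt (fun t => cos (2 * x * t) * cos t ^ n) 0 (PI / 2) (wallis n x).
Proof.
  apply (RInt_correct (V := R_CompleteNormedModule)), (ex_RInt_continuous (V := R_CompleteNormedModule)).
  intros t _. apply continuous_of_ex_derive. auto_derive. exact I.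
Qed.

(** Two integrations by parts, in the form of an explicit primitive. *)
Lemma wallis_recurrence (n : nat) (x : R) :
  (INR (n + 2) ^ 2 - 4 * x ^ 2) * wallis (n + 2) x = INR (n + 2) * INR (n + 1) * wallis n x.
Proof.
  set (U := fun t => INR (n + 2) * (cos (2 * x * t) * (cos t ^ (n + 1) * sin t))
                     - 2 * x * (sin (2 * x * t) * cos t ^ (n + 2))).
  set (dU := fun t => (INR (n + 2) ^ 2 - 4 * x ^ 2) * (cos (2 * x * t) * cos t ^ (n + 2))
                     - INR (n + 2) * INR (n + 1) * (cos (2 * x * t) * cos t ^ n)).
  assert (H1 : is_RInt dU 0 (PI / 2) (minus (U (PI / 2)) (U 0))).
  { apply (is_RInt_derive (V := R_CompleteNormedModule)).
    - intros t _. unfold U, dU. auto_derive; [exact I|].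
      pose proof (sin2_cos2 t) as sc. unfold Rsqr in sc.
      assert (sc' : sin t * sin t = 1 - cos t * cos t) by lra.
      replace (pred (n + 1)) with n by lia. replace (pred (n + 2)) with (n + 1)%nat by lia.
      rewrite !pow_add, !plus_INR. simpl (INR 1). simpl (INR 2).
      rewrite !pow_1. 
      ring_simplify. 
      replace (sin t ^ 2) with (1 - cos t ^ 2) by (simpl; lra). ring.
    - intros t _. apply continuous_of_ex_derive.
      unfold dU. auto_derive. exact I. }
  assert (H2 : is_RInt dU 0 (PI / 2)
    ((INR (n + 2) ^ 2 - 4 * x ^ 2) * wallis (n + 2) x - INR (n + 2) * INR (n + 1) * wallis n x)).
  { apply (is_RInt_minus (V := R_NormedModule)
      (fun t => (INR (n + 2) ^ 2 - 4 * x ^ 2) * (cos (2 * x * t) * cos t ^ (n + 2)))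
      (fun t => INR (n + 2) * INR (n + 1) * (cos (2 * x * t) * cos t ^ n)));
    apply (is_RInt_scal (V := R_NormedModule)); apply wallis_is_RInt. }
  apply (is_RInt_unique (V := R_CompleteNormedModule)) in H1.
  apply (is_RInt_unique (V := R_CompleteNormedModule)) in H2. rewrite H1 in H2.
  replace (minus (U (PI / 2)) (U 0)) with 0 in H2.
  - lra.
  - unfold U. rewrite cos_PI2, sin_0, !Rmult_0_r, sin_0, !pow_i by lia.
    unfold minus, plus, opp; simpl. ring.
Qed.

Lemma sin_lt_self (v : R) : 0 <= v -> sin v <= v.
Proof. intros [Hv|<-]; [left; now apply sin_lt_x|rewrite sin_0; lra]. Qed.

Lemma one_minus_cos_le (u : R) : 1 - cos u <= u ^ 2 / 2.
Proof.
  assert (G : forall v, 0 <= v -> 1 - cos v <= v ^ 2 / 2).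
  { intros v Hv. rewrite one_minus_cos_half.
    destruct (Rle_lt_dec v 2) as [H|H].
    - assert (0 <= sin (v / 2)) by (apply sin_ge_0; pose proof PI2_3_2; lra).
      pose proof (sin_lt_self (v / 2) ltac:(lra)). nra.
    - pose proof (SIN_bound (v / 2)). nra. }
  destruct (Rle_lt_dec 0 u) as [H|H]; [now apply G|].
  specialize (G (- u) ltac:(lra)). rewrite cos_neg in G. replace (u ^ 2) with ((- u) ^ 2) by ring.
  exact G.
Qed.

Lemma mul_cos_le_sin (t : R) : 0 <= t <= PI / 2 -> t * cos t <= sin t.
Proof.
  intros Ht.
  destruct (MVT_gen (fun s => sin s - s * cos s) 0 t (fun s => s * sin s)) as [c [Hc E]].
  - intros s _. auto_derive; [exact I|ring].
  - intros s _. apply continuity_pt_filterlim.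
    apply (continuous_of_ex_derive (fun s => sin s - s * cos s)).
    auto_derive. exact I.
  - rewrite Rmin_left, Rmax_right in Hc by lra. rewrite sin_0 in E.
    assert (0 <= sin c) by (apply sin_ge_0; lra).
    assert (0 <= c * sin c * (t - 0)) by (repeat apply Rmult_le_pos; lra). lra.
Qed.

Definition wallis_even (m : nat) (x : R) : R := wallis (2 * m) x.

Lemma wallis_even_recurrence (m : nat) (x : R) :
  (1 - x ^ 2 / INR (S m) ^ 2) * wallis_even (S m) x
  = (1 - / (2 * INR (S m))) * wallis_even m x.
Proof.
  pose proof (wallis_recurrence (2 * m) x) as H. unfold wallis_even.
  replace (2 * S m)%nat with (2 * m + 2)%nat by lia.
  rewrite !plus_INR, mult_INR in H. simpl (INR 2) in H. simpl (INR 1) in H.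
  pose proof (pos_INR m) as Hm. rewrite S_INR. set (y := INR m) in *.
  apply Rmult_eq_reg_l with ((2 * y + 2) ^ 2); [|nra].
  transitivity (((2 * y + 2) ^ 2 - 4 * x ^ 2) * wallis (2 * m + 2) x); [field; lra|].
  replace (1 + 1) with 2 in H by ring. rewrite H. field. lra.
Qed.

Lemma wallis_even_0_pos (m : nat) : 0 < wallis_even m 0.
Proof.
  induction m as [|m IH].
  - unfold wallis_even, wallis. rewrite (RInt_ext _ (fun _ => 1)).
    + rewrite RInt_const. unfold scal; simpl; unfold mult; simpl. pose proof PI_RGT_0. lra.
    + intros t _. simpl. replace (2 * 0 * t) with 0 by ring. rewrite cos_0. ring.
  - pose proof (wallis_even_recurrence m 0) as H.
    replace (1 - 0 ^ 2 / INR (S m) ^ 2) with 1 in H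
      by (field; apply not_0_INR; lia).
    rewrite Rmult_1_l in H. rewrite H. apply Rmult_lt_0_compat; [|exact IH].
    assert (1 <= INR (S m)) by (apply (le_INR 1); lia).
    assert (/ (2 * INR (S m)) < 1); [|lra].
    rewrite <- Rinv_1. apply Rinv_lt_contravar; lra.
Qed.

(** [1 - cos (2 x t) <= 2 x^2 t^2] and [t cos t <= sin t] bound the difference of
    the integrals by [2 x^2] times the difference of two consecutive values at [0]. *)
Lemma wallis_even_close (m : nat) (x : R) :
  Rabs (wallis_even (S m) 0 - wallis_even (S m) x)
  <= 2 * x ^ 2 * (wallis_even m 0 - wallis_even (S m) 0).
Proof.
  pose proof PI_RGT_0 as HPI.
  set (f := fun t => cos (2 * 0 * t) * cos t ^ (2 * S m) - cos (2 * x * t) * cos t ^ (2 * S m)).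
  set (g := fun t => 2 * x ^ 2 * (cos (2 * 0 * t) * cos t ^ (2 * m) - cos (2 * 0 * t) * cos t ^ (2 * S m))).
  assert (Hf : is_RInt f 0 (PI / 2) (wallis_even (S m) 0 - wallis_even (S m) x)).
  { apply (is_RInt_minus (V := R_NormedModule)); apply wallis_is_RInt. }
  assert (Hg : is_RInt g 0 (PI / 2) (2 * x ^ 2 * (wallis_even m 0 - wallis_even (S m) 0))).
  { apply (is_RInt_scal (V := R_NormedModule)).
    apply (is_RInt_minus (V := R_NormedModule)); apply wallis_is_RInt. }
  apply (norm_RInt_le (V := R_NormedModule) f g 0 (PI / 2)); [lra| |exact Hf|exact Hg].
  intros t Ht. change (Rabs (f t) <= g t). unfold f, g.
  replace (2 * 0 * t) with 0 by ring. rewrite cos_0.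
  replace (2 * S m)%nat with (2 * m + 2)%nat by lia. rewrite pow_add.
  assert (Hc0 : 0 <= cos t) by (apply cos_ge_0; lra).
  assert (Hp : 0 <= cos t ^ (2 * m)) by now apply pow_le.
  pose proof (mul_cos_le_sin t Ht) as Hts.
  assert (Hsq : (t * cos t) ^ 2 <= sin t ^ 2) by (apply pow_incr; nra).
  pose proof (sin2_cos2 t) as sc. unfold Rsqr in sc.
  pose proof (one_minus_cos_le (2 * x * t)) as H1.
  pose proof (COS_bound (2 * x * t)) as H2.
  set (P := cos t ^ (2 * m)) in *. set (d := 1 - cos (2 * x * t)) in *.
  replace (1 * (P * cos t ^ 2) - cos (2 * x * t) * (P * cos t ^ 2)) with (P * (d * cos t ^ 2))
    by (unfold d; ring).
  replace (2 * x ^ 2 * (1 * P - 1 * (P * cos t ^ 2))) with (P * (2 * x ^ 2 * sin t ^ 2)).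
  2: { replace (sin t ^ 2) with (1 - cos t ^ 2) by (simpl; lra). ring. }
  assert (Hd : 0 <= d) by (unfold d; lra).
  rewrite Rabs_pos_eq by (apply Rmult_le_pos; [exact Hp|apply Rmult_le_pos; [exact Hd|nra]]).
  apply Rmult_le_compat_l; [exact Hp|].
  apply Rle_trans with ((2 * x * t) ^ 2 / 2 * cos t ^ 2).
  - apply Rmult_le_compat_r; [nra|exact H1].
  - replace ((2 * x * t) ^ 2 / 2 * cos t ^ 2) with (2 * x ^ 2 * (t * cos t) ^ 2) by field.
    apply Rmult_le_compat_l; [nra|exact Hsq].
Qed.

Definition wallis_ratio (m : nat) (x : R) : R := wallis_even m x / wallis_even m 0.

Lemma wallis_ratio_0 (x : R) : 0 < x -> wallis_ratio 0 x = sin (PI * x) / (PI * x).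
Proof.
  intros Hx. pose proof PI_RGT_0 as HPI. unfold wallis_ratio.
  assert (E : wallis_even 0 x = sin (PI * x) / (2 * x)).
  { unfold wallis_even, wallis.
    apply (is_RInt_unique (V := R_CompleteNormedModule)).
    replace (sin (PI * x) / (2 * x)) with
      (minus (sin (2 * x * (PI / 2)) / (2 * x)) (sin (2 * x * 0) / (2 * x))).
    - apply (is_RInt_derive (V := R_CompleteNormedModule) (fun t => sin (2 * x * t) / (2 * x))).
      + intros t _. simpl pow. auto_derive; [lra|field; lra].
      + intros t _. apply continuous_of_ex_derive.
        auto_derive. exact I.
    - unfold minus, plus, opp; simpl. rewrite Rmult_0_r, sin_0.
      replace (2 * x * (PI / 2)) with (PI * x) by field. field. lra. }
  assert (E0 : wallis_even 0 0 = PI / 2).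
  { unfold wallis_even, wallis. rewrite (RInt_ext _ (fun _ => 1)).
    + rewrite RInt_const. unfold scal; simpl; unfold mult; simpl. ring.
    + intros t _. simpl. replace (2 * 0 * t) with 0 by ring. rewrite cos_0. ring. }
  rewrite E, E0. field. lra.
Qed.

Lemma wallis_ratio_S (m : nat) (x : R) :
  (1 - x ^ 2 / INR (S m) ^ 2) * wallis_ratio (S m) x = wallis_ratio m x.
Proof.
  pose proof (wallis_even_recurrence m x) as H. pose proof (wallis_even_recurrence m 0) as H0.
  pose proof (wallis_even_0_pos m) as P. pose proof (wallis_even_0_pos (S m)) as P'.
  assert (1 <= INR (S m)) by (apply (le_INR 1); lia).
  replace (1 - 0 ^ 2 / INR (S m) ^ 2) with 1 in H0 by (field; lra).
  rewrite Rmult_1_l in H0. unfold wallis_ratio.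
  assert (/ (2 * INR (S m)) < 1) by (rewrite <- Rinv_1; apply Rinv_lt_contravar; lra).
  set (c := 1 - / (2 * INR (S m))) in *. assert (Hc : 0 < c) by (unfold c; lra).
  unfold Rdiv at 2. rewrite <- Rmult_assoc, H, H0. field. lra.
Qed.

Lemma wallis_ratio_close (m : nat) (x : R) :
  Rabs (1 - wallis_ratio (S m) x) <= 2 * x ^ 2 / INR (S m).
Proof.
  pose proof (wallis_even_close m x) as H. pose proof (wallis_even_recurrence m 0) as H0.
  pose proof (wallis_even_0_pos m) as P. pose proof (wallis_even_0_pos (S m)) as P'.
  pose proof (INR_S_ge_1 m) as R1.
  replace (1 - 0 ^ 2 / INR (S m) ^ 2) with 1 in H0 by (field; lra).
  rewrite Rmult_1_l in H0. unfold wallis_ratio.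
  replace (1 - wallis_even (S m) x / wallis_even (S m) 0)
    with ((wallis_even (S m) 0 - wallis_even (S m) x) / wallis_even (S m) 0) by (field; lra).
  rewrite Rabs_div, (Rabs_pos_eq (wallis_even (S m) 0)) by lra.
  apply Rle_div_l; [exact P'|]. eapply Rle_trans; [exact H|].
  unfold Rdiv. rewrite !Rmult_assoc. apply Rmult_le_compat_l; [lra|].
  apply Rmult_le_compat_l; [nra|].
  rewrite H0. set (y := INR (S m)) in *. set (w := wallis_even m 0) in *.
  apply Rmult_le_reg_l with (2 * y ^ 2); [nra|].
  replace (2 * y ^ 2 * (w - (1 - / (2 * y)) * w)) with (y * w) by (field; lra).
  replace (2 * y ^ 2 * (/ y * ((1 - / (2 * y)) * w))) with ((2 * y - 1) * w) by (field; lra).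
  apply Rmult_le_compat_r; lra.
Qed.

(** By [wallis_ratio_S] the partial products are [wallis_ratio 0 x] divided by a
    ratio that tends to [1]. *)
Lemma ln_sine_product (x : R) : 0 < x < 1 ->
  is_series (fun i => ln (1 - x ^ 2 / INR (S i) ^ 2)) (ln (sin (PI * x) / (PI * x))).
Proof.
  intros Hx. pose proof PI_RGT_0 as HPI.
  assert (Hfac : forall i, 0 < 1 - x ^ 2 / INR (S i) ^ 2).
  { intros i. pose proof (INR_S_ge_1 i) as R1.
    assert (x ^ 2 / INR (S i) ^ 2 < 1); [|lra].
    apply Rlt_div_l; [nra|]. nra. }
  assert (Hpos : forall m, 0 < wallis_ratio m x).
  { induction m as [|m IH].
    - rewrite wallis_ratio_0 by lra. apply Rdiv_lt_0_compat; [|nra].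
      apply sin_gt_0; nra.
    - pose proof (wallis_ratio_S m x) as H. specialize (Hfac m).
      apply Rnot_le_lt. intros L. nra. }
  assert (Hsum : forall n, sum_n (fun i => ln (1 - x ^ 2 / INR (S i) ^ 2)) n
            = ln (sin (PI * x) / (PI * x)) - ln (wallis_ratio (S n) x)).
  { rewrite <- (wallis_ratio_0 x) by lra.
    assert (Hstep : forall m, ln (1 - x ^ 2 / INR (S m) ^ 2)
              = ln (wallis_ratio m x) - ln (wallis_ratio (S m) x)).
    { intros m. rewrite <- (wallis_ratio_S m x), ln_mult by auto. ring. }
    induction n as [|n IH].
    - rewrite sum_O. apply Hstep.
    - rewrite Rsum_S, IH, Hstep. Rring. }
  apply Rseries_eps. intros eps Heps.
  destruct (nfloor_ex (Rmax 4 (8 / eps))) as [N HN].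
  { eapply Rle_trans; [|apply Rmax_l]. lra. }
  exists N. intros n Hn. rewrite Hsum.
  pose proof (wallis_ratio_close n x) as Hc. specialize (Hpos (S n)).
  set (R := wallis_ratio (S n) x) in *.
  assert (HnN : Rmax 4 (8 / eps) < INR (S n)).
  { eapply Rlt_le_trans; [apply HN|]. rewrite <- S_INR. apply le_INR. lia. }
  pose proof (Rmax_l 4 (8 / eps)). pose proof (Rmax_r 4 (8 / eps)).
  assert (H4 : 2 * x ^ 2 / INR (S n) <= 1 / 2).
  { apply Rle_div_l; [lra|]. nra. }
  assert (H8 : 2 * x ^ 2 / INR (S n) < eps / 2).
  { apply Rlt_div_l; [lra|].
    assert (8 < eps * INR (S n)).
    { apply Rlt_le_trans with (eps * (8 / eps) + eps * (INR (S n) - 8 / eps)).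
      - replace (eps * (8 / eps)) with 8 by (field; lra). nra.
      - lra. }
    nra. }
  apply Rabs_le_between in Hc.
  pose proof (ln_le_sub_1 R Hpos) as L1.
  assert (L2 : - ln R <= 2 * Rabs (1 - R)).
  { rewrite <- ln_Rinv by exact Hpos.
    eapply Rle_trans; [apply ln_le_sub_1, Rinv_0_lt_compat, Hpos|].
    replace (/ R - 1) with ((1 - R) / R) by (field; lra).
    apply Rle_div_l; [exact Hpos|]. pose proof (Rle_abs (1 - R)).
    pose proof (Rabs_pos (1 - R)). nra. }
  assert (Rabs (1 - R) < eps / 2) by (apply Rabs_lt_between; lra).
  apply Rabs_lt_between. lra.
Qed.

(** * Power series with a norm *)

(** Unlike the supremum on a disc, the norm [sum |a k| rho^k] controls a series of
    functions coefficient by coefficient; so a sum of analytic functions is seen to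
    be analytic by the absolute convergence of a double series. *)
Definition normed_pseries (f : C -> C) (s0 : C) (rho B : R) (a : nat -> C) : Prop :=
  (forall n, sum_n (fun k => Cmod (a k) * rho ^ k) n <= B) /\
  (forall w, Cmod w <= rho -> Cseries (fun k => (a k * w ^ k)%C) (f (s0 + w)%C)).

Lemma normed_pseries_ext (f g : C -> C) s0 rho B a :
  (forall s, f s = g s) -> normed_pseries f s0 rho B a -> normed_pseries g s0 rho B a.
Proof. intros E [H1 H2]. split; [exact H1|]. intros w Hw. rewrite <- E. auto. Qed.

Lemma normed_pseries_weaken (f : C -> C) s0 rho B B' a :
  B <= B' -> normed_pseries f s0 rho B a -> normed_pseries f s0 rho B' a.
Proof. intros HB [H1 H2]. split; [|exact H2]. intros n. eapply Rle_trans; eauto. Qed.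

Lemma normed_pseries_scal (c : C) (f : C -> C) s0 rho B a :
  normed_pseries f s0 rho B a ->
  normed_pseries (fun s => (c * f s)%C) s0 rho (Cmod c * B) (fun k => (c * a k)%C).
Proof.
  intros [H1 H2]. split.
  - intros n. rewrite (sum_n_ext _ (fun k => Cmod c * (Cmod (a k) * rho ^ k))).
    + rewrite Rsum_scal. apply Rmult_le_compat_l; [apply Cmod_ge_0|apply H1].
    + intros k. rewrite Cmod_mult. Rring.
  - intros w Hw. eapply Cseries_ext; [|apply (Cseries_scal c _ _ (H2 w Hw))].
    intros k. cbv beta. ring.
Qed.

Definition coef_shift (a : nat -> C) (k : nat) : C :=
  match k with O => 0 | S j => a j end.

Lemma Cseries_coef_shift (a : nat -> C) (w l : C) :
  Cseries (fun k => (a k * w ^ k)%C) l -> Cseries (fun k => (coef_shift a k * w ^ k)%C) (w * l)%C.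
Proof.
  intros H. apply (is_series_decr_1 (fun k => (coef_shift a k * w ^ k)%C)).
  replace (plus _ _) with (w * l)%C.
  - eapply Cseries_ext; [|apply (Cseries_scal w _ _ H)]. intros k. simpl. ring.
  - change (w * l = w * l - (0 * 1))%C. ring.
Qed.

Lemma Cseries_mul_var (a : nat -> C) (s0 w l : C) :
  Cseries (fun k => (a k * w ^ k)%C) l ->
  Cseries (fun k => ((s0 * a k + coef_shift a k) * w ^ k)%C) ((s0 + w) * l)%C.
Proof.
  intros H. replace ((s0 + w) * l)%C with (s0 * l + w * l)%C by ring.
  eapply Cseries_ext; [|apply Cseries_plus; [apply (Cseries_scal s0 _ _ H)
    |apply (Cseries_coef_shift _ _ _ H)]].
  intros k. cbv beta. ring.
Qed.

Lemma normed_pseries_mul_var (f : C -> C) s0 rho B a :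
  0 <= rho -> normed_pseries f s0 rho B a ->
  normed_pseries (fun s => (s * f s)%C) s0 rho ((Cmod s0 + rho) * B)
    (fun k => (s0 * a k + coef_shift a k)%C).
Proof.
  intros Hr [H1 H2]. split.
  - assert (B0 : 0 <= B).
    { eapply Rle_trans; [|apply (H1 0%nat)]. rewrite sum_O. simpl.
      pose proof (Cmod_ge_0 (a 0%nat)). lra. }
    assert (G : forall n, sum_n (fun k => Cmod (s0 * a k + coef_shift a k)%C * rho ^ k) n
                <= Cmod s0 * sum_n (fun k => Cmod (a k) * rho ^ k) n
                   + rho * (match n with O => 0 | S m => sum_n (fun k => Cmod (a k) * rho ^ k) m end)).
    { induction n as [|n IH].
      - rewrite !sum_O. simpl. replace (s0 * a 0%nat + 0)%C with (s0 * a 0%nat)%C by ring.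
        rewrite Cmod_mult. lra.
      - rewrite !Rsum_S. simpl coef_shift.
        assert (Ht : Cmod (s0 * a (S n) + a n)%C <= Cmod s0 * Cmod (a (S n)) + Cmod (a n)).
        { rewrite <- Cmod_mult. apply Cmod_triangle. }
        assert (Hp : 0 <= rho ^ n) by now apply pow_le.
        assert (Hn : Cmod (s0 * a (S n) + a n)%C * rho ^ S n
          <= Cmod s0 * (Cmod (a (S n)) * rho ^ S n) + rho * (Cmod (a n) * rho ^ n)).
        { simpl pow. apply Rle_trans with ((Cmod s0 * Cmod (a (S n)) + Cmod (a n)) * (rho * rho ^ n)).
          - apply Rmult_le_compat_r; [nra|exact Ht].
          - apply Req_le. ring. }
        destruct n as [|n].
        + rewrite !sum_O in *. simpl in *. lra.
        + rewrite !Rsum_S in IH |- *. lra. }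
    intros n. eapply Rle_trans; [apply G|].
    rewrite Rmult_plus_distr_r. apply Rplus_le_compat.
    + apply Rmult_le_compat_l; [apply Cmod_ge_0|apply H1].
    + apply Rmult_le_compat_l; [exact Hr|]. destruct n; [exact B0|apply H1].
  - intros w Hw. apply (Cseries_mul_var _ _ _ _ (H2 w Hw)).
Qed.

Fixpoint mul_pow_coef (s0 : C) (a : nat -> C) (m : nat) : nat -> C :=
  match m with
  | O => a
  | S j => fun k => (s0 * mul_pow_coef s0 a j k + coef_shift (mul_pow_coef s0 a j) k)%C
  end.

Lemma normed_pseries_mul_pow (f : C -> C) s0 rho B a (m : nat) :
  0 <= rho -> normed_pseries f s0 rho B a ->
  normed_pseries (fun s => (s ^ m * f s)%C) s0 rho ((Cmod s0 + rho) ^ m * B)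
    (mul_pow_coef s0 a m).
Proof.
  intros Hr H. induction m as [|m IH].
  - apply normed_pseries_ext with f; [intros; simpl; ring|].
    apply normed_pseries_weaken with B; [simpl; lra|exact H].
  - apply normed_pseries_ext with (fun s => (s * (s ^ m * f s))%C); [intros; simpl; ring|].
    apply (normed_pseries_weaken _ _ _ ((Cmod s0 + rho) * ((Cmod s0 + rho) ^ m * B)));
      [simpl; lra|].
    apply normed_pseries_mul_var; [exact Hr|exact IH].
Qed.

(** The norm is the exponential series at [|L| rho], times [|Cexp (- s0 L)|]. *)
Lemma normed_pseries_exp (L : R) (s0 : C) (rho : R) : 0 <= rho ->
  normed_pseries (fun s => Cexp (- s * RtoC L)%C) s0 rho (exp (- (Re s0 * L) + Rabs L * rho))
    (fun k => (Cexp (- s0 * RtoC L) * (RtoC (- L) ^ k / RtoC (INR (fact k))))%C).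
Proof.
  intros Hr. split.
  - intros n.
    rewrite (sum_n_ext _ (fun k => exp (- (Re s0 * L)) * ((Rabs L * rho) ^ k / INR (fact k)))).
    + rewrite Rsum_scal, exp_plus.
      apply Rmult_le_compat_l; [left; apply exp_pos|].
      apply exp_series_bound, Rmult_le_pos; [apply Rabs_pos|exact Hr].
    + intros k. rewrite Cmod_mult, Cmod_Cexp, Cmod_exp_term, Cmod_R, Rabs_Ropp, Rpow_mult_distr.
      replace (Re (- s0 * RtoC L)%C) with (- (Re s0 * L))
        by (destruct s0; unfold Cmult, Copp, RtoC, Re; simpl; ring).
      unfold Rdiv. Rring.
  - intros w _.
    replace (Cexp (- (s0 + w) * RtoC L)%C) with (Cexp (- s0 * RtoC L) * Cexp (w * RtoC (- L)))%C.
    + eapply Cseries_ext; [|apply Cseries_scal, Cexp_series]. intros k. cbv beta.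
      rewrite Cpow_mult_l. unfold Cdiv. ring.
    + rewrite <- Cexp_plus. f_equal. rewrite RtoC_opp. ring.
Qed.

Lemma Rsum_term_le (u : nat -> R) n k :
  (forall j, 0 <= u j) -> (k <= n)%nat -> u k <= sum_n u n.
Proof.
  intros H Hk. apply Rle_trans with (sum_n u k); [|now apply Rsum_nonneg_incr].
  destruct k; [rewrite sum_O; lra|]. rewrite Rsum_S. pose proof (Rsum_nonneg u k H). lra.
Qed.

(** Completeness: the double series of the coefficients converges absolutely. *)
Lemma normed_pseries_series (f : nat -> C -> C) s0 rho (B : nat -> R) (a : nat -> nat -> C) :
  0 < rho -> (forall n, normed_pseries (f n) s0 rho (B n) (a n)) -> ex_series B ->
  normed_pseries (fun s => CSeries (fun n => f n s)) s0 rho (Series B)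
    (fun k => CSeries (fun n => a n k)).
Proof.
  intros Hr H HB.
  assert (Hak : forall n k, Cmod (a n k) * rho ^ k <= B n).
  { intros n k. destruct (H n) as [H1 _]. eapply Rle_trans; [|apply (H1 k)].
    apply (Rsum_term_le (fun k => Cmod (a n k) * rho ^ k)); [|lia].
    intros j. apply Rmult_le_pos; [apply Cmod_ge_0|apply pow_le; lra]. }
  assert (Hcol : forall k, ex_series (fun n => Cmod (a n k))).
  { intros k. apply ex_series_le_nonneg with (fun n => B n * / rho ^ k).
    - intros n. split; [apply Cmod_ge_0|].
      assert (Hp : 0 < rho ^ k) by now apply pow_lt.
      apply Rmult_le_reg_r with (rho ^ k); [exact Hp|].
      rewrite Rmult_assoc, Rinv_l, Rmult_1_r by lra. apply Hak.
    - destruct HB as [b Hb]. exists (b * / rho ^ k). now apply is_series_scal_r. }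
  split.
  - assert (Hswap : forall m, is_series (fun n => sum_n (fun k => Cmod (a n k) * rho ^ k) m)
              (sum_n (fun k => Series (fun n => Cmod (a n k)) * rho ^ k) m)).
    { assert (Hk : forall k, is_series (fun n => Cmod (a n k) * rho ^ k)
                (Series (fun n => Cmod (a n k)) * rho ^ k)).
      { intros k. apply is_series_scal_r. now apply Series_correct. }
      induction m as [|m IH].
      - rewrite sum_O. eapply is_series_ext; [|apply (Hk 0%nat)].
        intros n. now rewrite sum_O.
      - rewrite Rsum_S. eapply is_series_ext; [|apply (is_series_plus _ _ _ _ IH (Hk (S m)))].
        intros n. now rewrite Rsum_S. }
    intros m. apply Rle_trans with (sum_n (fun k => Series (fun n => Cmod (a n k)) * rho ^ k) m).
    + apply Rsum_le. intros k. apply Rmult_le_compat_r; [apply pow_le; lra|].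
      apply Cseries_le_bound with (fun n => a n k).
      * apply Cseries_abs, Hcol.
      * apply sum_le_series; [intros; apply Cmod_ge_0|]. apply Series_correct, Hcol.
    + apply series_le_bound with (1 := Hswap m). intros n.
      apply Rle_trans with (sum_n B n).
      * apply Rsum_le. intros i. apply H.
      * apply sum_le_series; [|now apply Series_correct].
        intros i. eapply Rle_trans; [|apply (Hak i 0%nat)].
        apply Rmult_le_pos; [apply Cmod_ge_0|apply pow_le; lra].
  - intros w Hw.
    rewrite (CSeries_ext (fun n => f n (s0 + w)%C) (fun n => CSeries (fun k => (a n k * w ^ k)%C))).
    + eapply Cseries_ext; [|apply (fubini_complex (fun n k => (a n k * w ^ k)%C) B); [|exact HB]].
      * intros k. cbv beta.
        transitivity (w ^ k * CSeries (fun n => a n k))%C; [|ring].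
        apply Cseries_CSeries.
        eapply Cseries_ext; [|apply Cseries_scal, Cseries_abs, Hcol]. intros n. cbv beta. ring.
      * intros n J. destruct (H n) as [H1 _]. eapply Rle_trans; [|apply (H1 J)].
        apply Rsum_le. intros k. rewrite Cmod_mult, Cmod_pow.
        apply Rmult_le_compat_l; [apply Cmod_ge_0|].
        apply pow_incr. split; [apply Cmod_ge_0|exact Hw].
    + intros n. symmetry. apply Cseries_CSeries. now apply H.
Qed.

(** * Analytic functions along a segment *)

Definition pseries_on (f : C -> C) (s0 : C) (r : R) (c : nat -> C) : Prop :=
  forall w, Cmod w < r -> Cseries (fun k => (c k * w ^ k)%C) (f (s0 + w)%C).

Definition has_pseries (f : C -> C) (s0 : C) : Prop :=
  exists r c, 0 < r /\ pseries_on f s0 r c.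

Lemma pow_n_Cpow (w : C) (k : nat) : pow_n (K := C_Ring) w k = (w ^ k)%C.
Proof. induction k as [|k IH]; [reflexivity|]. simpl pow_n. rewrite IH. reflexivity. Qed.

Lemma analytic_has_pseries (f : C -> C) (z : C) : analytic_at f z -> has_pseries f z.
Proof.
  intros [r [c [Hr H]]]. exists r, c. split; [exact Hr|].
  intros w Hw. specialize (H (z + w)%C). replace (z + w - z)%C with w in H by ring.
  eapply Cseries_ext; [|apply (H Hw)]. intros k. cbv beta.
  change (pow_n (K := C_Ring) w k * c k = c k * w ^ k)%C. rewrite pow_n_Cpow. ring.
Qed.

Lemma normed_has_pseries (f : C -> C) s0 rho B a :
  0 < rho -> normed_pseries f s0 rho B a -> pseries_on f s0 rho a.
Proof. intros Hr [_ H] w Hw. apply H. lra. Qed.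

Lemma pseries_on_weaken (f : C -> C) s0 r r' c :
  r' <= r -> pseries_on f s0 r c -> pseries_on f s0 r' c.
Proof. intros Hr H w Hw. apply H. lra. Qed.

Lemma pseries_on_ext (f g : C -> C) s0 r c :
  (forall s, f s = g s) -> pseries_on f s0 r c -> pseries_on g s0 r c.
Proof. intros E H w Hw. rewrite <- E. auto. Qed.

Lemma pseries_on_plus (f g : C -> C) s0 r c d :
  pseries_on f s0 r c -> pseries_on g s0 r d ->
  pseries_on (fun s => (f s + g s)%C) s0 r (fun k => (c k + d k)%C).
Proof.
  intros Hf Hg w Hw. eapply Cseries_ext; [|apply (Cseries_plus _ _ _ _ (Hf w Hw) (Hg w Hw))].
  intros k. cbv beta. ring.
Qed.

Lemma pseries_on_scal (z : C) (f : C -> C) s0 r c :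
  pseries_on f s0 r c -> pseries_on (fun s => (z * f s)%C) s0 r (fun k => (z * c k)%C).
Proof.
  intros Hf w Hw. eapply Cseries_ext; [|apply (Cseries_scal z _ _ (Hf w Hw))].
  intros k. cbv beta. ring.
Qed.

Lemma pseries_on_mul_var (f : C -> C) s0 r c :
  pseries_on f s0 r c ->
  pseries_on (fun s => (s * f s)%C) s0 r (fun k => (s0 * c k + coef_shift c k)%C).
Proof.
  intros Hf w Hw. apply (Cseries_mul_var _ _ _ _ (Hf w Hw)).
Qed.

Lemma pseries_on_translate (f : C -> C) (z s0 : C) r c :
  pseries_on f (s0 + z)%C r c -> pseries_on (fun s => f (s + z)%C) s0 r c.
Proof.
  intros Hf w Hw. replace (s0 + w + z)%C with (s0 + z + w)%C by ring. now apply Hf.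
Qed.

Lemma pseries_coef_bound (f : C -> C) s0 r c rho :
  pseries_on f s0 r c -> 0 < rho < r ->
  exists B, 0 <= B /\ forall k, Cmod (c k) * rho ^ k <= B.
Proof.
  intros Hf Hr. specialize (Hf (RtoC rho)).
  rewrite Cmod_R, Rabs_pos_eq in Hf by lra. specialize (Hf ltac:(lra)).
  destruct (filterlim_bounded (V := C_NormedModule) (sum_n (fun k => (c k * RtoC rho ^ k)%C)))
    as [M HM]; [now exists (f (s0 + RtoC rho)%C)|].
  assert (HM' : forall n, Cmod (Csum (fun k => c k * RtoC rho ^ k)%C n) <= M).
  { intros n. exact (HM n). }
  assert (M0 : 0 <= M) by (eapply Rle_trans; [apply Cmod_ge_0|apply (HM' 0%nat)]).
  exists (2 * M). split; [lra|]. intros k.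
  replace (Cmod (c k) * rho ^ k) with (Cmod (c k * RtoC rho ^ k)%C)
    by (rewrite Cmod_mult, Cmod_pow, Cmod_R, Rabs_pos_eq; lra).
  destruct k as [|k].
  - pose proof (HM' 0%nat) as H. rewrite Csum_0 in H. lra.
  - pose proof (HM' (S k)) as H1. pose proof (HM' k) as H2. rewrite Csum_S in H1.
    set (S1 := Csum _ k) in *. set (t := (c (S k) * RtoC rho ^ S k)%C) in *.
    replace t with ((S1 + t) + - S1)%C by ring.
    eapply Rle_trans; [apply Cmod_triangle|]. rewrite Cmod_opp. lra.
Qed.

(** If the [c j rho^j] are bounded, then for [|w| <= rho / 2] the remaining terms
    are dominated by a geometric series of ratio [1/2]. *)
Lemma pseries_tail_bound (f : C -> C) s0 r c :
  0 < r -> pseries_on f s0 r c -> forall k, exists A delta, 0 <= A /\ 0 < delta < r /\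
  forall w, Cmod w <= delta ->
    Cmod (f (s0 + w) - Csum (fun j => c j * w ^ j) k)%C <= A * Cmod w ^ S k.
Proof.
  intros Hr Hf k. destruct (pseries_coef_bound f s0 r c (r / 2) Hf ltac:(lra)) as [B [B0 HB]].
  set (rho := r / 2) in *. assert (Hrho : 0 < rho) by (unfold rho; lra).
  exists (2 * B / rho ^ S k), (rho / 2).
  assert (Hp : 0 < rho ^ S k) by now apply pow_lt.
  repeat split; [apply Rdiv_le_0_compat; lra|lra|unfold rho; lra|].
  intros w Hw. pose proof (Cmod_ge_0 w) as Hw0.
  set (x := Cmod w / rho).
  assert (Hx : 0 <= x <= 1 / 2).
  { split; [apply Rdiv_le_0_compat; lra|]. apply Rle_div_l; lra. }
  assert (Ew : Cmod w = x * rho) by (unfold x; field; lra).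
  apply Cseries_le_bound with (fun j => (c (S k + j)%nat * w ^ (S k + j))%C).
  - apply (is_series_incr_n (fun j => (c j * w ^ j)%C) (S k)); [lia|].
    change (sum_n (fun j => (c j * w ^ j)%C) (Init.Nat.pred (S k)))
      with (Csum (fun j => (c j * w ^ j)%C) k).
    replace (plus _ _) with (f (s0 + w)%C).
    + apply Hf. unfold rho in *. lra.
    + set (z := Csum _ k). change (f (s0 + w) = f (s0 + w) - z + z)%C. ring.
  - intros n. apply Rle_trans with (sum_n (fun j => B * x ^ S k * x ^ j) n).
    + apply Rsum_le. intros j. rewrite Cmod_mult, Cmod_pow, Ew.
      specialize (HB (S k + j)%nat). rewrite Rpow_mult_distr.
      replace (B * x ^ S k * x ^ j) with (B * x ^ (S k + j)) by (rewrite pow_add; ring).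
      assert (0 <= x ^ (S k + j)) by (apply pow_le; lra). nra.
    + rewrite Rsum_scal.
      assert (Hx0 : 0 <= x ^ S k) by (apply pow_le; lra).
      apply Rle_trans with (B * x ^ S k * 2).
      * apply Rmult_le_compat_l; [nra|].
        eapply Rle_trans; [apply geometric_sum_le; lra|].
        rewrite <- (Rinv_inv 2). apply Rinv_le_contravar; lra.
      * apply Req_le. rewrite Ew, Rpow_mult_distr. field. lra.
Qed.

(** A power series with zeros accumulating at its centre vanishes: its first
    non-zero term would dominate the others. *)
Lemma pseries_accumulating_zeros (f : C -> C) s0 r c :
  0 < r -> pseries_on f s0 r c ->
  (forall d, 0 < d -> exists w : C, w <> 0 /\ Cmod w < d /\ f (s0 + w)%C = 0) ->
  forall k, c k = 0.
Proof.
  intros Hr Hf Hz k. induction k as [k IH] using lt_wf_ind.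
  destruct (pseries_tail_bound f s0 r c Hr Hf k) as [A [delta [A0 [Hd HA]]]].
  apply Cmod_eq_0. apply Rle_antisym; [|apply Cmod_ge_0].
  apply Rle_plus_epsilon. intros eps Heps. rewrite Rplus_0_l.
  destruct (Hz (Rmin delta (eps / (A + 1)))) as [w [Hw0 [Hw Hfw]]].
  { apply Rmin_glb_lt; [lra|apply Rdiv_lt_0_compat; lra]. }
  pose proof (Rmin_l delta (eps / (A + 1))). pose proof (Rmin_r delta (eps / (A + 1))).
  specialize (HA w ltac:(lra)). rewrite Hfw in HA.
  rewrite (Csum_single _ k k) in HA; [|lia|].
  2: { intros i Hi Hik. rewrite IH by lia. ring. }
  assert (Hwp : 0 < Cmod w) by now apply Cmod_gt_0.
  assert (Hwk : 0 < Cmod w ^ k) by now apply pow_lt.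
  replace (0 - c k * w ^ k)%C with (- (c k * w ^ k))%C in HA by ring.
  rewrite Cmod_opp, Cmod_mult, Cmod_pow in HA. simpl pow in HA.
  assert (Hck : Cmod (c k) <= A * Cmod w).
  { apply Rmult_le_reg_r with (Cmod w ^ k); [exact Hwk|]. lra. }
  assert (Hlt : Cmod w * (A + 1) <= eps).
  { replace eps with (eps / (A + 1) * (A + 1)) by (field; lra).
    apply Rmult_le_compat_r; lra. }
  lra.
Qed.

Lemma pseries_zero_coef (f : C -> C) s0 r c :
  pseries_on f s0 r c -> (forall k, c k = 0) -> forall w, Cmod w < r -> f (s0 + w)%C = 0.
Proof.
  intros Hf Hc w Hw. apply (Cseries_unique (fun k => (c k * w ^ k)%C)); [now apply Hf|].
  apply Cseries_ext with (fun _ => RtoC 0); [intros k; rewrite Hc; ring|].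
  apply Cseries_components. split; apply is_series_0.
Qed.

(** At the supremum of the parameters up to which [f] vanishes, zeros accumulate,
    so [f] vanishes on a disc; hence the supremum is [1]. *)
Lemma identity_theorem_segment (f : C -> C) (z v : C) (eta : R) :
  v <> 0 -> 0 < eta ->
  (forall t, 0 <= t <= 1 -> has_pseries f (z + RtoC t * v)%C) ->
  (forall t, 0 <= t < eta -> f (z + RtoC t * v)%C = 0) ->
  forall r c, 0 < r -> pseries_on f (z + v)%C r c -> forall k, c k = 0.
Proof.
  intros Hv Heta Han H0.
  assert (Hvp : 0 < Cmod v) by now apply Cmod_gt_0.
  set (E := fun T => 0 <= T <= 1 /\ forall t, 0 <= t < T -> f (z + RtoC t * v)%C = 0).
  destruct (completeness E) as [T [Hub Hlub]].
  { exists 1. intros x [Hx _]. lra. }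
  { exists 0. split; [lra|]. intros; lra. }
  assert (HT1 : T <= 1) by (apply Hlub; intros x [Hx _]; lra).
  assert (HT0 : 0 < T).
  { apply Rlt_le_trans with (Rmin eta 1); [apply Rmin_glb_lt; lra|].
    apply Hub. pose proof (Rmin_l eta 1). pose proof (Rmin_r eta 1).
    split; [split; [apply Rmin_glb; lra|lra]|]. intros t Ht. apply H0. lra. }
  assert (HTz : forall t, 0 <= t < T -> f (z + RtoC t * v)%C = 0).
  { intros t Ht. apply NNPP. intros Hne.
    assert (HTt : T <= t); [|lra].
    apply Hlub. intros x [Hx Hxz]. apply Rnot_lt_le. intros L. apply Hne, Hxz. lra. }
  assert (Hacc : forall d, 0 < d -> exists w : C, w <> 0 /\ Cmod w < d
            /\ f (z + RtoC T * v + w)%C = 0).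
  { intros d Hd. set (e := Rmin T (d / (2 * Cmod v))).
    assert (He0 : 0 < d / (2 * Cmod v)) by (apply Rdiv_lt_0_compat; lra).
    assert (He : 0 < e) by (apply Rmin_glb_lt; lra).
    exists (RtoC (- e) * v)%C. split; [|split].
    - apply Cmult_neq_0; [|exact Hv]. intros F. apply RtoC_inj in F. lra.
    - rewrite Cmod_mult, Cmod_R, Rabs_Ropp, Rabs_pos_eq by lra.
      apply Rle_lt_trans with (d / (2 * Cmod v) * Cmod v).
      + apply Rmult_le_compat_r; [lra|apply Rmin_r].
      + replace (d / (2 * Cmod v) * Cmod v) with (d / 2) by (field; lra). lra.
    - replace (z + RtoC T * v + RtoC (- e) * v)%C with (z + RtoC (T - e) * v)%C.
      + apply HTz. pose proof (Rmin_l T (d / (2 * Cmod v))). fold e in H. lra.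
      + unfold Rminus. rewrite RtoC_plus. ring. }
  destruct (Req_dec T 1) as [E1|Hne].
  - intros r c Hr Hc. apply (pseries_accumulating_zeros f (z + v)%C r c Hr Hc).
    rewrite E1 in Hacc. replace (z + RtoC 1 * v)%C with (z + v)%C in Hacc by ring. exact Hacc.
  - exfalso. destruct (Han T ltac:(lra)) as [r [c [Hr Hc]]].
    pose proof (pseries_accumulating_zeros f _ r c Hr Hc Hacc) as Hc0.
    pose proof (pseries_zero_coef f _ r c Hc Hc0) as Hdisc.
    set (e := Rmin (1 - T) (r / (2 * Cmod v))).
    assert (He0 : 0 < r / (2 * Cmod v)) by (apply Rdiv_lt_0_compat; lra).
    assert (He : 0 < e) by (apply Rmin_glb_lt; lra).
    pose proof (Rmin_l (1 - T) (r / (2 * Cmod v))) as L1. fold e in L1.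
    assert (HE : E (T + e)).
    { split; [lra|]. intros t Ht. destruct (Rlt_le_dec t T) as [L|L]; [apply HTz; lra|].
      replace (z + RtoC t * v)%C with (z + RtoC T * v + RtoC (t - T) * v)%C.
      - apply Hdisc. rewrite Cmod_mult, Cmod_R, Rabs_pos_eq by lra.
        apply Rlt_le_trans with (e * Cmod v); [apply Rmult_lt_compat_r; lra|].
        apply Rle_trans with (r / (2 * Cmod v) * Cmod v).
        + apply Rmult_le_compat_r; [lra|apply Rmin_r].
        + replace (r / (2 * Cmod v) * Cmod v) with (r / 2) by (field; lra). lra.
      - unfold Rminus. rewrite RtoC_plus, RtoC_opp. ring. }
    apply Hub in HE. lra.
Qed.

Lemma pseries_C_derive (f : C -> C) s0 r c :
  0 < r -> pseries_on f s0 r c -> C_derive f s0 = c 1%nat.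
Proof.
  intros Hr Hf.
  destruct (pseries_tail_bound f s0 r c Hr Hf 1) as [A [delta [A0 [Hd HA]]]].
  assert (Hf0 : f s0 = c 0%nat).
  { pose proof (HA 0) as H. rewrite Cmod_0 in H. specialize (H ltac:(lra)).
    rewrite Csum_S, Csum_0 in H. simpl in H. rewrite !Rmult_0_l, Rmult_0_r in H.
    assert (E : (f (s0 + 0) - (c 0%nat * 1 + c 1%nat * (0 * 1)))%C = 0).
    { apply Cmod_eq_0. apply Rle_antisym; [exact H|apply Cmod_ge_0]. }
    replace s0 with (s0 + 0)%C at 1 by ring.
    replace (f (s0 + 0)%C) with ((f (s0 + 0) - (c 0%nat * 1 + c 1%nat * (0 * 1))) + c 0%nat)%C by ring.
    rewrite E. ring. }
  unfold C_derive. apply is_C_lim_unique.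
  apply filterlim_locally. intros eps.
  assert (Hd' : 0 < Rmin delta (eps / (A + 1)) / 2).
  { apply Rdiv_lt_0_compat; [|lra].
    apply Rmin_glb_lt; [lra|apply Rdiv_lt_0_compat; [apply cond_pos|lra]]. }
  exists (mkposreal _ Hd'). intros y Hy Hne.
  apply C_NormedModule_mixin_compat1.
  apply C_NormedModule_mixin_compat2 in Hy. simpl pos in Hy.
  set (w := (y - s0)%C). change (Cmod w < sqrt 2 * (Rmin delta (eps / (A + 1)) / 2)) in Hy.
  assert (S2 : sqrt 2 <= 2).
  { rewrite <- (sqrt_pow2 2) at 2 by lra. apply sqrt_le_1_alt. lra. }
  assert (Hw : Cmod w < Rmin delta (eps / (A + 1))) by nra.
  assert (Hy' : y = (s0 + w)%C).
  { unfold w. assert (G : forall a b : C, a = (b + (a - b))%C) by (intros; ring). apply G. }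
  assert (Hw0 : w <> 0).
  { intros E. apply Hne. rewrite Hy', E. apply Cplus_0_r. }
  pose proof (Rmin_l delta (eps / (A + 1))). pose proof (Rmin_r delta (eps / (A + 1))).
  specialize (HA w ltac:(lra)). rewrite Csum_S, Csum_0 in HA. rewrite Hf0.
  change (Cmod ((f y - c 0%nat) / w - c 1%nat)%C < eps).
  replace ((f y - c 0%nat) / w - c 1%nat)%C
    with ((f (s0 + w) - (c 0%nat * w ^ 0 + c 1%nat * w ^ 1)) / w)%C
    by (rewrite <- Hy'; simpl; field; exact Hw0).
  assert (Hwp : 0 < Cmod w) by now apply Cmod_gt_0.
  rewrite Cmod_div by exact Hw0. simpl pow in HA.
  apply Rle_lt_trans with (A * Cmod w).
  - apply Rle_div_l; [exact Hwp|]. simpl Cpow in *. lra.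
  - assert (Hlt : Cmod w * (A + 1) < eps).
    { replace (pos eps) with (eps / (A + 1) * (A + 1)) by (field; lra).
      apply Rmult_lt_compat_r; lra. }
    lra.
Qed.

(** * Analytic continuation of the odd part of the Hurwitz zeta function *)

(** [(n + x)^(-s) - (n - x)^(-s) + 2 s x n^(-s-1)] for [n = i + 1]. The last summand
    cancels the first odd Taylor term in [x], leaving [O(n^(-s-3))], summable
    beyond [s = -1]. *)
Definition remainder_term (x : R) (i : nat) (s : C) : C :=
  (Cexp (- s * RtoC (ln (INR (S i) + x))) - Cexp (- s * RtoC (ln (INR (S i) - x)))
   + RtoC (2 * (x / INR (S i))) * (s * Cexp (- s * RtoC (ln (INR (S i))))))%C.

Definition remainder_series (x : R) (s : C) : C := CSeries (fun i => remainder_term x i s).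

(** [remainder_term x i s] is [n^(-s)] times the power series in [s] with these
    coefficients, where [n = i + 1] and [y = x / n]. *)
Definition remainder_beta (y : R) (m : nat) : R :=
  ((- ln (1 + y)) ^ m - (- ln (1 - y)) ^ m) / INR (fact m)
  + (if Nat.eqb m 1 then 2 * y else 0).

Lemma Rabs_pow_diff_le (p q b : R) (m : nat) :
  Rabs p <= b -> Rabs q <= b -> Rabs (p ^ m - q ^ m) <= 2 * b ^ m.
Proof.
  intros Hp Hq. eapply Rle_trans; [apply Rabs_triang|].
  rewrite Rabs_Ropp, <- !RPow_abs.
  assert (Rabs p ^ m <= b ^ m) by (apply pow_incr; split; [apply Rabs_pos|exact Hp]).
  assert (Rabs q ^ m <= b ^ m) by (apply pow_incr; split; [apply Rabs_pos|exact Hq]).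
  lra.
Qed.

Lemma ln_one_minus_bound (u : R) : 0 <= u < 1 -> 0 <= - ln (1 - u) <= u / (1 - u).
Proof.
  intros Hu. split.
  - pose proof (ln_le_sub_1 (1 - u) ltac:(lra)). lra.
  - rewrite <- ln_Rinv by lra.
    eapply Rle_trans; [apply ln_le_sub_1, Rinv_0_lt_compat; lra|].
    apply Req_le. field. lra.
Qed.

Lemma ln_one_plus_bound (y : R) : 0 <= y -> 0 <= ln (1 + y) <= y.
Proof.
  intros Hy. split.
  - rewrite <- ln_1. apply ln_le; lra.
  - pose proof (ln_le_sub_1 (1 + y) ltac:(lra)). lra.
Qed.

Lemma ln_quotient_bound (y x : R) : 0 <= y <= x -> x < 1 ->
  Rabs (- ln (1 + y) + ln (1 - y) + 2 * y) <= 2 / (1 - x) * y ^ 3.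
Proof.
  intros Hy Hx.
  destruct (MVT_gen (fun t => - ln (1 + t) + ln (1 - t) + 2 * t) 0 y
    (fun t => - (2 * t ^ 2 / (1 - t ^ 2)))) as [c [Hc E]].
  - rewrite Rmin_left, Rmax_right by lra. intros t Ht.
    auto_derive; [lra|]. field. nra.
  - rewrite Rmin_left, Rmax_right by lra. intros t Ht. apply continuity_pt_filterlim.
    apply (continuous_of_ex_derive (fun t => - ln (1 + t) + ln (1 - t) + 2 * t)).
    auto_derive. lra.
  - rewrite Rmin_left, Rmax_right in Hc by lra.
    rewrite Rplus_0_r, Rminus_0_r, ln_1 in E.
    replace (- ln (1 + y) + ln (1 - y) + 2 * y) with (- (2 * c ^ 2 / (1 - c ^ 2)) * (y - 0)) by lra.
    assert (H1 : 0 < 1 - x) by lra.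
    assert (H2 : 1 - x <= 1 - c ^ 2) by nra.
    assert (H3 : 0 <= 2 * c ^ 2 / (1 - c ^ 2) <= 2 * y ^ 2 / (1 - x)).
    { split; [apply Rdiv_le_0_compat; nra|].
      apply Rmult_le_compat; [nra|left; apply Rinv_0_lt_compat; lra|nra|].
      apply Rinv_le_contravar; lra. }
    rewrite Rminus_0_r, Rabs_mult, Rabs_Ropp, !Rabs_pos_eq by lra.
    replace (2 / (1 - x) * y ^ 3) with (2 * y ^ 2 / (1 - x) * y) by (field; lra).
    apply Rmult_le_compat_r; lra.
Qed.

(** The terms with [m <= 2] are [O(y^3)] by cancellation. *)
Lemma remainder_beta_bound (x y A : R) (m : nat) : 0 <= y <= x -> x < 1 -> 0 <= A ->
  Rabs (remainder_beta y m) * A ^ m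
  <= 4 * y ^ 3 * ((A / (1 - x)) ^ m / INR (fact m)).
Proof.
  intros Hy Hx HA. set (c := / (1 - x)).
  assert (Hc : 1 <= c).
  { unfold c. rewrite <- Rinv_1. apply Rinv_le_contravar; lra. }
  replace (A / (1 - x)) with (c * A) by (unfold c; field; lra).
  assert (Hu : forall u, 0 <= u <= x -> u / (1 - u) <= c * u).
  { intros u Hu. unfold c, Rdiv. rewrite Rmult_comm. apply Rmult_le_compat_r; [lra|].
    apply Rinv_le_contravar; lra. }
  pose proof (ln_one_plus_bound y ltac:(lra)) as P1.
  pose proof (ln_one_minus_bound y ltac:(lra)) as Q1. pose proof (Hu y Hy) as Q2.
  set (p := - ln (1 + y)). set (q := - ln (1 - y)).
  assert (Hp : Rabs p <= c * y).
  { unfold p. rewrite Rabs_Ropp, Rabs_pos_eq by lra. nra. }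
  assert (Hq : Rabs q <= c * y) by (unfold q; rewrite Rabs_pos_eq; lra).
  assert (Hpq : Rabs (p + q) <= c * y ^ 2).
  { assert (E : p + q = - ln (1 - y ^ 2)).
    { unfold p, q. replace (1 - y ^ 2) with ((1 + y) * (1 - y)) by ring.
      rewrite ln_mult by lra. ring. }
    rewrite E. pose proof (ln_one_minus_bound (y ^ 2) ltac:(nra)) as L.
    pose proof (Hu (y ^ 2) ltac:(nra)). rewrite Rabs_pos_eq; lra. }
  assert (H1 : Rabs (p - q + 2 * y) <= 2 * c * y ^ 3).
  { unfold p, q. replace (- ln (1 + y) - - ln (1 - y) + 2 * y)
      with (- ln (1 + y) + ln (1 - y) + 2 * y) by ring.
    apply (ln_quotient_bound y x Hy Hx). }
  unfold remainder_beta. fold p q.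
  assert (Hy3 : 0 <= y ^ 3) by (apply pow_le; lra).
  destruct m as [|[|[|m]]].
  - simpl. replace ((1 - 1) / 1 + 0) with 0 by field. rewrite Rabs_R0. lra.
  - change (Nat.eqb 1 1) with true. cbv iota. simpl (INR (fact 1)). rewrite !pow_1.
    replace ((p - q) / 1 + 2 * y) with (p - q + 2 * y) by field.
    apply Rle_trans with (2 * c * y ^ 3 * A); [apply Rmult_le_compat_r; lra|].
    assert (0 <= c * A * y ^ 3) by (apply Rmult_le_pos; nra). lra.
  - change (Nat.eqb 2 1) with false. cbv iota. replace (INR (fact 2)) with 2 by (simpl; ring).
    replace ((p ^ 2 - q ^ 2) / 2 + 0) with ((p - q) * (p + q) / 2) by field.
    assert (Hd : Rabs (p - q) <= 2 * (c * y)).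
    { eapply Rle_trans; [apply Rabs_triang|]. rewrite Rabs_Ropp. lra. }
    assert (Hprod : Rabs (p - q) * Rabs (p + q) <= 2 * (c * y) * (c * y ^ 2)).
    { apply Rmult_le_compat; try apply Rabs_pos; assumption. }
    unfold Rdiv. rewrite !Rabs_mult, (Rabs_pos_eq (/ 2)) by lra.
    apply Rle_trans with (2 * (c * y) * (c * y ^ 2) * / 2 * A ^ 2).
    + apply Rmult_le_compat_r; [nra|]. apply Rmult_le_compat_r; lra.
    + replace (2 * (c * y) * (c * y ^ 2) * / 2 * A ^ 2) with ((c * A) ^ 2 * y ^ 3) by field.
      assert (0 <= (c * A) ^ 2 * y ^ 3) by (apply Rmult_le_pos; nra). lra.
  - change (Nat.eqb (S (S (S m))) 1) with false. cbv iota. set (k := S (S (S m))).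
    assert (Hf : 0 < / INR (fact k)) by apply Rinv_0_lt_compat, INR_fact_lt_0.
    rewrite Rplus_0_r. unfold Rdiv. rewrite Rabs_mult, (Rabs_pos_eq (/ _)) by lra.
    pose proof (Rabs_pow_diff_le p q (c * y) k Hp Hq) as Hk.
    assert (Hyk : y ^ k <= y ^ 3).
    { unfold k. change (S (S (S m))) with (3 + m)%nat. rewrite pow_add.
      assert (y ^ m <= 1) by (rewrite <- (pow1 m); apply pow_incr; lra). nra. }
    apply Rle_trans with (2 * (c * y) ^ k * / INR (fact k) * A ^ k).
    + apply Rmult_le_compat_r; [now apply pow_le|]. apply Rmult_le_compat_r; lra.
    + rewrite !Rpow_mult_distr.
      assert (H0 : 0 <= c ^ k * A ^ k * / INR (fact k)).
      { apply Rmult_le_pos; [apply Rmult_le_pos; apply pow_le; lra|lra]. }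
      set (Z := c ^ k * A ^ k * / INR (fact k)) in *.
      replace (2 * (c ^ k * y ^ k) * / INR (fact k) * A ^ k) with (2 * y ^ k * Z) by (unfold Z; ring).
      nra.
Qed.

Lemma Cseries_single (z : C) (p : nat) : Cseries (fun m => if Nat.eqb m p then z else 0) z.
Proof.
  apply Cseries_eps. intros eps Heps. exists p. intros n Hn.
  rewrite (Csum_single _ p n Hn).
  - rewrite Nat.eqb_refl. replace (z - z)%C with (RtoC 0) by ring. now rewrite Cmod_0.
  - intros i _ Hi. now rewrite (proj2 (Nat.eqb_neq _ _) Hi).
Qed.

Definition remainder_summand (x : R) (i m : nat) (s : C) : C :=
  (RtoC (remainder_beta (x / INR (S i)) m) * (s ^ m * Cexp (- s * RtoC (ln (INR (S i))))))%C.

Lemma remainder_term_series (x : R) (i : nat) (s : C) : 0 < x < 1 ->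
  Cseries (fun m => remainder_summand x i m s) (remainder_term x i s).
Proof.
  intros Hx. pose proof (INR_S_ge_1 i) as R1.
  unfold remainder_summand. set (n := INR (S i)) in *. set (y := x / n).
  assert (Hy : 0 < y < 1).
  { split; [apply Rdiv_lt_0_compat; lra|]. apply Rlt_div_l; lra. }
  set (E := Cexp (- s * RtoC (ln n))%C).
  assert (Ep : Cexp (- s * RtoC (ln (n + x)))%C = (E * Cexp (s * RtoC (- ln (1 + y))))%C).
  { unfold E. rewrite <- Cexp_plus. f_equal.
    replace (n + x) with (n * (1 + y)) by (unfold y; field; lra).
    rewrite ln_mult by lra. rewrite RtoC_plus, RtoC_opp. ring. }
  assert (Eq : Cexp (- s * RtoC (ln (n - x)))%C = (E * Cexp (s * RtoC (- ln (1 - y))))%C).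
  { unfold E. rewrite <- Cexp_plus. f_equal.
    replace (n - x) with (n * (1 - y)) by (unfold y; field; lra).
    rewrite ln_mult by lra. rewrite RtoC_plus, RtoC_opp. ring. }
  pose proof (Cseries_scal E _ _ (Cexp_series (s * RtoC (- ln (1 + y)))%C)) as S1.
  pose proof (Cseries_scal E _ _ (Cexp_series (s * RtoC (- ln (1 - y)))%C)) as S2.
  pose proof (Cseries_single (RtoC (2 * y) * (s * E))%C 1) as S3.
  pose proof (Cseries_plus _ _ _ _ (Cseries_minus _ _ _ _ S1 S2) S3) as S4.
  unfold remainder_term. fold n y E. rewrite Ep, Eq.
  eapply Cseries_ext; [|exact S4]. intros m. cbv beta. unfold remainder_beta.
  rewrite !Cpow_mult_l, <- !RtoC_pow.
  assert (Hf : INR (fact m) <> 0) by apply INR_fact_neq_0.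
  assert (Hf' : RtoC (INR (fact m)) <> 0) by (intros F; apply RtoC_inj in F; lra).
  rewrite RtoC_plus, RtoC_div, RtoC_minus by exact Hf.
  destruct (Nat.eqb_spec m 1) as [->|Hm].
  - simpl Cpow. field. exact Hf'.
  - field. exact Hf'.
Qed.

(** [n^(-3/2)] is dominated by the telescoping [4/sqrt (n-1) - 4/sqrt n]. *)
Lemma ex_series_three_halves : ex_series (fun i => exp (- (3 / 2 * ln (INR (S i))))).
Proof.
  assert (E : forall i, exp (- (3 / 2 * ln (INR (S i)))) = / sqrt (INR (S i)) ^ 3).
  { intros i. pose proof (INR_S_pos i) as R1.
    pose proof (sqrt_lt_R0 _ R1) as Hs.
    rewrite <- (sqrt_sqrt (INR (S i))) at 1 by lra. rewrite ln_mult by exact Hs.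
    rewrite exp_Ropp. f_equal.
    replace (3 / 2 * (ln (sqrt (INR (S i))) + ln (sqrt (INR (S i)))))
      with (ln (sqrt (INR (S i))) + (ln (sqrt (INR (S i))) + ln (sqrt (INR (S i))))) by field.
    rewrite !exp_plus, !exp_ln by exact Hs. ring. }
  apply ex_series_bounded with 5; [intros; left; apply exp_pos|].
  intros n. apply Rle_trans with (5 - 4 / sqrt (INR (S n))).
  - induction n as [|n IH].
    + rewrite sum_O, E. simpl (INR 1). rewrite sqrt_1. lra.
    + rewrite Rsum_S, E. eapply Rle_trans; [apply Rplus_le_compat_r, IH|].
      set (a := sqrt (INR (S n))). set (b := sqrt (INR (S (S n)))).
      assert (Ha : 0 < a) by (apply sqrt_lt_R0, lt_0_INR; lia).
      assert (Ea : a * a = INR (S n)) by (apply sqrt_sqrt, pos_INR).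
      assert (Eb : b * b = INR (S n) + 1) by (rewrite <- S_INR; apply sqrt_sqrt, pos_INR).
      assert (Hb : 0 < b) by (apply sqrt_lt_R0, lt_0_INR; lia).
      assert (Hab : a <= b) by nra.
      assert (D : 4 / a - 4 / b = 4 / (a * b * (a + b))).
      { replace (4 / a - 4 / b) with (4 * (b - a) * (a + b) / (a * b * (a + b))) by (field; lra).
        replace (4 * (b - a) * (a + b)) with (4 * (b * b - a * a)) by ring.
        rewrite Ea, Eb. unfold Rdiv. f_equal. ring. }
      assert (G : / b ^ 3 <= 4 / (a * b * (a + b))); [|lra].
      replace (/ b ^ 3) with (4 / (4 * b ^ 3)) by (field; lra).
      apply Rmult_le_compat_l; [lra|]. apply Rinv_le_contravar.
      * repeat apply Rmult_lt_0_compat; lra.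
      * replace (4 * b ^ 3) with (b * (4 * (b * b))) by ring.
        replace (a * b * (a + b)) with (b * (a * (a + b))) by ring.
        apply Rmult_le_compat_l; [lra|]. nra.
  - assert (0 < 4 / sqrt (INR (S n))); [|lra].
    apply Rdiv_lt_0_compat; [lra|]. apply sqrt_lt_R0, lt_0_INR. lia.
Qed.

Definition power_coef (i : nat) (s0 : C) (k : nat) : C :=
  (Cexp (- s0 * RtoC (ln (INR (S i)))) * (RtoC (- ln (INR (S i))) ^ k / RtoC (INR (fact k))))%C.

Definition remainder_coef (x : R) (s0 : C) (i k : nat) : C :=
  CSeries (fun m => (RtoC (remainder_beta (x / INR (S i)) m)
                     * mul_pow_coef s0 (power_coef i s0) m k)%C).

Definition remainder_norm (x : R) (s0 : C) : R := 4 * exp ((Cmod s0 + 1 / 2) / (1 - x)).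

(** Each term is [O(n^(-3))] times [|n^(-s)|], which is at most [n^(3/2)] within
    distance [1/2] of [s0] when [Re s0 >= -1]. *)
Lemma normed_pseries_remainder_term (x : R) (s0 : C) (i : nat) :
  0 < x < 1 -> -1 <= Re s0 ->
  normed_pseries (remainder_term x i) s0 (1 / 2)
    (remainder_norm x s0 * exp (- (3 / 2 * ln (INR (S i))))) (remainder_coef x s0 i).
Proof.
  intros Hx Hs0. pose proof (INR_S_ge_1 i) as R1.
  set (n := INR (S i)) in *. set (L := ln n).
  assert (HL : 0 <= L) by (unfold L; rewrite <- ln_1; apply ln_le; lra).
  set (A := Cmod s0 + 1 / 2). pose proof (Cmod_ge_0 s0) as Hc.
  set (y := x / n).
  assert (Hy : 0 < y <= x).
  { split; [apply Rdiv_lt_0_compat; lra|]. apply Rle_div_l; nra. }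
  set (W := exp (- (Re s0 * L) + Rabs L * (1 / 2))).
  assert (Hterm : forall m, normed_pseries (remainder_summand x i m) s0 (1 / 2)
            (Cmod (RtoC (remainder_beta y m)) * (A ^ m * W))
            (fun k => (RtoC (remainder_beta y m) * mul_pow_coef s0 (power_coef i s0) m k)%C)).
  { intros m. apply normed_pseries_scal. apply normed_pseries_mul_pow; [lra|].
    apply normed_pseries_exp. lra. }
  set (b := fun m => Cmod (RtoC (remainder_beta y m)) * (A ^ m * W)).
  assert (HW : 0 < W) by apply exp_pos.
  assert (Hb : forall N, sum_n b N <= 4 * y ^ 3 * exp (A / (1 - x)) * W).
  { intros N.
    apply Rle_trans with (sum_n (fun m => 4 * y ^ 3 * W * ((A / (1 - x)) ^ m / INR (fact m))) N).
    - apply Rsum_le. intros m. unfold b. rewrite Cmod_R.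
      pose proof (remainder_beta_bound x y A m ltac:(lra) ltac:(lra) ltac:(unfold A; lra)) as G.
      apply Rmult_le_compat_r with (r := W) in G; lra.
    - rewrite Rsum_scal.
      replace (4 * y ^ 3 * exp (A / (1 - x)) * W) with (4 * y ^ 3 * W * exp (A / (1 - x))) by ring.
      apply Rmult_le_compat_l.
      + apply Rmult_le_pos; [|lra]. apply Rmult_le_pos; [lra|apply pow_le; lra].
      + apply exp_series_bound. apply Rdiv_le_0_compat; [unfold A; lra|lra]. }
  assert (Hb0 : forall m, 0 <= b m).
  { intros m. unfold b. apply Rmult_le_pos; [apply Cmod_ge_0|].
    apply Rmult_le_pos; [apply pow_le; unfold A; lra|lra]. }
  assert (Hex : ex_series b) by (apply (ex_series_bounded b _ Hb0 Hb)).
  pose proof (normed_pseries_series _ s0 (1 / 2) b _ ltac:(lra) Hterm Hex) as H.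
  apply normed_pseries_ext with (g := remainder_term x i) in H.
  2: { intros s. apply Cseries_CSeries. now apply remainder_term_series. }
  eapply normed_pseries_weaken; [|exact H].
  eapply Rle_trans; [apply (series_le_bound b _ _ (Series_correct _ Hex) Hb)|].
  unfold remainder_norm. fold A.
  assert (Hn3 : y ^ 3 * W <= exp (- (3 / 2 * L))).
  { assert (En : n = exp L) by (unfold L; rewrite exp_ln; lra).
    apply Rle_trans with (exp (- L) ^ 3 * W).
    - apply Rmult_le_compat_r; [lra|]. apply pow_incr. split; [lra|].
      unfold y. rewrite exp_Ropp, <- En. unfold Rdiv.
      assert (0 < / n) by (apply Rinv_0_lt_compat; lra). nra.
    - unfold W. rewrite (Rabs_pos_eq L) by exact HL. simpl pow.
      rewrite Rmult_1_r, <- !exp_plus.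
      destruct (Req_dec (- L + (- L + - L) + (- (Re s0 * L) + L * (1 / 2))) (- (3 / 2 * L))) as [->|Hne]; [lra|].
      left. apply exp_increasing. nra. }
  assert (He : 0 < exp (A / (1 - x))) by apply exp_pos.
  replace (4 * y ^ 3 * exp (A / (1 - x)) * W) with (4 * exp (A / (1 - x)) * (y ^ 3 * W)) by ring.
  apply Rmult_le_compat_l; lra.
Qed.

Lemma pseries_remainder_series (x : R) (s0 : C) : 0 < x < 1 -> -1 <= Re s0 ->
  pseries_on (remainder_series x) s0 (1 / 2) (fun k => CSeries (fun i => remainder_coef x s0 i k)).
Proof.
  intros Hx Hs. eapply normed_has_pseries; [lra|].
  apply (normed_pseries_series (remainder_term x) s0 (1 / 2)
    (fun i => remainder_norm x s0 * exp (- (3 / 2 * ln (INR (S i))))) (remainder_coef x s0)).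
  - lra.
  - intros i. now apply normed_pseries_remainder_term.
  - destruct ex_series_three_halves as [l Hl]. exists (remainder_norm x s0 * l).
    apply (is_series_scal (remainder_norm x s0) _ _ Hl).
Qed.

Lemma pseries_power (L r : R) (s0 : C) : 0 <= r ->
  pseries_on (fun s => Cexp (- s * RtoC L)%C) s0 r
    (fun k => (Cexp (- s0 * RtoC L) * (RtoC (- L) ^ k / RtoC (INR (fact k))))%C).
Proof.
  intros Hr w Hw. destruct (normed_pseries_exp L s0 r Hr) as [_ H]. apply H. lra.
Qed.

Lemma Cexp_ln (y : R) : 0 < y -> Cexp (RtoC (ln y)) = RtoC y.
Proof.
  intros Hy. unfold Cexp, RtoC, Re, Im. simpl. rewrite cos_0, sin_0, exp_ln by exact Hy.
  f_equal; ring.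
Qed.

Lemma Cexp_ln_at_m1 (y : R) : 0 < y -> Cexp (- RtoC (-1) * RtoC (ln y))%C = RtoC y.
Proof.
  intros Hy. replace (- RtoC (-1) * RtoC (ln y))%C with (RtoC (ln y)).
  - now apply Cexp_ln.
  - rewrite <- RtoC_opp, <- RtoC_mult. f_equal. ring.
Qed.

(** The derivative of [remainder_term x i] at [s = -1]. *)
Definition remainder_derivative (i : nat) (x : R) : R :=
  - ((INR (S i) + x) * ln (INR (S i) + x)) + (INR (S i) - x) * ln (INR (S i) - x)
  + 2 * x * (1 + ln (INR (S i))).

Lemma remainder_coef_1 (x : R) (i : nat) : 0 < x < 1 ->
  remainder_coef x (RtoC (-1)) i 1 = RtoC (remainder_derivative i x).
Proof.
  intros Hx. pose proof (INR_S_ge_1 i) as R1.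
  assert (Hre : -1 <= Re (RtoC (-1))) by (simpl; lra).
  pose proof (normed_pseries_remainder_term x (RtoC (-1)) i Hx Hre) as H1.
  assert (Hhalf : 0 < 1 / 2) by lra.
  apply normed_has_pseries in H1; [|lra].
  rewrite <- (pseries_C_derive _ _ _ _ Hhalf H1).
  pose proof (pseries_power (ln (INR (S i) + x)) (1 / 2) (RtoC (-1)) ltac:(lra)) as P1.
  pose proof (pseries_power (ln (INR (S i) - x)) (1 / 2) (RtoC (-1)) ltac:(lra)) as P2.
  pose proof (pseries_on_mul_var _ _ _ _
    (pseries_power (ln (INR (S i))) (1 / 2) (RtoC (-1)) ltac:(lra))) as P3.
  pose proof (pseries_on_plus _ _ _ _ _ _ (pseries_on_plus _ _ _ _ _ _ P1
    (pseries_on_scal (- (1))%C _ _ _ _ P2))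
    (pseries_on_scal (RtoC (2 * (x / INR (S i)))) _ _ _ _ P3)) as P.
  apply (pseries_on_ext _ (remainder_term x i)) in P;
    [|intros s; unfold remainder_term; ring].
  rewrite (pseries_C_derive _ _ _ _ Hhalf P). unfold remainder_derivative. clear P P1 P2 P3 H1.
  set (n := INR (S i)) in *. clearbody n. cbv beta. simpl coef_shift.
  simpl Cpow. simpl fact. simpl (INR 1). rewrite !Cexp_ln_at_m1 by lra.
  rewrite ?RtoC_plus, ?RtoC_opp, ?RtoC_minus, ?RtoC_mult, ?RtoC_plus, ?RtoC_minus, ?RtoC_div by lra.
  assert (RtoC n <> 0) by (intros F; apply RtoC_inj in F; lra).
  field. assumption.
Qed.

Definition has_pseries_derivative (f : C -> C) (s0 l : C) : Prop :=
  has_pseries f s0 /\ C_derive f s0 = l.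

Lemma has_pseries_derivative_plus (f g : C -> C) s0 l m :
  has_pseries_derivative f s0 l -> has_pseries_derivative g s0 m ->
  has_pseries_derivative (fun s => (f s + g s)%C) s0 (l + m)%C.
Proof.
  intros [[r [c [Hr Hf]]] <-] [[r' [d [Hr' Hg]]] <-].
  assert (H : pseries_on (fun s => (f s + g s)%C) s0 (Rmin r r') (fun k => (c k + d k)%C)).
  { apply pseries_on_plus.
    - eapply pseries_on_weaken; [apply Rmin_l|exact Hf].
    - eapply pseries_on_weaken; [apply Rmin_r|exact Hg]. }
  assert (Hm : 0 < Rmin r r') by now apply Rmin_glb_lt.
  split; [now exists (Rmin r r'), (fun k => (c k + d k)%C)|].
  rewrite (pseries_C_derive f s0 r c Hr Hf), (pseries_C_derive g s0 r' d Hr' Hg).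
  exact (pseries_C_derive _ _ _ _ Hm H).
Qed.

Lemma has_pseries_derivative_scal (z : C) (f : C -> C) s0 :
  has_pseries f s0 ->
  has_pseries_derivative (fun s => (z * f s)%C) s0 (z * C_derive f s0)%C.
Proof.
  intros [r [c [Hr Hf]]]. pose proof (pseries_on_scal z _ _ _ _ Hf) as H.
  split; [now exists r, (fun k => (z * c k)%C)|].
  rewrite (pseries_C_derive f s0 r c Hr Hf). exact (pseries_C_derive _ _ _ _ Hr H).
Qed.

Lemma has_pseries_mul_var (f : C -> C) s0 :
  has_pseries f s0 -> has_pseries (fun s => (s * f s)%C) s0.
Proof. intros [r [c [Hr Hf]]]. eexists _, _. split; [exact Hr|]. apply pseries_on_mul_var, Hf. Qed.

Lemma has_pseries_translate (f : C -> C) z s0 :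
  has_pseries f (s0 + z)%C -> has_pseries (fun s => f (s + z)%C) s0.
Proof. intros [r [c [Hr Hf]]]. eexists _, _. split; [exact Hr|]. apply pseries_on_translate, Hf. Qed.

Lemma has_pseries_power (L : R) s0 : has_pseries (fun s => Cexp (- s * RtoC L)%C) s0.
Proof. eexists 1, _. split; [lra|]. apply pseries_power. lra. Qed.

Lemma C_derive_power (y : R) : 0 < y ->
  C_derive (fun s => Cexp (- s * RtoC (ln y))%C) (RtoC (-1)) = RtoC (- (y * ln y)).
Proof.
  intros Hy. assert (H1 : 0 < 1) by lra.
  rewrite (pseries_C_derive _ _ _ _ H1 (pseries_power (ln y) 1 (RtoC (-1)) (Rlt_le _ _ H1))).
  rewrite Cexp_ln_at_m1 by exact Hy. simpl Cpow. simpl fact. simpl (INR 1).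
  rewrite !RtoC_opp, RtoC_mult. field.
Qed.

Lemma has_pseries_remainder (x : R) s0 : 0 < x < 1 -> -1 <= Re s0 ->
  has_pseries (remainder_series x) s0.
Proof. intros Hx Hs. eexists _, _. split; [|now apply pseries_remainder_series]. lra. Qed.

Lemma C_derive_remainder (x : R) : 0 < x < 1 ->
  C_derive (remainder_series x) (RtoC (-1)) = RtoC (Series (fun i => remainder_derivative i x)).
Proof.
  intros Hx. assert (Hh : 0 < 1 / 2) by lra. assert (Hre : -1 <= Re (RtoC (-1))) by (simpl; lra).
  rewrite (pseries_C_derive _ _ _ _ Hh (pseries_remainder_series x (RtoC (-1)) Hx Hre)).
  rewrite (CSeries_ext _ (fun i => RtoC (remainder_derivative i x)))
    by (intros; now apply remainder_coef_1).
  unfold CSeries, RtoC. f_equal. cbn [Im snd].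
  apply Series_0.
Qed.

Section Hurwitz.

Variable zeta : C -> R -> C.
Hypothesis Hzeta : is_hurwitz_zeta zeta.

(** [zeta(s+1, 1)] has its pole at [s = 0], off the segment used below. *)
Definition shifted_zeta (s : C) : C := (s * zeta (s + 1) 1)%C.

Lemma hurwitz_has_pseries (alpha : R) (s0 : C) : 0 < alpha -> s0 <> 1 ->
  has_pseries (fun s => zeta s alpha) s0.
Proof. intros Ha Hs. apply analytic_has_pseries. now apply Hzeta. Qed.

Lemma shifted_zeta_has_pseries (s0 : C) : s0 <> 0 -> has_pseries shifted_zeta s0.
Proof.
  intros Hs. apply (has_pseries_mul_var (fun s => zeta (s + 1)%C 1)).
  apply (has_pseries_translate (fun s => zeta s 1)).
  apply hurwitz_has_pseries; [lra|]. intros E. apply Hs.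
  replace s0 with (s0 + 1 - 1)%C by ring. rewrite E. ring.
Qed.

(** In the half-plane of convergence the Dirichlet series of
    [zeta(s,x) - zeta(s,1-x) - x^(-s)], paired as [n + x] and [n - x], differs from
    the convergent remainder series by the multiple [2 x s] of [zeta(s+1,1)]. *)
Definition continuation_defect (x : R) (s : C) : C :=
  (zeta s x + - (1) * zeta s (1 - x) + - (1) * Cexp (- s * RtoC (ln x))
   + RtoC (2 * x) * shifted_zeta s + - (1) * remainder_series x s)%C.

Lemma hurwitz_series (alpha : R) (s : C) : 0 < alpha -> 1 < Re s ->
  Cseries (fun n => Cexp (- s * RtoC (ln (INR n + alpha)))%C) (zeta s alpha).
Proof. intros Ha Hs. destruct (Hzeta alpha Ha) as [_ H]. apply (H s Hs). Qed.

Lemma continuation_defect_0 (x : R) (s : C) : 0 < x < 1 -> 1 < Re s ->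
  continuation_defect x s = 0.
Proof.
  intros Hx Hs.
  pose proof (hurwitz_series x s ltac:(lra) Hs) as H1.
  pose proof (hurwitz_series (1 - x) s ltac:(lra) Hs) as H2.
  assert (Hs1 : 1 < Re (s + 1)%C) by (destruct s; unfold Re, Cplus in *; simpl in *; lra).
  pose proof (hurwitz_series 1 (s + 1)%C ltac:(lra) Hs1) as H3.
  assert (H1' : Cseries (fun i => Cexp (- s * RtoC (ln (INR (S i) + x)))%C)
                  (zeta s x - Cexp (- s * RtoC (ln x)))%C).
  { apply (is_series_incr_1 (fun n => Cexp (- s * RtoC (ln (INR n + x)))%C)).
    simpl (INR 0). rewrite Rplus_0_l.
    replace (plus _ _) with (zeta s x); [exact H1|].
    set (e := Cexp (- s * RtoC (ln x))%C).
    change (zeta s x = zeta s x - e + e)%C. ring. }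
  pose proof (Cseries_plus _ _ _ _ (Cseries_minus _ _ _ _ H1' H2)
    (Cseries_scal (RtoC (2 * x) * s)%C _ _ H3)) as H.
  assert (E : remainder_series x s
    = (zeta s x - Cexp (- s * RtoC (ln x)) - zeta s (1 - x) + RtoC (2 * x) * s * zeta (s + 1) 1)%C).
  { apply Cseries_CSeries. eapply Cseries_ext; [|exact H]. intros i. cbv beta.
    pose proof (INR_S_pos i) as R1.
    unfold remainder_term. rewrite <- (S_INR i).
    replace (INR i + (1 - x)) with (INR (S i) - x) by (rewrite S_INR; ring).
    replace (Cexp (- (s + 1) * RtoC (ln (INR (S i))))%C)
      with (Cexp (- s * RtoC (ln (INR (S i)))) * / RtoC (INR (S i)))%C.
    - rewrite !RtoC_mult, RtoC_div by lra. unfold Cdiv. ring.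
    - replace (- (s + 1) * RtoC (ln (INR (S i))))%C
        with (- s * RtoC (ln (INR (S i))) + - RtoC (ln (INR (S i))))%C by ring.
      rewrite Cexp_plus, Cexp_opp, Cexp_ln by exact R1.
      reflexivity. }
  unfold continuation_defect, shifted_zeta. rewrite E. ring.
Qed.

Lemma continuation_defect_pseries (x : R) (s : C) :
  0 < x < 1 -> s <> 0 -> s <> 1 -> -1 <= Re s ->
  has_pseries_derivative (continuation_defect x) s
    (C_derive (fun s => zeta s x) s + - (1) * C_derive (fun s => zeta s (1 - x)) s
     + - (1) * C_derive (fun s => Cexp (- s * RtoC (ln x))) s
     + RtoC (2 * x) * C_derive shifted_zeta s + - (1) * C_derive (remainder_series x) s)%C.
Proof.
  intros Hx H0 H1 Hs. unfold continuation_defect.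
  refine (has_pseries_derivative_plus _ _ s _ _ (has_pseries_derivative_plus _ _ s _ _
    (has_pseries_derivative_plus _ _ s _ _ (has_pseries_derivative_plus _ _ s _ _
      (conj _ eq_refl) (has_pseries_derivative_scal _ _ s _))
      (has_pseries_derivative_scal _ _ s (has_pseries_power (ln x) s)))
      (has_pseries_derivative_scal _ _ s (shifted_zeta_has_pseries s H0)))
      (has_pseries_derivative_scal _ _ s (has_pseries_remainder x s Hx Hs)));
    apply hurwitz_has_pseries; (exact H1 || lra).
Qed.

(** The segment from [2 + 3 i] to [-1] avoids [0] and [1], starts in the half-plane
    of convergence, and stays in [Re s >= -1]. *)
Lemma hurwitz_odd_derivative (x : R) : 0 < x < 1 ->
  (dzeta zeta (RtoC (-1)) x - dzeta zeta (RtoC (-1)) (1 - x))%C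
  = (RtoC (Series (fun i => remainder_derivative i x) - x * ln x)
     - RtoC (2 * x) * C_derive shifted_zeta (RtoC (-1)))%C.
Proof.
  intros Hx.
  assert (N0 : RtoC (-1) <> 0) by (intros E; apply RtoC_inj in E; lra).
  assert (N1 : RtoC (-1) <> 1) by (intros E; apply RtoC_inj in E; lra).
  assert (Hre : -1 <= Re (RtoC (-1))) by (simpl; lra).
  set (z := (2, 3) : C). set (v := (-3, -3) : C).
  assert (Ezv : (z + v)%C = RtoC (-1)) by (unfold z, v, Cplus, RtoC; simpl; f_equal; ring).
  assert (Hg : forall t, (z + RtoC t * v)%C = (2 - 3 * t, 3 - 3 * t)).
  { intros t. unfold z, v, Cplus, Cmult, RtoC. simpl. f_equal; ring. }
  destruct (continuation_defect_pseries x (RtoC (-1)) Hx N0 N1 Hre) as [[r [c [Hr Hc]]] HD].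
  rewrite (pseries_C_derive _ _ r c Hr Hc),
    (identity_theorem_segment (continuation_defect x) z v (1 / 3)) with (r := r) in HD.
  - symmetry in HD. rewrite C_derive_power, C_derive_remainder in HD by lra.
    unfold dzeta. rewrite RtoC_minus. rewrite RtoC_opp in HD.
    set (d1 := C_derive (fun s => zeta s x) (RtoC (-1))) in *.
    set (d2 := C_derive (fun s => zeta s (1 - x)) (RtoC (-1))) in *.
    match type of HD with ?l = _ => replace (d1 - d2)%C with (d1 - d2 - l)%C by (rewrite HD; ring) end.
    ring.
  - intros E. unfold v, RtoC in E. injection E as E _. lra.
  - lra.
  - intros t Ht. rewrite Hg. apply continuation_defect_pseries; [exact Hx| | |simpl; lra];
      intros E; unfold RtoC in E; injection E as E1 E2; lra.
  - intros t Ht. rewrite Hg. apply continuation_defect_0; [exact Hx|]. simpl. lra.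
  - exact Hr.
  - rewrite Ezv. exact Hc.
Qed.

End Hurwitz.

(** * The odd part of [zeta'(-1, x)] as a Clausen function *)

Lemma primitive_limit_dilate (U g : R -> R) (c a b : R) : 0 < c ->
  primitive_limit U g (c * a) (c * b) ->
  primitive_limit (fun t => / c * U (c * t)) (fun t => g (c * t)) a b.
Proof.
  intros Hc HU eps Heps.
  assert (Hic : 0 < / c) by now apply Rinv_0_lt_compat.
  destruct (HU (Rmin eps (c * eps))) as [u [u' [Du Eu]]].
  { apply Rmin_glb_lt; [exact Heps|nra]. }
  pose proof (Rmin_l eps (c * eps)) as L1. pose proof (Rmin_r eps (c * eps)) as L2.
  exists (fun t => / c * u (c * t)), (fun t => u' (c * t)).
  assert (Hin : forall t, a <= t <= b -> c * a <= c * t <= c * b) by (intros; nra).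
  split.
  - intros t Ht. replace (u' (c * t)) with (/ c * (c * u' (c * t))) by (field; lra).
    apply (is_derive_scal (fun t => u (c * t))).
    apply (is_derive_comp u (fun t => c * t)); [apply Du; auto|].
    auto_derive; [exact I|ring].
  - intros t Ht. destruct (Eu (c * t) (Hin t Ht)) as [E1 E2]. split; [|lra].
    rewrite <- Rmult_minus_distr_l, Rabs_mult, (Rabs_pos_eq (/ c)) by lra.
    replace eps with (/ c * (c * eps)) by (field; lra).
    apply Rmult_le_compat_l; lra.
Qed.

Lemma sub_square_ratio (b t : R) (i : nat) : 0 <= t <= b -> b < 1 ->
  0 <= t ^ 2 / INR (S i) ^ 2 <= b ^ 2 / INR (S i) ^ 2 /\ t ^ 2 / INR (S i) ^ 2 <= b ^ 2 /\ b ^ 2 < 1.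
Proof.
  intros Ht Hb. pose proof (INR_S_ge_1 i) as R1.
  assert (Hi : 0 < / INR (S i) ^ 2 <= 1).
  { split; [apply Rinv_0_lt_compat; nra|rewrite <- Rinv_1; apply Rinv_le_contravar; nra]. }
  assert (Ht2 : 0 <= t ^ 2 <= b ^ 2) by nra. assert (Hb2 : b ^ 2 < 1) by nra.
  unfold Rdiv. set (z := / INR (S i) ^ 2) in *. clearbody z.
  repeat split; [apply Rmult_le_pos|apply Rmult_le_compat_r| |]; nra.
Qed.

Lemma remainder_log_bound (b t : R) (i : nat) : 0 <= t <= b -> b < 1 ->
  Rabs (- ln (1 - t ^ 2 / INR (S i) ^ 2)) <= / (1 - b ^ 2) * / INR (S i) ^ 2.
Proof.
  intros Ht Hb. destruct (sub_square_ratio b t i Ht Hb) as [[H0 H1] [H2 H3]].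
  set (u := t ^ 2 / INR (S i) ^ 2) in *.
  pose proof (ln_one_minus_bound u ltac:(lra)) as L. rewrite Rabs_pos_eq by lra.
  eapply Rle_trans; [apply L|]. unfold Rdiv. rewrite Rmult_comm.
  apply Rmult_le_compat; [left; apply Rinv_0_lt_compat; lra|exact H0| |].
  - apply Rinv_le_contravar; lra.
  - eapply Rle_trans; [exact H1|]. unfold Rdiv.
    rewrite <- (Rmult_1_l (/ INR (S i) ^ 2)) at 2. apply Rmult_le_compat_r; [|lra].
    left. apply inverse_square_pos.
Qed.

Lemma remainder_derivative_deriv (i : nat) (t : R) : 0 <= t < 1 ->
  is_derive (remainder_derivative i) t (- ln (1 - t ^ 2 / INR (S i) ^ 2)).
Proof.
  intros Ht. pose proof (INR_S_ge_1 i) as R1.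
  unfold remainder_derivative. set (n := INR (S i)) in *. clearbody n.
  auto_derive; [lra|].
  replace (1 - t ^ 2 / n ^ 2) with ((n + t) * (n - t) / (n * n)) by (field; lra).
  rewrite ln_div, !ln_mult by nra. unfold Rminus. field. lra.
Qed.

Lemma remainder_derivative_0 (i : nat) : remainder_derivative i 0 = 0.
Proof. unfold remainder_derivative. rewrite Rplus_0_r, Rminus_0_r. ring. Qed.

Lemma remainder_derivative_bound (b t : R) (i : nat) : 0 <= t <= b -> b < 1 ->
  Rabs (remainder_derivative i t) <= / (1 - b ^ 2) * / INR (S i) ^ 2.
Proof.
  intros Ht Hb.
  pose proof (primitive_limit_derive (remainder_derivative i)
    (fun t => - ln (1 - t ^ 2 / INR (S i) ^ 2)) 0 b) as H.
  specialize (H ltac:(intros; apply remainder_derivative_deriv; lra)).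
  pose proof (primitive_limit_lipschitz _ _ 0 b (/ (1 - b ^ 2) * / INR (S i) ^ 2) 0 t H) as L.
  specialize (L ltac:(intros; now apply remainder_log_bound) ltac:(lra) ltac:(lra) ltac:(lra)).
  rewrite remainder_derivative_0, !Rminus_0_r in L.
  eapply Rle_trans; [exact L|].
  destruct (sub_square_ratio b t i Ht Hb) as [_ [_ Hb2]].
  assert (0 < / (1 - b ^ 2)) by (apply Rinv_0_lt_compat; lra).
  assert (0 < / INR (S i) ^ 2) by (apply inverse_square_pos).
  set (P := / (1 - b ^ 2) * / INR (S i) ^ 2). assert (0 <= P) by (unfold P; nra). nra.
Qed.

Definition remainder_sum (x : R) : R := Series (fun i => remainder_derivative i x).

Lemma remainder_sum_primitive (b : R) : 0 < b < 1 ->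
  primitive_limit remainder_sum (fun t => Series (fun i => - ln (1 - t ^ 2 / INR (S i) ^ 2))) 0 b.
Proof.
  intros Hb.
  apply (primitive_limit_series remainder_derivative (fun i t => - ln (1 - t ^ 2 / INR (S i) ^ 2))
    (fun i => / (1 - b ^ 2) * / INR (S i) ^ 2) (fun i => / (1 - b ^ 2) * / INR (S i) ^ 2)).
  - intros i t Ht. apply remainder_derivative_deriv. lra.
  - intros i t Ht. split; [apply remainder_derivative_bound|apply remainder_log_bound]; lra.
  - destruct ex_series_inverse_squares as [l Hl]. eexists. apply (is_series_scal (/ (1 - b ^ 2)) _ _ Hl).
  - destruct ex_series_inverse_squares as [l Hl]. eexists. apply (is_series_scal (/ (1 - b ^ 2)) _ _ Hl).
Qed.

Lemma remainder_sum_small (t : R) : 0 <= t <= 1 / 2 ->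
  Rabs (remainder_sum t) <= 4 / 3 * Series (fun i => / INR (S i) ^ 2) * t.
Proof.
  intros Ht.
  pose proof (Series_correct _ ex_series_inverse_squares) as HS.
  assert (Hsq : forall i, 0 <= / INR (S i) ^ 2).
  { intros i. left. apply inverse_square_pos. }
  assert (E0 : remainder_sum 0 = 0).
  { unfold remainder_sum. rewrite (Series_ext _ (fun _ => 0)) by (intros; apply remainder_derivative_0).
    apply Series_0. }
  pose proof (primitive_limit_lipschitz _ _ 0 (1 / 2)
    (4 / 3 * Series (fun i => / INR (S i) ^ 2)) 0 t (remainder_sum_primitive (1 / 2) ltac:(lra))) as L.
  rewrite E0, !Rminus_0_r in L. apply L; try lra.
  intros s Hs. apply Rabs_Series_le. intros n.
  apply Rle_trans with (sum_n (fun i => 4 / 3 * / INR (S i) ^ 2) n).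
  - apply Rsum_le. intros i.
    eapply Rle_trans; [apply (remainder_log_bound (1 / 2) s i); lra|].
    apply Req_le. f_equal. field.
  - rewrite Rsum_scal. apply Rmult_le_compat_l; [lra|].
    apply (sum_le_series _ _ Hsq HS).
Qed.

Lemma clausen_sin_small (eps : R) : 0 < eps ->
  exists eta, 0 < eta /\ forall t, 0 <= t <= eta -> Rabs (clausen_sin t) <= eps.
Proof.
  intros Heps. destruct (small_threshold eps Heps) as [N [eta [HN [Heta H]]]].
  exists eta. split; [lra|]. intros t Ht. unfold clausen_sin. apply Rabs_Series_le. intros n.
  eapply Rle_trans; [apply (small_over_squares (fun i => sin (INR (S i) * t)) eta N HN ltac:(lra))|exact H].
  intros i. assert (Hit : 0 <= INR (S i) * t) by (apply Rmult_le_pos; [apply pos_INR|lra]).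
  apply Rmin_glb.
  - apply Rabs_le_between, SIN_bound.
  - apply Rle_trans with (INR (S i) * t).
    + set (v := INR (S i) * t) in *. apply Rabs_le_between. split; [|now apply sin_lt_self].
      destruct (Rle_lt_dec v 3) as [L|L].
      * assert (0 <= sin v) by (apply sin_ge_0; pose proof PI2_3_2; lra). lra.
      * pose proof (SIN_bound v). lra.
    + apply Rmult_le_compat_l; [apply pos_INR|lra].
Qed.

Lemma mul_ln_small (x : R) : 0 < x <= 1 -> Rabs (x * ln x) <= 2 * sqrt x.
Proof.
  intros Hx. pose proof (sqrt_lt_R0 x ltac:(lra)) as Hs.
  assert (Es : sqrt x * sqrt x = x) by (apply sqrt_sqrt; lra).
  assert (Hln : ln x <= 0) by (rewrite <- ln_1; apply ln_le; lra).
  rewrite Rabs_left1 by nra.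
  pose proof (ln_le_sub_1 (/ sqrt x) ltac:(now apply Rinv_0_lt_compat)) as H.
  rewrite ln_Rinv in H by exact Hs.
  assert (E2 : ln x = 2 * ln (sqrt x)) by (rewrite <- Es at 1; rewrite ln_mult by exact Hs; ring).
  rewrite E2. apply Rle_trans with (x * (2 * / sqrt x)); [nra|].
  apply Req_le. rewrite <- Es at 1. field. lra.
Qed.

(** On the left the derivative is [- ln x - 1 - sum ln (1 - x^2/n^2)], which is
    [- ln (sin (PI x))] plus a constant by the product for the sine; the Clausen
    term has the derivative [- ln (2 sin (PI x))]. *)
Lemma remainder_minus_clausen_affine : exists C0 C1 : R, forall x, 0 < x < 1 ->
  remainder_sum x - x * ln x - / (2 * PI) * clausen_sin (2 * PI * x) = C0 + C1 * x.
Proof.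
  pose proof PI_RGT_0 as HPI. set (c := ln (2 * PI) - 1).
  set (Z := fun x => remainder_sum x - x * ln x - / (2 * PI) * clausen_sin (2 * PI * x) - c * x).
  assert (Hc : forall x y, 0 < x -> x <= y -> y < 1 -> Z x = Z y).
  { intros x y Hx Hxy Hy. apply (primitive_limit_zero Z x y); [|lra|lra].
    assert (H1 : primitive_limit remainder_sum
              (fun t => Series (fun i => - ln (1 - t ^ 2 / INR (S i) ^ 2))) x y).
    { intros eps Heps. destruct (remainder_sum_primitive y ltac:(lra) eps Heps) as [u [u' [D E]]].
      exists u, u'. split; intros t Ht; [apply D|apply E]; lra. }
    assert (H2 : primitive_limit (fun t => t * ln t) (fun t => ln t + 1) x y).
    { apply primitive_limit_derive. intros t Ht. auto_derive; [lra|field; lra]. }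
    assert (H3 : primitive_limit (fun t => / (2 * PI) * clausen_sin (2 * PI * t))
              (fun t => - ln (2 * sin (2 * PI * t / 2))) x y).
    { apply (primitive_limit_dilate clausen_sin (fun t => - ln (2 * sin (t / 2)))); [lra|].
      apply primitive_limit_clausen_sin; nra. }
    assert (H4 : primitive_limit (fun t => c * t) (fun _ => c) x y).
    { apply primitive_limit_derive. intros t _. auto_derive; [exact I|ring]. }
    pose proof (primitive_limit_minus _ _ _ _ _ _ (primitive_limit_minus _ _ _ _ _ _
      (primitive_limit_minus _ _ _ _ _ _ H1 H2) H3) H4) as H.
    eapply primitive_limit_ext; [| |exact H]; intros t Ht; cbv beta; [reflexivity|].
    rewrite Series_opp, (is_series_unique _ _ (ln_sine_product t ltac:(lra))).
    replace (2 * PI * t / 2) with (PI * t) by field.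
    assert (Hs : 0 < sin (PI * t)) by (apply sin_gt_0; nra).
    unfold c. rewrite ln_div by nra. rewrite !ln_mult by lra. ring. }
  exists (Z (1 / 2)), c. intros x Hx.
  assert (E : Z x = Z (1 / 2)).
  { destruct (Rle_lt_dec x (1 / 2)); [apply Hc; lra|symmetry; apply Hc; lra]. }
  rewrite <- E. unfold Z. ring.
Qed.

Lemma clausen_sin_nat_PI (n : nat) : clausen_sin (INR n * PI) = 0.
Proof.
  unfold clausen_sin. rewrite (Series_ext _ (fun _ => 0)).
  - apply Series_0.
  - intros i. replace (sin (INR (S i) * (INR n * PI))) with 0; [unfold Rdiv; ring|].
    symmetry. apply sin_eq_0_1. exists (Z.of_nat (S i * n)).
    rewrite <- INR_IZR_INZ, mult_INR. ring.
Qed.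

(** The affine discrepancy vanishes at [0+] and, both sides being odd about [1/2],
    at [1/2]; hence everywhere. *)
Lemma hurwitz_clausen (zeta : C -> R -> C) (x : R) : is_hurwitz_zeta zeta -> 0 < x < 1 ->
  (dzeta zeta (RtoC (-1)) x - dzeta zeta (RtoC (-1)) (1 - x))%C
  = RtoC (/ (2 * PI) * clausen_sin (2 * PI * x)).
Proof.
  intros Hz Hx. pose proof PI_RGT_0 as HPI.
  destruct remainder_minus_clausen_affine as [C0 [C1 HC]].
  set (lam := C_derive (shifted_zeta zeta) (RtoC (-1))).
  assert (HF : forall y, 0 < y < 1 ->
    (dzeta zeta (RtoC (-1)) y - dzeta zeta (RtoC (-1)) (1 - y))%C
    = (RtoC (/ (2 * PI) * clausen_sin (2 * PI * y) + C0 + C1 * y) - RtoC (2 * y) * lam)%C).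
  { intros y Hy. rewrite (hurwitz_odd_derivative zeta Hz y Hy). fold (remainder_sum y) lam.
    f_equal. f_equal. specialize (HC y Hy). lra. }
  (* every other term of [HC] tends to [0] with [x] *)
  assert (HC0 : C0 = 0).
  { apply Rabs_eq_0. apply Rle_antisym; [|apply Rabs_pos].
    apply Rle_plus_epsilon. intros eps Heps. rewrite Rplus_0_l.
    destruct (clausen_sin_small (eps / 4) ltac:(lra)) as [eta [Heta Hs]].
    set (S2 := 4 / 3 * Series (fun i => / INR (S i) ^ 2)).
    set (q := S2 + Rabs C1 + 2).
    assert (HS2 : 0 <= S2).
    { unfold S2. apply Rmult_le_pos; [lra|].
      apply Rle_trans with (sum_n (fun i => / INR (S i) ^ 2) 0).
      - rewrite sum_O. simpl. lra.
      - apply sum_le_series; [|apply Series_correct, ex_series_inverse_squares].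
        intros i. left. apply inverse_square_pos. }
    pose proof (Rabs_pos C1) as HC1. assert (Hq : 0 < q) by (unfold q; lra).
    set (y := Rmin (1 / 2) (Rmin (eta / (2 * PI)) ((eps / (4 * q)) ^ 2))).
    assert (Y1 : y <= 1 / 2) by apply Rmin_l.
    assert (Y' : y <= Rmin (eta / (2 * PI)) ((eps / (4 * q)) ^ 2)) by apply Rmin_r.
    pose proof (Rle_trans _ _ _ Y' (Rmin_l _ _)) as Y2.
    pose proof (Rle_trans _ _ _ Y' (Rmin_r _ _)) as Y3.
    assert (Hq4 : 0 < eps / (4 * q)) by (apply Rdiv_lt_0_compat; lra).
    assert (Y0 : 0 < y).
    { repeat apply Rmin_glb_lt; [lra|apply Rdiv_lt_0_compat; lra|now apply pow_lt]. }
    specialize (HC y ltac:(lra)).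
    pose proof (remainder_sum_small y ltac:(lra)) as B1. fold S2 in B1.
    pose proof (mul_ln_small y ltac:(lra)) as B2.
    pose proof (sqrt_pos y) as Hsy.
    assert (Hy1 : sqrt y <= 1) by (rewrite <- sqrt_1; apply sqrt_le_1_alt; lra).
    assert (Hyy : y <= sqrt y) by (rewrite <- (sqrt_sqrt y) at 1 by lra; nra).
    assert (B5 : q * sqrt y <= eps / 4).
    { replace (eps / 4) with (q * (eps / (4 * q))) by (field; lra).
      apply Rmult_le_compat_l; [lra|]. rewrite <- (sqrt_pow2 (eps / (4 * q))) by lra.
      now apply sqrt_le_1_alt. }
    assert (B3 : Rabs (clausen_sin (2 * PI * y)) <= eps / 4).
    { apply Hs. split; [nra|].
      replace eta with (2 * PI * (eta / (2 * PI))) by (field; lra).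
      apply Rmult_le_compat_l; lra. }
    assert (B3' : Rabs (/ (2 * PI) * clausen_sin (2 * PI * y)) <= eps / 4).
    { assert (Hi : 0 < / (2 * PI) <= 1).
      { split; [apply Rinv_0_lt_compat; lra|]. rewrite <- Rinv_1.
        apply Rinv_le_contravar; pose proof PI2_3_2; lra. }
      rewrite Rabs_mult, (Rabs_pos_eq (/ (2 * PI))) by lra.
      pose proof (Rabs_pos (clausen_sin (2 * PI * y))). nra. }
    assert (B4 : Rabs (C1 * y) <= Rabs C1 * sqrt y).
    { rewrite Rabs_mult, (Rabs_pos_eq y) by lra. apply Rmult_le_compat_l; lra. }
    assert (B1' : S2 * y <= S2 * sqrt y) by (apply Rmult_le_compat_l; lra).
    assert (E5 : q * sqrt y = S2 * sqrt y + Rabs C1 * sqrt y + 2 * sqrt y) by (unfold q; ring).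
    replace C0 with (remainder_sum y - y * ln y - / (2 * PI) * clausen_sin (2 * PI * y) - C1 * y) by lra.
    apply Rabs_le_between in B1, B2, B3', B4. apply Rabs_le_between. lra. }
  (* at [1/2] the left side is a difference of equal terms *)
  pose proof (HF (1 / 2) ltac:(lra)) as Hh.
  replace (1 - 1 / 2) with (1 / 2) in Hh by field.
  replace (2 * PI * (1 / 2)) with PI in Hh by field.
  replace (2 * (1 / 2)) with 1 in Hh by field.
  replace (clausen_sin PI) with 0 in Hh
    by (rewrite <- (clausen_sin_nat_PI 1); f_equal; simpl; ring).
  rewrite HC0 in Hh.
  replace (/ (2 * PI) * 0 + 0 + C1 * (1 / 2)) with (C1 / 2) in Hh by (field; lra).
  assert (Hlam : lam = RtoC (C1 / 2)).
  { set (d := dzeta zeta (RtoC (-1)) (1 / 2)) in Hh.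
    replace lam with (RtoC (C1 / 2) - (RtoC (C1 / 2) - RtoC 1 * lam))%C by ring.
    rewrite <- Hh. ring. }
  rewrite (HF x Hx), Hlam, HC0, <- RtoC_mult, <- RtoC_minus. f_equal. field. lra.
Qed.

(** * The asymptotic formula *)

Lemma phase_series_hurwitz (zeta : C -> R -> C) (K b : Z) :
  is_hurwitz_zeta zeta -> (1 <= b)%Z -> (b <= K)%Z ->
  Cseries (phase_term (IZR b / IZR K))
    (RtoC (PI ^ 2 * (IZR b ^ 2 / IZR K ^ 2 - IZR b / IZR K + 1 / 6))
     + RtoC (2 * PI) * Ci
       * (- dzeta zeta (RtoC (-1)) (IZR b / IZR K)
          + dzeta zeta (RtoC (-1)) (IZR (bstar K b) / IZR K)))%C.
Proof.
  intros Hz Hb HbK. pose proof PI_RGT_0 as HPI.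
  assert (Rb : 1 <= IZR b) by now apply (IZR_le 1).
  assert (RbK : IZR b <= IZR K) by now apply IZR_le.
  set (x := IZR b / IZR K).
  assert (Hx : 0 < x <= 1).
  { split; [apply Rdiv_lt_0_compat; lra|]. apply Rle_div_l; lra. }
  replace (IZR b ^ 2 / IZR K ^ 2 - x + 1 / 6) with (x ^ 2 - x + 1 / 6)
    by (unfold x; field; lra).
  rewrite <- (clausen_cos_bernoulli x Hx).
  assert (Hd : (- dzeta zeta (RtoC (-1)) x + dzeta zeta (RtoC (-1)) (IZR (bstar K b) / IZR K))%C
               = RtoC (- (/ (2 * PI) * clausen_sin (2 * PI * x)))).
  { unfold bstar. destruct (Z.eqb_spec b K) as [->|Hne].
    - assert (x1 : x = 1) by (unfold x; field; lra).
      fold x. rewrite x1, Rmult_1_r,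
        (clausen_sin_nat_PI 2 : clausen_sin (2 * PI) = 0), Rmult_0_r, Ropp_0. ring.
    - assert (IZR b < IZR K) by (apply IZR_lt; lia).
      replace (IZR (K - b) / IZR K) with (1 - x) by (rewrite minus_IZR; unfold x; field; lra).
      assert (x < 1) by (apply Rlt_div_l; lra).
      rewrite RtoC_opp, <- (hurwitz_clausen zeta x Hz ltac:(lra)). ring. }
  rewrite Hd.
  replace (RtoC (clausen_cos (2 * PI * x))
    + RtoC (2 * PI) * Ci * RtoC (- (/ (2 * PI) * clausen_sin (2 * PI * x))))%C
    with ((clausen_cos (2 * PI * x), - clausen_sin (2 * PI * x)) : C); [apply phase_series|].
  unfold Ci, RtoC, Cplus, Cmult. cbn [fst snd]. f_equal; field; lra.
Qed.

Theorem theorem1p1 :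
  forall zeta : C -> R -> C, is_hurwitz_zeta zeta ->
  exists X0 : R,
  forall M : Z, (1 <= M)%Z ->
  exists B : R,
  forall X : R, 16 <= X -> X0 <= X ->
  forall h k : Z, (1 <= h)%Z -> (h <= k)%Z -> (k <= Nof X)%Z ->
    Z.gcd h k = 1%Z ->
  forall Y : R, Rabs Y <= 1 / (IZR k * IZR (Nof X)) ->
  forall a : Z, (1 <= a)%Z -> (a <= M)%Z ->
  forall b : Z, (1 <= b)%Z -> (b <= Z.gcd k M)%Z ->
    (b mod Z.gcd k M = (- (h * a)) mod Z.gcd k M)%Z ->
  exists E : C,
    Phi a M (qpt X Y h k) = (main_term zeta M X Y k b + E)%C /\
    Rabs (Re E) <= B * (sqrt X * ln X).
Proof.
  intros zeta Hz. exists 16. intros M HM.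
  destruct (Phi_polar_estimate M HM) as [B HB]. exists B.
  intros X HX _ h k Hh Hhk HkN Hgcd Y HY a Ha HaM b Hb HbK Hmod.
  exists (Phi a M (qpt X Y h k) - main_term zeta M X Y k b)%C. split; [ring|].
  eapply Rle_trans; [apply re_le_Cmod|].
  apply (HB X HX h k ltac:(lia) HkN Hgcd Y HY a ltac:(lia) b Hmod).
  now apply phase_series_hurwitz.
Qed.
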